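(* Let $U\subset\mathbb R^2$ be a bounded simply connected closed domain with smooth boundary $\partial U$, with exterior unit normal $n$ and arc-length element $d\gamma$. Let $\psi^{(1)},\psi^{(2)}:U\to\mathbb R$ be two smooth initial conditions with $\psi^{(1)}(u)\ge\psi^{(2)}(u)$ for every $u\in U$ and $\psi^{(1)}|_{\partial U}=\psi^{(2)}|_{\partial U}$. Then $$\int_{\partial U}\left[W(\nabla\psi^{(1)})-W(\nabla\psi^{(2)})\right]\cdot n\;d\gamma\le 0 .$$ Moreover, let $\psi^{(1)}(u,t),\psi^{(2)}(u,t)$ be the solutions of $$\partial_t\psi=\mu(\nabla\psi)\sum_{i,j=1,2}\sigma_{i,j}(\nabla\psi)\,\frac{\partial^2\psi}{\partial u_i\partial u_j}$$ with these initial conditions and with boundary values on $\partial U$ kept fixed in time, and let $\mathcal V(\psi)=\int_U\psi(u)\,du$. Then for all $t\geq 0$ $$\frac{d}{dt}\left(\mathcal V(\psi^{(1)}(\cdot,t))-\mathcal V(\psi^{(2)}(\cdot,t))\right)=\int_{\partial U}\left[W(\nabla\psi^{(1)}(u,t))-W(\nabla\psi^{(2)}(u,t))\right]\cdot n\;d\gamma\le 0 .$$ Here $\mu,\sigma_{i,j},W$ are as in the context.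
   Context: Let $\mathbb T\subset\mathbb R^2$ be the open triangle with vertices $(0,0),(1,0),(0,1)$. For $\rho=(\rho_1,\rho_2)\in\mathbb T$: $$\sigma(\rho)=\frac1\pi\left[\Lambda(\pi\rho_1)+\Lambda(\pi\rho_2)+\Lambda(\pi(1-\rho_1-\rho_2))\right],\qquad \Lambda(\theta)=\int_0^\theta\ln(2\sin t)\,dt,$$ $\sigma_{i,j}=\partial^2\sigma/\partial\rho_i\partial\rho_j$, i.e. $\sigma_{i,i}(\rho)=\pi\cot(\pi\rho_i)+\pi\cot(\pi(1-\rho_1-\rho_2))$ and $\sigma_{1,2}(\rho)=\sigma_{2,1}(\rho)=\pi\cot(\pi(1-\rho_1-\rho_2))$; and $$\mu(\rho)=\frac1{2\pi}\frac{\sin(\pi\rho_1)\sin(\pi\rho_2)}{\sin(\pi(1-\rho_1-\rho_2))}.$$ The vector field $W=(W^{(1)},W^{(2)})$ on $\mathbb T$ is $$W^{(1)}(\rho_1,\rho_2)=-\frac1{2\pi}\cot(\pi(\rho_1+\rho_2))\sin^2(\pi\rho_2)-\frac{\rho_2}4+\frac1{4\pi}\sin(2\pi\rho_2),\qquad W^{(2)}(\rho_1,\rho_2)=W^{(1)}(\rho_2,\rho_1).$$ Throughout, initial conditions satisfy $\nabla\psi(u)\in\mathbb T$ for all $u\in U$, and it is assumed that the equation with the given initial and boundary data admits a unique classical solution, $C^1$ on $U\times[0,\infty)$ ($U$ closed), with $\nabla\psi(u,t)\in\mathbb T$ for all $u\in U$, $t\ge0$. *)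

(* Defs.v *)
(* MathComp-Analysis. *)
From HB Require Import structures.
From mathcomp Require Import all_boot all_order all_algebra.
From mathcomp Require Import all_classical all_reals all_analysis.
Set Implicit Arguments.
Unset Strict Implicit.
Unset Printing Implicit Defensive.
Import Order.TTheory GRing.Theory Num.Theory.
Import numFieldNormedType.Exports.
Local Open Scope classical_set_scope.
Local Open Scope ring_scope.

Section Plane.
Variable R : realType.

Definition e2 (i : 'I_2) : R * R := if i == ord0 then (1, 0) else (0, 1).

Definition dot (x y : R * R) : R := x.1 * y.1 + x.2 * y.2.

(* [f] is C^k on the closed set [A] (meant to be the closure of its interior):
   the iterated partial derivatives of order at most [k], along the basis [B],
   exist in the interior of [A] and extend continuously to [A]. *)
Fixpoint Ck_on (V : normedModType R) (B : seq V) (A : set V) (k : nat)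
    (f : V -> R) : Prop :=
  {within A, continuous f} /\
  if k is k'.+1 then
    forall e, e \in B -> exists2 g : V -> R,
      Ck_on B A k' g & forall v, A° v -> is_derive v e f (g v)
  else True.

Definition smooth_on (A : set (R * R)) (f : R * R -> R) :=
  forall k, Ck_on [:: e2 0; e2 1] A k f.

(* The gradient of [f] on the closed domain [U]; at a boundary point it is the
   limit of the gradient taken from the interior of [U]. *)
Definition grad (U : set (R * R)) (f : R * R -> R) (u : R * R) : R * R :=
  (lim ('D_(e2 0) f v @[v --> within U° (nbhs u)]),
   lim ('D_(e2 1) f v @[v --> within U° (nbhs u)])).

Definition simply_connected (A : set (R * R)) : Prop :=
  (forall x y, A x -> A y -> exists p : R -> R * R,
    [/\ {within `[0, 1], continuous p}, p @` `[0, 1] `<=` A,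
        p 0 = x & p 1 = y]) /\
  (forall p : R -> R * R,
    {within `[0, 1], continuous p} -> p @` `[0, 1] `<=` A -> p 0 = p 1 ->
    exists H : R * R -> R * R,
    [/\ {within `[0, 1] `*` `[0, 1], continuous H},
        H @` (`[0, 1] `*` `[0, 1]) `<=` A,
        forall s, s \in `[0, 1] -> H (s, 0) = p s /\ H (s, 1) = H (0, 1) &
        forall t, t \in `[0, 1] -> H (0, t) = H (1, t)]).

Definition bdry (A : set (R * R)) : set (R * R) := closure A `\` A°.

(* [gamma], of period [L], is an arc-length parametrization of the smooth
   simple closed curve [C]. *)
Record arclength_param (C : set (R * R)) (gamma : R -> R * R) (L : R) : Prop :=
  { ap_length : 0 < L;
    ap_smooth : forall k s, derivable gamma^`(k)%classic s 1;
    ap_speed : forall s, dot (gamma^`()%classic s) (gamma^`()%classic s) = 1;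
    ap_periodic : forall s, gamma (s + L) = gamma s;
    ap_simple : {in `[0, L[ &, injective gamma};
    ap_image : gamma @` `[0, L] = C }.

(* Bounded simply connected closed domain whose boundary is smooth. By simple
   connectedness the boundary is a single closed curve; [gamma] is any of its
   arc-length parametrizations, of either orientation. *)
Record smooth_sc_domain (U : set (R * R)) (gamma : R -> R * R) (L : R) : Prop :=
  { dom_nonempty : U !=set0;
    dom_bounded : bounded_set U;
    dom_closure : closure U° = U;
    dom_connected : connected U°;
    dom_simply_connected : simply_connected U;
    dom_boundary : arclength_param (bdry U) gamma L }.

Definition exterior_unit_normal (U : set (R * R)) (gamma : R -> R * R)
    (nu : R * R -> R * R) : Prop :=
  forall s, let u := gamma s in
    [/\ dot (nu u) (nu u) = 1, dot (nu u) (gamma^`()%classic s) = 0 &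
        \forall eps \near 0^'+, ~ U (u + eps *: nu u)].

(* Integral of [f] over a closed curve with respect to arc length. *)
Definition curve_integral (gamma : R -> R * R) (L : R) (f : R * R -> R) : R :=
  \int[lebesgue_measure]_(s in `[0, L]) f (gamma s).

Definition volume (U : set (R * R)) (f : R * R -> R) : R :=
  \int[(@lebesgue_measure R \x @lebesgue_measure R)%E]_(u in U) f u.

Definition triangle : set (R * R) :=
  [set rho | [/\ 0 < rho.1, 0 < rho.2 & rho.1 + rho.2 < 1]].

Definition cot (x : R) : R := cos x / sin x.

Definition Lobachevsky (theta : R) : R :=
  \int[lebesgue_measure]_(t in `[0, theta]) ln (2 * sin t).

Definition sigma (rho : R * R) : R :=
  pi^-1 * (Lobachevsky (pi * rho.1) + Lobachevsky (pi * rho.2)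
           + Lobachevsky (pi * (1 - rho.1 - rho.2))).

Definition sigma2 (i j : 'I_2) (rho : R * R) : R :=
  'D_(e2 i) ('D_(e2 j) sigma) rho.

Definition mu (rho : R * R) : R :=
  (2 * pi)^-1 * (sin (pi * rho.1) * sin (pi * rho.2)
                 / sin (pi * (1 - rho.1 - rho.2))).

Definition W1 (r1 r2 : R) : R :=
  - (2 * pi)^-1 * cot (pi * (r1 + r2)) * sin (pi * r2) ^+ 2
  - r2 / 4 + (4 * pi)^-1 * sin (2 * pi * r2).

Definition W (rho : R * R) : R * R := (W1 rho.1 rho.2, W1 rho.2 rho.1).

(* [psi u t] is a classical solution on [U] x [0, +oo) with initial datum
   [psi0] and boundary values fixed in time: C^1 up to the boundary and up to
   time 0, with continuous second space derivatives and the equation holding in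
   the interior of [U] at positive times. *)
Record classical_solution (U : set (R * R)) (psi0 : R * R -> R)
    (psi : R * R -> R -> R) : Prop :=
  { sol_C1 : Ck_on [:: (e2 0, 0); (e2 1, 0); ((0, 0), 1) : R * R * R]
               (U `*` [set t | 0 <= t]) 1
               (fun p : (R * R) * R => psi p.1 p.2);
    sol_C2 : forall (i j : 'I_2) u t, U° u -> 0 < t ->
      derivable ('D_(e2 j) (psi ^~ t)) u (e2 i) /\
      {for (u, t), continuous (fun p : (R * R) * R =>
         'D_(e2 i) ('D_(e2 j) (psi ^~ p.2)) p.1)};
    sol_triangle : forall u t, U u -> 0 <= t ->
      triangle (grad U (psi ^~ t) u);
    sol_eq : forall u t, U° u -> 0 < t ->
      (psi u)^`()%classic t =
        mu (grad U (psi ^~ t) u) *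
        \sum_(i < 2) \sum_(j < 2)
          sigma2 i j (grad U (psi ^~ t) u)
          * 'D_(e2 i) ('D_(e2 j) (psi ^~ t)) u;
    sol_init : forall u, U u -> psi u 0 = psi0 u;
    sol_bdry : forall u t, bdry U u -> 0 <= t -> psi u t = psi0 u }.

(* Derivative at [t] of a function of time considered on [0, +oo) only; it is
   the right derivative when [t = 0]. *)
Definition is_time_derivative (F : R -> R) (t l : R) : Prop :=
  (fun h => h^-1 * (F (t + h) - F t)) @ within [set h | 0 <= t + h] 0^' --> l.

End Plane.

(* Main.v *)
Require Import Defs.
From HB Require Import structures.
From mathcomp Require Import all_boot all_order all_algebra.
From mathcomp Require Import all_classical all_reals all_analysis.
From mathcomp Require Import measurable_realfun.
From mathcomp Require Import lra ring.
Import Order.TTheory GRing.Theory Num.Theory.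
Import numFieldNormedType.Exports.
Local Open Scope classical_set_scope.
Local Open Scope ring_scope.
Set Implicit Arguments.
Unset Strict Implicit.
Unset Printing Implicit Defensive.

(** At a boundary point the gradients of psi1 and psi2 have the same tangential part,
    since the boundary values coincide, and psi1 >= psi2 inside U orders their normal
    parts: grad psi1 = grad psi2 - l n with l >= 0 ([boundary_gradient]). The symmetric
    part of the Jacobian matrix of W is mu times the Hessian matrix of sigma, which is
    positive definite on the triangle, a convex set; hence W (r - l n) . n <= W (r) . n
    ([W_monotone]). So the boundary integrand is pointwise nonpositive
    ([flux_comparison]), which is the first assertion. For the solutions at time t it
    remains to know that their order is preserved: the equation is parabolic and
    Psi1 - Psi2 + e t cannot have an interior minimum ([comparison]).

    For the same reason as above, mu times the sum of the sigma_ij psi_ij is the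
    divergence of W (grad psi) ([pde_operator], with the symmetry of second derivatives).
    The volume is differentiated under the integral sign ([volume_derive]), and the
    divergence theorem turns the integral of the time derivative into the boundary flux
    at positive times; at time 0 both sides are limits ([area_flux]).

    The divergence theorem is needed for fields that are C^1 inside U only, with a
    divergence that extends continuously to U, because the second derivatives of a
    solution are not controlled at the boundary. Near a boundary point, the boundary is
    a graph over one of the axes ([chart_exists]) and the coordinates (arc length,
    depth) flatten it; there the theorem reduces to a rectangle
    ([rectangle_divergence]). Bumps on a finite cover of U reduce the general case to
    this one ([cover_weight], [divergence_theorem]). *)

(** * Integration over compact sets of the plane *)

Lemma nbhs_box (R : realType) (u : R * R) (A : set (R * R)) :
  nbhs u A <-> exists2 r : R, 0 < r &
    forall v, `|v.1 - u.1| < r -> `|v.2 - u.2| < r -> A v.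
Proof.
split.
  move=> /nbhs_ballP[r /= r0 rA]; exists r => // v v1 v2; apply: rA.
  by split; rewrite /ball/= distrC.
move=> [r r0 rA]; apply/nbhs_ballP; exists r => //= v [].
by rewrite /ball/= => v1 v2; apply: rA; rewrite distrC.
Qed.

(** An open set is the union of the rational boxes that it contains, a countable family. *)
Lemma open_measurable2 (R : realType) (A : set (R * R)) : open A ->
  measurable (A : set (measurableTypeR R * measurableTypeR R)).
Proof.
move=> oA.
pose box (q : (rat * rat) * (rat * rat)) : set (R * R) :=
  `]ratr q.1.1, ratr q.1.2[ `*` `]ratr q.2.1, ratr q.2.2[.
pose F q := if `[< box q `<=` A >] then box q else set0.
have -> : A = \bigcup_q F q.
  apply/seteqP; split => [u Au|u [q _]]; last first.
    by rewrite /F; case: ifPn => // /asboolP; apply.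
  have /nbhs_box[r r0 rA] : nbhs u A by exact: open_nbhs_nbhs.
  have [a] := @rat_in_itvoo R (u.1 - r) u.1 ltac:(lra).
  have [b] := @rat_in_itvoo R u.1 (u.1 + r) ltac:(lra).
  have [c] := @rat_in_itvoo R (u.2 - r) u.2 ltac:(lra).
  have [d] := @rat_in_itvoo R u.2 (u.2 + r) ltac:(lra).
  rewrite !in_itv/= => /andP[d1 d2] /andP[c1 c2] /andP[b1 b2] /andP[a1 a2].
  exists ((a, b), (c, d)) => //; rewrite /F ifT.
    by split; rewrite /= in_itv/=; apply/andP; split.
  apply/asboolP => v [] /=; rewrite !in_itv/= => /andP[v1 v2] /andP[w1 w2].
  by apply: rA; rewrite ltr_norml; apply/andP; split; lra.
apply: countable_bigcupT_measurable => [|q]; first exact: countableP.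
rewrite /F; case: ifPn => // _.
by apply: measurableX; exact: measurable_itv.
Qed.

Lemma closed_measurable2 (R : realType) (A : set (R * R)) : closed A ->
  measurable (A : set (measurableTypeR R * measurableTypeR R)).
Proof.
move=> cA; rewrite -(setCK A); apply: measurableC.
by apply: open_measurable2; exact: closed_openC.
Qed.

Lemma compact_measurable2 (R : realType) (K : set (R * R)) : compact K ->
  measurable (K : set (measurableTypeR R * measurableTypeR R)).
Proof.
by move=> cK; apply: closed_measurable2; exact: compact_closed.
Qed.

Lemma continuous_measurable2 (R : realType) (K : set (R * R)) (f : R * R -> R) :
  compact K -> {within K, continuous f} ->
  measurable_fun (K : set (measurableTypeR R * measurableTypeR R)) (f : _ -> R).
Proof.
move=> cK /continuousP cf; apply: (measurability _ (RGenOpens.measurableE R)).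
move=> _ [_ [a [b ->] <-]].
have oab : open `]a, b[%classic by exact: interval_open.
have /open_subspaceP[V oV VK] : open (f @^-1` `]a, b[ : set (subspace K)).
  exact: (cf _ oab).
rewrite setIC -VK; apply: measurableI; first exact: open_measurable2.
exact: compact_measurable2.
Qed.

Lemma bounded_box (R : realType) (A : set (R * R)) : bounded_set A ->
  exists2 M, 0 < M & A `<=` `[- M, M] `*` `[- M, M].
Proof.
move=> [M [_ AM]]; exists (`|M| + 1); first by rewrite ltr_wpDl.
move=> u Au; have := AM (`|M| + 1) _ _ Au; rewrite (le_lt_trans (ler_norm M)) ?ltrDl//.
move=> /(_ isT) /= h; split; rewrite /= in_itv/= -ler_norml; apply: le_trans h.
  by rewrite prod_normE/= le_max lexx.
by rewrite prod_normE/= le_max lexx orbT.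
Qed.

Lemma compact_measure_fin (R : realType) (K : set (R * R)) : compact K ->
  ((@lebesgue_measure R \x @lebesgue_measure R)%E K < +oo)%E.
Proof.
move=> cK; have [M M0 KM] := bounded_box (compact_bounded cK).
apply: (@le_lt_trans _ _ ((@lebesgue_measure R \x @lebesgue_measure R)%E
  (`[- M, M] `*` `[- M, M]))).
  apply: le_measure => //; rewrite inE; first exact: compact_measurable2.
  by apply: measurableX; exact: measurable_itv.
rewrite [ltLHS]product_measure1E; try exact: measurable_itv.
have lM : lebesgue_measure (`[- M, M] : set R) = (M + M)%:E.
  by rewrite lebesgue_measure_itv/= lte_fin gtrN // -EFinD opprK.
rewrite [ltLHS](_ : _ = (M + M)%:E * (M + M)%:E)%E ?ltry//.
by congr (_ * _)%E; exact: lM.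
Qed.

Lemma integrable2 (R : realType) (K : set (R * R)) (f : R * R -> R) :
  compact K -> {within K, continuous f} ->
  (@lebesgue_measure R \x @lebesgue_measure R)%E.-integrable K (EFin \o f).
Proof.
move=> cK cf; apply: measurable_bounded_integrable.
- exact: compact_measurable2.
- exact: compact_measure_fin.
- exact: continuous_measurable2.
- have /compact_bounded[M [_ mrt]] := continuous_compact cf cK.
  by exists M; split; rewrite ?num_real // => ? ? ? ?; exact: mrt.
Qed.

Lemma Rintegral_restrict d (T : measurableType d) (R : realType)
    (mu : {measure set T -> \bar R}) (A B : set T) (f : T -> R) :
  A `<=` B -> (forall x, B x -> ~ A x -> f x = 0) ->
  \int[mu]_(x in B) f x = \int[mu]_(x in A) f x.
Proof.
move=> AB f0; rewrite [LHS]Rintegral_mkcond [RHS]Rintegral_mkcond.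
congr (Rintegral _ _ _); apply/funext => x; rewrite !patchE.
case: ifPn => xB; case: ifPn => xA //.
  by rewrite !inE in xB; apply: f0 => //; move/negP: xA; rewrite inE.
by exfalso; move/negP: xB; apply; rewrite inE; apply: AB; rewrite inE in xA.
Qed.

Lemma cvg_Rintegral_unif d (T : measurableType d) (R : realType)
    (mu : {measure set T -> \bar R}) (D : set T) (I : Type) (F : set_system I)
    (f : I -> T -> R) (g : T -> R) : Filter F ->
  measurable D -> (mu D < +oo)%E -> mu.-integrable D (EFin \o g) ->
  (\forall i \near F, mu.-integrable D (EFin \o f i)) ->
  (forall e, 0 < e -> \forall i \near F, forall x, D x -> `|f i x - g x| <= e) ->
  \int[mu]_(x in D) f i x @[i --> F] --> \int[mu]_(x in D) g x.
Proof.
move=> FF mD muD ig if_ fg; apply/cvgrPdist_le => /= e e0.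
have m0 : 0 <= fine (mu D) by exact: fine_ge0.
have : 0 < e / (fine (mu D) + 1) by rewrite divr_gt0// ltr_wpDl.
move=> /fg fg'; near=> i.
have ifi : mu.-integrable D (EFin \o f i) by near: i.
rewrite distrC -RintegralB//.
apply: le_trans (le_normr_Rintegral _ _) _ => //.
  rewrite (_ : _ \o _ = (EFin \o f i) \- (EFin \o g))%E; last by apply/funext.
  exact: integrableB.
have ii : mu.-integrable D (EFin \o (fun x => `|f i x - g x|)).
  rewrite (_ : _ \o _ = abse \o ((EFin \o f i) \- (EFin \o g)))%E; last by apply/funext.
  by apply: integrable_abse; exact: integrableB.
apply: (@le_trans _ _ (\int[mu]_(x in D) (e / (fine (mu D) + 1)))).
  apply: le_Rintegral => //; last by near: i.
  apply: measurable_bounded_integrable => //.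
  by exists `|e / (fine (mu D) + 1)|; split => //= x xM y _; exact: ltW.
rewrite Rintegral_cst// mulrAC ler_pdivrMr ?ltr_wpDl//.
by rewrite ler_pM2l// lerDl.
Unshelve. all: by end_near. Qed.

(** A boundary arc is a graph over the first or the second axis, depending on the
    place; the boolean tells over which one, so that each argument is made once. *)
Definition pt {R : realType} (i : bool) (x y : R) : R * R :=
  if i then (x, y) else (y, x).

Lemma cvg_pt (R : realType) (i : bool) (T : Type) (F : set_system T) (f g : T -> R)
    (a b : R) : Filter F ->
  f z @[z --> F] --> a -> g z @[z --> F] --> b ->
  pt i (f z) (g z) @[z --> F] --> pt i a b.
Proof.
move=> FF fa gb; apply/cvg_ballP => e e0; near=> z.
have [h1 h2] : ball a e (f z) /\ ball b e (g z).
  by split; near: z; [move/cvg_ballP: fa; apply|move/cvg_ballP: gb; apply].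
by case: i; split.
Unshelve. all: by end_near. Qed.

Lemma compact_slice (R : realType) (K : set (R * R)) i (x : R) : compact K ->
  compact [set y | K (pt i x y)].
Proof.
move=> cK; have [M M0 KM] := bounded_box (compact_bounded cK).
have cl : closed K by apply: compact_closed.
apply: (@subclosed_compact _ _ `[- M, M]%classic) => [||y Kxy].
- apply: (@closed_comp _ _ (fun y : R => pt i x y) K) => // y _.
  by apply: cvg_pt; [exact: cvg_cst|exact: cvg_id].
- exact: segment_compact.
- by case: i Kxy => /KM[].
Qed.

Lemma within_slice (R : realType) (K : set (R * R)) (f : R * R -> R) i (x : R) :
  {within K, continuous f} ->
  {within [set y | K (pt i x y)], continuous (fun y => f (pt i x y))}.
Proof.
move=> /subspace_continuousP cf; apply/subspace_continuousP => y Kxy.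
apply: (cvg_comp (pt i x) f) (cf _ Kxy).
have h : pt i x z @[z --> y] --> pt i x y.
  by apply: cvg_pt; [exact: cvg_cst|exact: cvg_id].
by move=> A; rewrite /= !/nbhs/= /within/= => /h.
Qed.

(** The slices of K are compact and f is continuous on them, so that the inner
    integrals are finite and the extended real identity descends to R. *)
Lemma Rfubini (R : realType) (K : set (R * R)) (f : R * R -> R) i :
  compact K -> {within K, continuous f} ->
  \int[(@lebesgue_measure R \x @lebesgue_measure R)%E]_(u in K) f u =
  \int[@lebesgue_measure R]_x \int[@lebesgue_measure R]_y (f \_ K) (pt i x y).
Proof.
move=> cK cf; have fi := integrable2 cK cf.
rewrite Rintegral_mkcond /Rintegral; congr fine.
transitivity (\int[@lebesgue_measure R]_x \int[@lebesgue_measure R]_y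
    ((f \_ K) (pt i x y))%:E)%E.
  have fi' : (@lebesgue_measure R \x @lebesgue_measure R)%E.-integrable setT
      (EFin \o (f \_ K)).
    rewrite -restrict_EFin; by apply: (integrable_mkcond _ _).1 => //; exact: (compact_measurable2 cK).
  by case: i; rewrite /pt; [have := integral12_prod_meas1 fi'|
                            have := integral21_prod_meas1 fi'].
apply: eq_integral => x _; rewrite fineK//.
apply: integrable_fin_num => //.
rewrite (_ : (fun _ => _) = (EFin \o ((fun y => f (pt i x y)) \_ [set y | K (pt i x y)]))).
  have cKx : compact [set y | K (pt i x y)] by exact: compact_slice.
  have h : (@lebesgue_measure R).-integrable [set y | K (pt i x y)]
      (EFin \o (fun y => f (pt i x y))).
    by apply: continuous_compact_integrable => //; exact: within_slice.
  have mKx : measurable ([set y | K (pt i x y)] : set (measurableTypeR R)).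
    exact: compact_measurable.
  by have := (integrable_mkcond _ mKx).1 h; rewrite restrict_EFin.
by apply/funext => y; rewrite /= /patch; congr EFin.
Qed.

(** * Calculus in one and two variables *)

Lemma is_derive_cvgP (R : realType) (V W : normedModType R) (f : V -> W) u e d :
  is_derive u e f d <-> h^-1 *: (f (h *: e + u) - f u) @[h --> (0:R)^'] --> d.
Proof.
split=> [[df <-]|fd]; first exact: df.
have -> : d = 'D_e f u by apply/esym/cvg_lim.
by apply/derivableP/cvg_ex; exists d.
Qed.

(** Directional derivatives are one-variable derivatives, to which the mean value
    theorem applies. *)
Lemma is_derive_lineP (R : realType) (V W : normedModType R) (f : V -> W) u e d
    (x : R) :
  is_derive (u + x *: e) e f d <-> is_derive x 1 (fun h => f (u + h *: e)) d.
Proof.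
rewrite 2!is_derive_cvgP.
suff -> : (fun h => h^-1 *: (f (h *: e + (u + x *: e)) - f (u + x *: e))) =
  (fun h => h^-1 *: (f (u + (h *: (1:R) + x) *: e) - f (u + x *: e))) by [].
by apply/funext => h; rewrite addrCA scalerDl [h *: 1]mulr1.
Qed.

Lemma is_derive_compR (R : realType) (V : normedModType R) (f : V -> R)
    (g : R -> R) u e a b :
  is_derive (f u) 1 g b -> is_derive u e f a ->
  is_derive u e (fun v => g (f v)) (b * a).
Proof.
move=> hg hf; have := hf; rewrite -{1}[u]addr0 -(scale0r e) is_derive_lineP => hf0.
rewrite -[u]addr0 -(scale0r e) is_derive_lineP.
by apply: (@is_derive1_comp _ g (fun h => f (u + h *: e))); rewrite ?scale0r ?addr0.
Qed.

Lemma is_derive_continuous (R : realType) (V : normedModType R) (f : R -> V) (s : R) d :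
  is_derive s 1 f d -> {for s, continuous f}.
Proof. by move=> [h _]; exact/differentiable_continuous/derivable1_diffP. Qed.

Lemma mvt_gen (R : realType) (f df : R -> R) (x y : R) : x != y ->
  (forall z, Num.min x y < z < Num.max x y -> is_derive z 1 f (df z)) ->
  {within `[Num.min x y, Num.max x y], continuous f} ->
  exists2 z, Num.min x y < z < Num.max x y & f y - f x = df z * (y - x).
Proof.
wlog xy : x y / x < y.
  move=> H xy fd cf; have /orP[yx|yx] : (x < y) || (y < x) by rewrite -neq_lt.
    exact: H.
  rewrite minC maxC in fd cf.
  have [|z zI zE] := H y x yx _ fd cf; first by rewrite eq_sym.
  exists z; first by rewrite minC maxC in zI.
  by rewrite -opprB zE -mulrN opprB.
move=> _; rewrite min_l ?max_r ?ltW// => fd cf.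
have [//|z zI zE] := @MVT R f df x y xy.
by exists z => //; move: zI; rewrite in_itv.
Qed.

Lemma mvt_itv (R : realType) (T : set R) (f df : R -> R) (x y : R) :
  is_interval T -> (forall z, T z -> is_derive z 1 f (df z)) -> T x -> T y ->
  exists2 z, T z /\ `|z - x| <= `|y - x| & f y - f x = df z * (y - x).
Proof.
move=> iT fd Tx Ty.
have [<-|xy] := eqVneq x y; first by exists x; rewrite ?subrr ?mulr0.
have mT z : Num.min x y <= z <= Num.max x y -> T z.
  move=> zI; have /orP[xy'|xy'] : (x < y) || (y < x) by rewrite -neq_lt.
    by apply: (iT x y) => //; move: zI; rewrite (min_l (ltW xy')) (max_r (ltW xy')).
  by apply: (iT y x) => //; move: zI; rewrite (min_r (ltW xy')) (max_l (ltW xy')).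
have [|||z zI zE] := @mvt_gen _ f df x y.
- exact: xy.
- by move=> z /andP[z1 z2]; apply: fd; apply: mT; rewrite !ltW.
- apply: continuous_in_subspaceT => z; rewrite inE/= in_itv/= => /mT/fd[h _].
  exact/differentiable_continuous/derivable1_diffP.
exists z => //; split; first by apply: mT; case/andP: zI => z1 z2; rewrite !ltW.
move: zI; have [xy'|xy'] := leP x y => /andP[z1 z2].
  by rewrite !ger0_norm ?subr_ge0// ?lerD2r ltW.
by rewrite !ltr0_norm ?subr_lt0//; lra.
Qed.

Lemma mvt_sym (R : realType) (f df : R -> R) (x y : R) :
  (forall z, `|z - x| <= `|y - x| -> is_derive z 1 f (df z)) ->
  exists2 z, `|z - x| <= `|y - x| & f y - f x = df z * (y - x).
Proof.
move=> fd; have iI : is_interval [set z : R | `|z - x| <= `|y - x|].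
  move=> u v; rewrite /= !ler_distl => /andP[u1 _] /andP[_ v2] z /andP[uz zv].
  by rewrite /= ler_distl (le_trans u1 uz) (le_trans zv v2).
have Ix : [set z : R | `|z - x| <= `|y - x|] x by rewrite /= subrr normr0.
have Iy : [set z : R | `|z - x| <= `|y - x|] y by rewrite /=.
by have [z [zI _] zE] := mvt_itv iI fd Ix Iy; exists z.
Qed.

Definition ev {R : realType} (i : bool) : R * R := pt i 1 0.

Lemma is_derive_ptP (R : realType) i (f : R * R -> R) (x y d : R) :
  is_derive (pt i x y) (ev i) f d <-> is_derive x 1 (fun z => f (pt i z y)) d.
Proof.
have -> : pt i x y = pt i 0 y + x *: ev i.
  by case: i; rewrite /ev /pt/=; congr pair; rewrite /= ?add0r ?mulr1 ?scaler0 ?addr0 //= ?[_ *: 1]mulr1.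
rewrite is_derive_lineP.
suff -> : (fun z => f (pt i z y)) = (fun h => f (pt i 0 y + h *: ev i)) by [].
apply/funext => h; congr f.
by case: i; rewrite /ev /pt/=; congr pair; rewrite /= ?add0r ?mulr1 ?scaler0 ?addr0 //= ?[_ *: 1]mulr1.
Qed.

Lemma is_derive_ptP' (R : realType) i (f : R * R -> R) (x y d : R) :
  is_derive (pt i y x) (ev (~~ i)) f d <-> is_derive x 1 (fun z => f (pt i y z)) d.
Proof. by case: i; [have := is_derive_ptP false f x y d|have := is_derive_ptP true f x y d]. Qed.

(** Move from u to v one coordinate at a time and apply the mean value theorem to
    each move; P and Q are the partial derivatives at the intermediate points. *)
Lemma increment (R : realType) (O : set (R * R)) (f p q : R * R -> R) u :
  nbhs u O ->
  (forall v, O v -> is_derive v (ev true) f (p v)) ->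
  (forall v, O v -> is_derive v (ev false) f (q v)) ->
  {for u, continuous p} -> {for u, continuous q} ->
  exists P Q : R * R -> R, [/\ P v @[v --> u] --> p u, Q v @[v --> u] --> q u &
    \forall v \near u, f v - f u = P v * (v.1 - u.1) + Q v * (v.2 - u.2)].
Proof.
move=> /nbhs_box[r r0 rO] fp fq cp cq.
have H v : exists ab : R * R, `|v.1 - u.1| < r -> `|v.2 - u.2| < r ->
    exists w1 w2 : R * R, [/\ `|w1.1 - u.1| <= `|v.1 - u.1| /\ `|w1.2 - u.2| <= `|v.2 - u.2|,
      `|w2.1 - u.1| <= `|v.1 - u.1| /\ `|w2.2 - u.2| <= `|v.2 - u.2|,
      ab.1 = p w1, ab.2 = q w2 &
      f v - f u = ab.1 * (v.1 - u.1) + ab.2 * (v.2 - u.2)].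
  have [v1|v1] := ltP `|v.1 - u.1| r; last by exists (0, 0).
  have [v2|v2] := ltP `|v.2 - u.2| r; last by exists (0, 0).
  have [x xE fx] : exists2 x, `|x - u.1| <= `|v.1 - u.1| &
      f (v.1, v.2) - f (u.1, v.2) = p (x, v.2) * (v.1 - u.1).
    apply: (@mvt_sym R (fun x => f (x, v.2)) (fun x => p (x, v.2))) => z zE.
    apply/(is_derive_ptP true); apply: fp; apply: rO => //=.
    exact: le_lt_trans zE v1.
  have [y yE fy] : exists2 y, `|y - u.2| <= `|v.2 - u.2| &
      f (u.1, v.2) - f (u.1, u.2) = q (u.1, y) * (v.2 - u.2).
    apply: (@mvt_sym R (fun y => f (u.1, y)) (fun y => q (u.1, y))) => z zE.
    apply/(is_derive_ptP' true); apply: fq; apply: rO => /=.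
      by rewrite subrr normr0.
    exact: le_lt_trans zE v2.
  exists (p (x, v.2), q (u.1, y)) => _ _.
  exists (x, v.2), (u.1, y); split => //=; first by rewrite subrr normr0.
  by rewrite -fx -fy -!surjective_pairing addrA subrK.
have [PQ hPQ] := choice H.
exists (fst \o PQ), (snd \o PQ); split => /=.
- apply/cvgrPdist_lt => e e0.
  have /cvgrPdist_lt/(_ _ e0)/nbhs_box[d d0 dp] := cp.
  apply/nbhs_box; exists (Num.min r d); first by rewrite lt_min r0.
  move=> v; rewrite !lt_min => /andP[v1 v1'] /andP[v2 v2'].
  have [w1 [w2 [[h1 h2] _ -> _ _]]] := hPQ v v1 v2.
  by apply: dp; apply: le_lt_trans; eassumption.
- apply/cvgrPdist_lt => e e0.
  have /cvgrPdist_lt/(_ _ e0)/nbhs_box[d d0 dp] := cq.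
  apply/nbhs_box; exists (Num.min r d); first by rewrite lt_min r0.
  move=> v; rewrite !lt_min => /andP[v1 v1'] /andP[v2 v2'].
  have [w1 [w2 [_ [h1 h2] _ -> _]]] := hPQ v v1 v2.
  by apply: dp; apply: le_lt_trans; eassumption.
- by apply/nbhs_box; exists r => // v v1 v2; have [w1 [w2 []]] := hPQ v v1 v2.
Qed.

Lemma chain_curve (R : realType) (O : set (R * R)) (f p q : R * R -> R)
    (c1 c2 : R -> R) (s d1 d2 : R) :
  nbhs (c1 s, c2 s) O ->
  (forall v, O v -> is_derive v (ev true) f (p v)) ->
  (forall v, O v -> is_derive v (ev false) f (q v)) ->
  {for (c1 s, c2 s), continuous p} -> {for (c1 s, c2 s), continuous q} ->
  is_derive s 1 c1 d1 -> is_derive s 1 c2 d2 ->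
  is_derive s 1 (fun z => f (c1 z, c2 z)) (p (c1 s, c2 s) * d1 + q (c1 s, c2 s) * d2).
Proof.
move=> Ou fp fq cp cq h1 h2; set u := (c1 s, c2 s) in Ou cp cq *.
have [P [Q [Pu Qu E]]] := increment Ou fp fq cp cq.
have cc (c : R -> R) d : is_derive s 1 c d -> c (h *: (1:R) + s) @[h --> (0:R)^'] --> c s.
  move=> hc; have /differentiable_continuous cd : differentiable c s.
    by apply/derivable1_diffP; have [] := hc.
  apply: (cvg_comp (fun h => h *: (1:R) + s) c _ cd).
  apply: cvg_within_filter.
  have h0 : h *: (1:R) + s @[h --> (0:R)] --> 0 *: (1:R) + s.
    by apply: cvgD; [apply: cvgZr_tmp; exact: cvg_id|exact: cvg_cst].
  by rewrite scale0r add0r in h0.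
have cu : (c1 (h *: (1:R) + s), c2 (h *: (1:R) + s)) @[h --> (0:R)^'] --> u.
  apply: (@cvg_pt R true); [exact: cc h1|exact: cc h2].
apply/is_derive_cvgP; move/is_derive_cvgP: h1 => h1; move/is_derive_cvgP: h2 => h2.
pose v h := (c1 (h *: (1:R) + s), c2 (h *: (1:R) + s)).
apply: (@cvg_trans _ ((fun h => P (v h) * (h^-1 *: (c1 (h *: (1:R) + s) - c1 s)) +
   Q (v h) * (h^-1 *: (c2 (h *: (1:R) + s) - c2 s))) @ (0:R)^')).
  have E' : \forall h \near (0:R)^', f (v h) - f u =
      P (v h) * ((v h).1 - u.1) + Q (v h) * ((v h).2 - u.2) by exact: (cu _ E).
  apply: near_eq_cvg; near=> h; rewrite -[in RHS]/(v h) (near E' h)//.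
  by rewrite /v /= /GRing.scale /=; ring.
apply: cvgD; apply: cvgM => //; [exact: cvg_comp cu Pu|exact: cvg_comp cu Qu].
Unshelve. all: by end_near. Qed.

Lemma schwarz (R : realType) (O : set (R * R)) (f p q r s : R * R -> R) u :
  nbhs u O ->
  (forall v, O v -> is_derive v (ev true) f (p v)) ->
  (forall v, O v -> is_derive v (ev false) f (q v)) ->
  (forall v, O v -> is_derive v (ev false) p (r v)) ->
  (forall v, O v -> is_derive v (ev true) q (s v)) ->
  {for u, continuous r} -> {for u, continuous s} -> r u = s u.
Proof.
move=> /nbhs_box[e e0 eO] fp fq pr qs cr cs.
suff H : forall d, 0 < d -> `|r u - s u| < d + d.
  apply/eqP; rewrite -subr_eq0 -normr_eq0; apply/negPn/negP => n0.
  have n1 : 0 < `|r u - s u| / 2 by rewrite divr_gt0// lt_def n0 normr_ge0.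
  by have := H _ n1; rewrite -splitr ltxx.
move=> d d0.
have /cvgrPdist_lt/(_ _ d0)/nbhs_box[a a0 ar] := cr.
have /cvgrPdist_lt/(_ _ d0)/nbhs_box[b b0 bs] := cs.
pose h := Num.min e (Num.min a b) / 2.
have m0 : 0 < Num.min e (Num.min a b) by rewrite !lt_min e0 a0 b0.
have h0 : 0 < h by rewrite divr_gt0.
have hm : h < Num.min e (Num.min a b) by rewrite /h ltr_pdivrMr// ltr_pMr// ltr1n.
have [he ha hb] : [/\ h < e, h < a & h < b] by move: hm; rewrite !lt_min => /and3P[].
have in1 z (x k : R) : `|z - x| <= `|x + h - x| -> h < k -> `|z - x| < k.
  by rewrite addrAC subrr add0r (gtr0_norm h0); exact: le_lt_trans.
have in0 (x k : R) : h < k -> `|x - x| < k by rewrite subrr normr0; exact: lt_trans.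
have inh (x k : R) : h < k -> `|x + h - x| < k by rewrite addrAC subrr add0r gtr0_norm.
(* the second difference of f over a square of side h, computed in two ways *)
have [x xE fx] : exists2 x, `|x - u.1| <= `|u.1 + h - u.1| &
    (f (u.1 + h, u.2 + h) - f (u.1 + h, u.2)) - (f (u.1, u.2 + h) - f (u.1, u.2))
    = (p (x, u.2 + h) - p (x, u.2)) * (u.1 + h - u.1).
  apply: (@mvt_sym R (fun x => f (x, u.2 + h) - f (x, u.2))
    (fun x => p (x, u.2 + h) - p (x, u.2))) => z zE.
  by apply: is_deriveB; apply/(is_derive_ptP true); apply: fp; apply: eO => /=; auto;
    exact: in1 zE he.
have [y yE fy] : exists2 y, `|y - u.2| <= `|u.2 + h - u.2| &
    p (x, u.2 + h) - p (x, u.2) = r (x, y) * (u.2 + h - u.2).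
  apply: (@mvt_sym R (fun y => p (x, y)) (fun y => r (x, y))) => z zE.
  by apply/(is_derive_ptP' true); apply: pr; apply: eO => /=;
    [exact: in1 xE he|exact: in1 zE he].
have [y' yE' fy'] : exists2 y, `|y - u.2| <= `|u.2 + h - u.2| &
    (f (u.1 + h, u.2 + h) - f (u.1, u.2 + h)) - (f (u.1 + h, u.2) - f (u.1, u.2))
    = (q (u.1 + h, y) - q (u.1, y)) * (u.2 + h - u.2).
  apply: (@mvt_sym R (fun y => f (u.1 + h, y) - f (u.1, y))
    (fun y => q (u.1 + h, y) - q (u.1, y))) => z zE.
  by apply: is_deriveB; apply/(is_derive_ptP' true); apply: fq; apply: eO => /=; auto;
    exact: in1 zE he.
have [x' xE' fx'] : exists2 x, `|x - u.1| <= `|u.1 + h - u.1| &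
    q (u.1 + h, y') - q (u.1, y') = s (x, y') * (u.1 + h - u.1).
  apply: (@mvt_sym R (fun x => q (x, y')) (fun x => s (x, y'))) => z zE.
  by apply/(is_derive_ptP true); apply: qs; apply: eO => /=;
    [exact: in1 zE he|exact: in1 yE' he].
have rs : r (x, y) = s (x', y').
  have hh : h * h != 0 by rewrite mulf_neq0// gt_eqF.
  apply: (mulIf hh); move: fx fy'; rewrite fy fx' => e1 e2.
  have d1 : u.1 + h - u.1 = h by ring.
  have d2 : u.2 + h - u.2 = h by ring.
  move: e1 e2; rewrite d1 d2 !mulrA => <- <-; ring.
have r1 : `|r u - r (x, y)| < d by apply: ar; [exact: in1 xE ha|exact: in1 yE ha].
have s1 : `|s u - s (x', y')| < d by apply: bs; [exact: in1 xE' hb|exact: in1 yE' hb].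
rewrite (_ : r u - s u = (r u - r (x, y)) - (s u - s (x', y'))); last by rewrite rs; ring.
by apply: le_lt_trans (ler_normB _ _) _; exact: ltrD.
Qed.

(** If D were negative, df, which vanishes at the minimum 0, would be negative just
    to the right of 0 and f would decrease there. *)
Lemma second_derivative_ge0 (R : realType) (f df : R -> R) (e D : R) : 0 < e ->
  (forall t : R, `|t| < e -> is_derive t 1 f (df t)) ->
  (forall t : R, `|t| < e -> f 0 <= f t) ->
  is_derive (0:R) 1 df D -> 0 <= D.
Proof.
move=> e0 fd fm dD.
have df0 : df 0 = 0.
  have h0 : is_derive (0:R) 1 f 0.
    apply: (@derive1_at_min R f (- e) e); first by lra.
    - by move=> t; rewrite in_itv/= -ltr_norml => /fd[].
    - by rewrite in_itv/=; lra.
    - by move=> t; rewrite in_itv/= -ltr_norml; exact: fm.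
  have h1 := fd 0; rewrite normr0 in h1.
  by have [_ e1] := h1 e0; have [_ e2] := h0; rewrite e1 in e2.
rewrite leNgt; apply/negP => D0.
move/is_derive_cvgP: dD; rewrite df0 => /cvgrPdist_lt/(_ (- D)).
rewrite oppr_gt0 => /(_ D0); rewrite near_withinE => /nbhs_ballP[d /= d0 dP].
pose t := Num.min e d / 2.
have m0 : 0 < Num.min e d by rewrite !lt_min e0 d0.
have t0 : 0 < t by rewrite divr_gt0.
have tm : t < Num.min e d by rewrite /t ltr_pdivrMr// ltr_pMr// ltr1n.
have [te td] : t < e /\ t < d by move: tm; rewrite !lt_min => /andP[].
have [z zI zE] : exists2 z, z \in `]0, t[ & f t - f 0 = df z * (t - 0).
  apply: MVT => // [z|].
    by rewrite in_itv/= => /andP[z1 z2]; apply: fd; rewrite gtr0_norm//; lra.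
  apply: continuous_in_subspaceT => z; rewrite inE/= in_itv/= => /andP[z1 z2].
  have [|h _] := fd z; first by rewrite ger0_norm//; lra.
  exact/differentiable_continuous/derivable1_diffP.
move: zI; rewrite in_itv/= => /andP[z1 z2].
have := dP z; rewrite /ball/= sub0r normrN gtr0_norm// => /(_ (lt_trans z2 td)).
rewrite gt_eqF// => /(_ isT); rewrite addr0 subr0 [z *: 1]mulr1 => h.
have : z^-1 * df z < 0 by move: h; rewrite ltr_norml opprK ltrBrDr gtrDl => /andP[].
rewrite pmulr_rlt0 ?invr_gt0// => dz.
have := fm t; rewrite gtr0_norm// => /(_ te); rewrite -subr_ge0 zE subr0.
by rewrite pmulr_lge0// leNgt dz.
Qed.

(** * Integrals with a parameter, divergence on a rectangle *)

(** Each x has a neighborhood in which the estimate holds for t close to t; the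
    compactness of K makes the choice of t uniform. *)
Lemma unif_near (R : realType) (X Y : topologicalType) (K : set X) (T : set Y)
    (f : X * Y -> R) t : compact K -> T t -> {within K `*` T, continuous f} ->
  forall e, 0 < e -> \forall t' \near within T (nbhs t),
    forall x, K x -> `|f (x, t') - f (x, t)| < e.
Proof.
move=> cK Tt /subspace_continuousP cf e e0.
have cov := (near_covering_withinP K).2 ((compact_near_coveringP K).1 cK).
suff : \forall t' \near nbhs t, K `<=` (fun x => T t' -> `|f (x, t') - f (x, t)| < e).
  by rewrite near_withinE; apply: filterS => t' h Tt' x Kx; exact: h.
apply: cov.
move=> x Kx.
have e2 : 0 < e / 2 by rewrite divr_gt0.
have /cvgrPdist_lt/(_ _ e2) := cf (x, t) (conj Kx Tt).
rewrite near_withinE => -[[A B] /= [Ax Bt] AB].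
exists (A, B) => //= -[x' t'] /= [Ax' Bt'] Kx' Tt'.
have h1 := AB (x', t') (conj Ax' Bt') (conj Kx' Tt').
have h2 := AB (x', t) (conj Ax' (nbhs_singleton Bt)) (conj Kx' Tt).
rewrite (_ : _ - _ = (f (x, t) - f (x', t)) - (f (x, t) - f (x', t'))); last by ring.
by apply: le_lt_trans (ler_normB _ _) _; rewrite [e]splitr ltrD.
Qed.

Lemma cvg_param_integral (R : realType) d (X : measurableType d) (Y : topologicalType)
    (mu : {measure set X -> \bar R}) (K : set X) (T : set Y) (f : X -> Y -> R) t :
  measurable K -> (mu K < +oo)%E -> T t ->
  (forall t, T t -> mu.-integrable K (EFin \o f ^~ t)) ->
  (forall e, 0 < e -> \forall t' \near within T (nbhs t),
    forall x, K x -> `|f x t' - f x t| < e) ->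
  \int[mu]_(x in K) f x t' @[t' --> within T (nbhs t)] --> \int[mu]_(x in K) f x t.
Proof.
move=> mK muK Tt fi uf.
apply: (cvg_Rintegral_unif (f := fun t' x => f x t')) => //; first exact: fi.
  by rewrite near_withinE; apply: filterE => t' /fi.
by move=> e /uf; apply: filterS => t' h x Kx; exact/ltW/h.
Qed.

(** A mean value inequality is assumed in place of the differentiability of f in
    time, because it passes to the limit in x and so reaches the points of K where
    f x is not known to be differentiable. *)
Lemma derive_param_integral (R : realType) d (X : measurableType d)
    (mu : {measure set X -> \bar R}) (K : set X) (T : set R) (f g : X -> R -> R) (t : R) :
  measurable K -> (mu K < +oo)%E -> T t ->
  (forall t, T t -> mu.-integrable K (EFin \o f ^~ t)) ->
  mu.-integrable K (EFin \o g ^~ t) ->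
  (forall e, 0 < e -> \forall t' \near within T (nbhs t),
    forall x, K x -> `|g x t' - g x t| < e) ->
  (forall h e, T (t + h) ->
    (forall x t', K x -> T t' -> `|t' - t| <= `|h| -> `|g x t' - g x t| <= e) ->
    forall x, K x -> `|f x (t + h) - f x t - g x t * h| <= e * `|h|) ->
  (fun h => h^-1 * (\int[mu]_(x in K) f x (t + h) - \int[mu]_(x in K) f x t)) @
    within [set h | T (t + h)] 0^' --> \int[mu]_(x in K) g x t.
Proof.
move=> mK muK Tt fi gi ug fg.
have ii h : T (t + h) -> mu.-integrable K (EFin \o (fun x => h^-1 * (f x (t + h) - f x t))).
  move=> Th.
  rewrite (_ : _ \o _ = (fun x => (h^-1)%:E * ((EFin \o f ^~ (t + h)%R) \- (EFin \o f ^~ t)) x))%E;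
    last by apply/funext.
  by apply: integrableZl => //; apply: integrableB => //; exact: fi.
apply: (@cvg_trans _ ((fun h => \int[mu]_(x in K) (h^-1 * (f x (t + h) - f x t))) @
    within [set h | T (t + h)] 0^')).
  apply: near_eq_cvg; rewrite near_withinE; apply: filterE => h /= Th.
  rewrite RintegralZl//; last first.
    rewrite (_ : _ \o _ = (EFin \o f ^~ (t + h)%R) \- (EFin \o f ^~ t))%E; last by apply/funext.
    by apply: integrableB => //; exact: fi.
  by rewrite RintegralB//; exact: fi.
apply: (cvg_Rintegral_unif (f := fun h x => h^-1 * (f x (t + h) - f x t))) => //.
  by rewrite near_withinE; apply: filterE => h /ii.
move=> e e0; have := ug _ e0; rewrite !near_withinE => /nbhs_ballP[r /= r0 rP].
apply/nbhs_ballP; exists r => //= h; rewrite /ball/= sub0r normrN => hr h0 Th x Kx.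
have H := fg h e Th _ x Kx.
have {}H : `|f x (t + h) - f x t - g x t * h| <= e * `|h|.
  apply: H => y t' Ky Tt' t'h; apply/ltW/rP => //.
  by rewrite /ball/= distrC; exact: le_lt_trans hr.
rewrite -(ler_pM2r (_ : 0 < `|h|)) ?normr_gt0// -normrM; apply: le_trans H.
by rewrite mulrBl [_ * _ * h]mulrAC mulVf// mul1r.
Qed.

Lemma Rfubini_box (R : realType) (g : R * R -> R) (a b c d : R) i :
  {within `[a, b] `*` `[c, d], continuous g} ->
  \int[(@lebesgue_measure R \x @lebesgue_measure R)%E]_(u in `[a, b] `*` `[c, d]) g u =
  \int[lebesgue_measure]_(x in if i then `[a, b]%classic else `[c, d]%classic)
    \int[lebesgue_measure]_(y in if i then `[c, d]%classic else `[a, b]%classic) g (pt i x y).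
Proof.
move=> cg; set K := _ `*` _ in cg *.
set I := if i then _ else _; set J := if i then _ else _.
have KE x y : K (pt i x y) <-> I x /\ J y.
  by rewrite /K /I /J; case: (i); split => -[].
have cK : compact K by apply: compact_setX; exact: segment_compact.
rewrite (Rfubini i cK cg).
transitivity (\int[lebesgue_measure]_(x in I) \int[@lebesgue_measure R]_y (g \_ K) (pt i x y)).
  apply: Rintegral_restrict => // x _ nI.
  rewrite (_ : (fun y => _) = cst 0); first by rewrite Rintegral_cst// mul0r.
  by apply/funext => y; rewrite patchE ifF//; apply/negP; rewrite inE => /KE[].
apply: eq_Rintegral => x; rewrite inE => Ix.
transitivity (\int[lebesgue_measure]_(y in J) (g \_ K) (pt i x y)).
  apply: Rintegral_restrict => // y _ nJ.
  by rewrite patchE ifF//; apply/negP; rewrite inE => /KE[].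
by apply: eq_Rintegral => y; rewrite inE => Jy; rewrite patchT// inE; apply/KE.
Qed.

Lemma RFTC2 (R : realType) (F f : R -> R) (a b : R) : a <= b ->
  {within `[a, b], continuous f} -> {within `[a, b], continuous F} ->
  (forall x, a < x < b -> is_derive x 1 F (f x)) ->
  \int[lebesgue_measure]_(x in `[a, b]) f x = F b - F a.
Proof.
rewrite le_eqVlt => /predU1P[<- _ _ _|ab cf cF dF].
  by rewrite set_itv1 Rintegral_set1 subrr.
rewrite /Rintegral (continuous_FTC2 (F := F) ab cf).
- by rewrite -EFinB.
- have /(continuous_within_itvP _ ab)[c1 c2 c3] := cF.
  by split => // x; rewrite in_itv/= => /dF[].
- by move=> x; rewrite in_itv/= => /dF[dx <-]; rewrite derive1E.
Qed.

Lemma segment_measure_fin (R : realType) (a b : R) :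
  (@lebesgue_measure R `[a, b] < +oo)%E.
Proof. by rewrite lebesgue_measure_itv/=; case: ifPn => _ //; rewrite -EFinB ltry. Qed.

Lemma cvg_within_mem (T U : Type) (F : set_system T) (G : set_system U)
    (f : T -> U) (A : set T) : Filter F -> F A ->
  f x @[x --> within A F] --> G -> f x @[x --> F] --> G.
Proof.
move=> FF FA h B /h; rewrite /= !/nbhs/= /within/= => hB.
by apply: filterS2 FA hB => x Ax; exact.
Qed.

Lemma within_slice2 (R : realType) (A B : set R) (f : R * R -> R) (z : R) :
  {within A `*` B, continuous f} -> B z -> {within A, continuous (fun s => f (s, z))}.
Proof.
move=> /(@within_slice _ _ _ false z) cf Bz; apply: continuous_subspaceW cf.
by move=> s As; split.
Qed.

Lemma integrable_seg (R : realType) (f : R -> R) (a b : R) :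
  {within `[a, b], continuous f} -> (@lebesgue_measure R).-integrable `[a, b] (EFin \o f).
Proof. by move=> cf; apply: continuous_compact_integrable => //; exact: segment_compact. Qed.

(** Only E and the divergence g are continuous up to the sides z = c1 and z = c2;
    Ps and Ez may be unbounded there. Integrating in s first removes Ps, and the
    fundamental theorem of calculus applies to z |-> J z, which is continuous on the
    closed interval and has derivative the integral of g inside. *)
Lemma rectangle_divergence (R : realType) (P E g Ps Ez : R * R -> R) (s1 s2 c1 c2 : R) :
  s1 <= s2 -> c1 <= c2 ->
  {within `[s1, s2] `*` `[c1, c2], continuous E} ->
  {within `[s1, s2] `*` `[c1, c2], continuous g} ->
  {within `[s1, s2] `*` `]c1, c2[, continuous Ps} ->
  (forall s z, s1 <= s <= s2 -> c1 < z < c2 -> is_derive s 1 (fun s => P (s, z)) (Ps (s, z))) ->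
  (forall s z, s1 <= s <= s2 -> c1 < z < c2 -> is_derive z 1 (fun z => E (s, z)) (Ez (s, z))) ->
  (forall s z, s1 <= s <= s2 -> c1 < z < c2 -> g (s, z) = Ps (s, z) + Ez (s, z)) ->
  (forall z, c1 < z < c2 -> P (s1, z) = 0 /\ P (s2, z) = 0) ->
  \int[lebesgue_measure]_(s in `[s1, s2]) \int[lebesgue_measure]_(z in `[c1, c2]) g (s, z) =
  \int[lebesgue_measure]_(s in `[s1, s2]) E (s, c2) -
  \int[lebesgue_measure]_(s in `[s1, s2]) E (s, c1).
Proof.
move=> s12 c12 cE cg cPs dP dE gE P0.
rewrite -(Rfubini_box true cg) (Rfubini_box false cg) /=.
pose J z := \int[lebesgue_measure]_(s in `[s1, s2]) E (s, z).
have int0 (h : R * R -> R) : {within `[s1, s2] `*` `[c1, c2], continuous h} ->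
    forall z, `[c1, c2]%classic z -> (@lebesgue_measure R).-integrable `[s1, s2] (EFin \o (fun s => h (s, z))).
  by move=> ch z zI; apply: integrable_seg; exact: within_slice2 zI.
have cJ (h : R * R -> R) : {within `[s1, s2] `*` `[c1, c2], continuous h} ->
    {within `[c1, c2], continuous (fun z => \int[lebesgue_measure]_(s in `[s1, s2]) h (s, z))}.
  move=> ch; apply/subspace_continuousP => z zI.
  exact: (@cvg_param_integral R _ _ _ lebesgue_measure _ _ (fun s z => h (s, z)) z
    (measurable_itv _) (segment_measure_fin _ _) zI (int0 h ch)
    (unif_near (@segment_compact _ _ _) zI ch)).
apply: (@RFTC2 R J); [exact: c12|exact: cJ|exact: cJ|move=> z zc].
- have zI : `]c1, c2[%classic z by rewrite /= in_itv.
  have zI' : `[c1, c2]%classic z by apply: subset_itv_oo_cc.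
  have sub : `[s1, s2] `*` `]c1, c2[ `<=` `[s1, s2] `*` `[c1, c2].
    by move=> [s t] [/= h1 h2]; split => //; exact: subset_itv_oo_cc.
  have cgP : {within `[s1, s2] `*` `]c1, c2[, continuous (fun u => g u - Ps u)}.
    by apply: within_continuousB => //; exact: continuous_subspaceW cg.
  have -> : \int[lebesgue_measure]_(s in `[s1, s2]) g (s, z) =
      \int[lebesgue_measure]_(s in `[s1, s2]) (g (s, z) - Ps (s, z)).
    rewrite RintegralB//; last 2 first.
    - exact: int0.
    - by apply: integrable_seg; exact: within_slice2 zI.
    have -> : \int[lebesgue_measure]_(s in `[s1, s2]) Ps (s, z) = P (s2, z) - P (s1, z).
      apply: (RFTC2 (F := fun s => P (s, z))) => // [||s /andP[h1 h2]].
      + exact: within_slice2 zI.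
      + apply: derivable_within_continuous => s; rewrite in_itv/= => sI.
        by have [] := dP s z sI zc.
      + by apply: dP => //; rewrite !ltW.
    by have [-> ->] := P0 z zc; rewrite !subr0.
  apply/is_derive_cvgP.
  have near_in : \forall h \near (0:R)^', `]c1, c2[%classic (z + h).
    rewrite /dnbhs near_withinE; apply/nbhs_ballP.
    move: zc => /andP[z0 zc]; exists (Num.min (z - c1) (c2 - z)).
      by rewrite /= lt_min !subr_gt0 z0.
    move=> h; rewrite /ball/= sub0r normrN lt_min ltr_norml ltr_norml in_itv/=.
    by move=> /andP[/andP[h1 h2] /andP[h3 h4]] _; apply/andP; split; lra.
  have -> : (fun h => h^-1 *: (J (h *: (1:R) + z) - J z)) =
      (fun h => h^-1 * (J (z + h) - J z)).
    by apply/funext => h; rewrite [_ *: 1]mulr1 [h + z]addrC.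
  apply: (cvg_within_mem _ near_in).
  apply: (@derive_param_integral R _ _ lebesgue_measure `[s1, s2] `]c1, c2[
    (fun s z => E (s, z)) (fun s z => g (s, z) - Ps (s, z)) z (measurable_itv _)
    (segment_measure_fin _ _) zI).
  - by move=> t tI; apply: int0 => //; exact: subset_itv_oo_cc tI.
  - by apply: integrable_seg; exact: (within_slice2 cgP zI).
  - exact: (unif_near (@segment_compact _ _ _) zI cgP).
  - move=> h e zhI he s sI.
    have sI' : s1 <= s <= s2 by move: sI; rewrite /= in_itv.
    have dEs w : `]c1, c2[%classic w -> is_derive w 1 (fun z => E (s, z)) (Ez (s, w)).
      by rewrite /= in_itv/= => wI; exact: dE.
    have [w [wI wh] ->] := mvt_itv (@interval_is_interval _ `]c1, c2[) dEs zI zhI.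
    have Ew w' : `]c1, c2[%classic w' -> Ez (s, w') = g (s, w') - Ps (s, w').
      by rewrite /= in_itv/= => w'I; rewrite gE// addrAC subrr add0r.
    rewrite addrAC subrr add0r in wh *.
    by rewrite Ew// -mulrBl normrM ler_wpM2r//; exact: he.
Qed.

(** * Closed curves and graph charts of the boundary *)

(** The coordinates of u in the order used by [pt i]. *)
Definition pa {R : realType} (i : bool) (u : R * R) : R := if i then u.1 else u.2.
Definition pb {R : realType} (i : bool) (u : R * R) : R := if i then u.2 else u.1.

Lemma ptK (R : realType) i (u : R * R) : pt i (pa i u) (pb i u) = u.
Proof. by case: i; rewrite /pt/pa/pb -surjective_pairing. Qed.

Lemma pa_pt (R : realType) i (x y : R) : pa i (pt i x y) = x.
Proof. by case: i. Qed.

Lemma pb_pt (R : realType) i (x y : R) : pb i (pt i x y) = y.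
Proof. by case: i. Qed.

Lemma dot_pt (R : realType) i (u v : R * R) :
  dot u v = pa i u * pa i v + pb i u * pb i v.
Proof. by case: i; rewrite /dot/pa/pb//= addrC. Qed.

Lemma nbhs_pt (R : realType) i (u : R * R) (A : set (R * R)) : nbhs u A <->
  exists2 r : R, 0 < r &
    forall v, `|pa i v - pa i u| < r -> `|pb i v - pb i u| < r -> A v.
Proof.
rewrite nbhs_box; case: i => //; split => -[r r0 H]; exists r => // v *; exact: H.
Qed.

Lemma cvg_pa (R : realType) i (u : R * R) : pa i v @[v --> u] --> pa i u.
Proof. by case: i; [exact: cvg_fst|exact: cvg_snd]. Qed.

Lemma cvg_pb (R : realType) i (u : R * R) : pb i v @[v --> u] --> pb i u.
Proof. by case: i; [exact: cvg_snd|exact: cvg_fst]. Qed.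

Lemma is_derive_pa (R : realType) i (c : R -> R * R) (s : R) d :
  is_derive s 1 c d -> is_derive s 1 (pa i \o c) (pa i d).
Proof.
move=> /is_derive_cvgP h; apply/is_derive_cvgP.
have := cvg_comp _ _ h (@cvg_pa R i d).
apply: cvg_trans; apply: near_eq_cvg; apply: nearW => t /=.
by case: i.
Qed.

Lemma is_derive_pb (R : realType) i (c : R -> R * R) (s : R) d :
  is_derive s 1 c d -> is_derive s 1 (pb i \o c) (pb i d).
Proof. by case: i; [exact: (@is_derive_pa R false)|exact: (@is_derive_pa R true)]. Qed.

Section closed_curve.
Variables (R : realType) (C : set (R * R)) (gamma : R -> R * R) (L : R).
Hypothesis arc : arclength_param C gamma L.

Lemma curve_derive (s : R) : is_derive s 1 gamma (gamma^`()%classic s).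
Proof. by rewrite derive1E; apply/derivableP; exact: (@ap_smooth _ _ _ _ arc 0%N s). Qed.

Lemma curve_derive_continuous : continuous (gamma^`()%classic : R -> R * R).
Proof.
move=> s; apply: differentiable_continuous; apply/derivable1_diffP.
exact: (@ap_smooth _ _ _ _ arc 1%N s).
Qed.

Lemma curve_continuous : continuous gamma.
Proof. by move=> s; exact: is_derive_continuous (curve_derive s). Qed.

Lemma curve_periodic (k : int) s : gamma (s + k%:~R * L) = gamma s.
Proof.
have nat_per (m : nat) x : gamma (x + m%:R * L) = gamma x.
  elim: m x => [|m IH] x; first by rewrite mul0r addr0.
  by rewrite -addn1 natrD mulrDl mul1r addrA (ap_periodic arc) IH.
case: k => m; first exact: nat_per.
by rewrite NegzE rmorphN/= mulNr -(nat_per m.+1) subrK.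
Qed.

Lemma curve_shift (c s : R) : exists k : int, c <= s + k%:~R * L < c + L.
Proof.
have L0 := ap_length arc.
exists (- Num.floor ((s - c) / L)).
have := floor_itv ((s - c) / L); rewrite intrD rmorphN/= ler_pdivlMr// ltr_pdivrMr//.
by move=> /andP[h1 h2]; apply/andP; split; lra.
Qed.

Lemma curve_inj (c s s' : R) : c <= s < c + L -> c <= s' < c + L ->
  gamma s = gamma s' -> s = s'.
Proof.
have L0 := ap_length arc.
have [k] := curve_shift 0 s; have [k'] := curve_shift 0 s'; rewrite add0r.
move=> /andP[a1 a2] /andP[b1 b2] /andP[c1 c2] /andP[d1 d2] ss'.
have E : s + k%:~R * L = s' + k'%:~R * L.
  by apply: (ap_simple arc); rewrite ?in_itv/= ?a1 ?b1// !curve_periodic.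
suff kk : k = k' by move: E; rewrite kk => /addIr.
have E' : s - s' = (k' - k)%:~R * L by rewrite intrB mulrBl; lra.
have : `|(k' - k)%:~R * L| < 1 * L by rewrite -E' ltr_norml; lra.
rewrite normrM (gtr0_norm L0) ltr_pM2r// -intr_norm (ltr_int R _ 1).
by rewrite -[1]add0r ltzD1 normr_le0 subr_eq0 => /eqP.
Qed.

Lemma curve_bdry (c : R) u : C u -> exists2 s, c <= s < c + L & gamma s = u.
Proof.
rewrite -(ap_image arc) => -[s _ <-].
by have [k kI] := curve_shift c s; exists (s + k%:~R * L) => //; rewrite curve_periodic.
Qed.

Lemma curve_in s : C (gamma s).
Proof.
rewrite -(ap_image arc); have [k kI] := curve_shift 0 s; rewrite add0r in kI.
exists (s + k%:~R * L); last by rewrite curve_periodic.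
by rewrite /= in_itv/=; case/andP: kI => -> /ltW.
Qed.

End closed_curve.
(** The part of the path inside U is both open and closed in the path, which is
    connected. *)
Lemma segment_stays (R : realType) (U : set (R * R)) (p : R -> R * R) :
  continuous p -> (forall t, 0 <= t <= 1 -> ~ bdry U (p t)) ->
  U (p 0) -> U (p 1).
Proof.
move=> cp nb U0.
have E t : 0 <= t <= 1 -> U (p t) -> U° (p t).
  move=> tI Ut; apply: contrapT => nU; apply: (nb t tI); split => //.
  exact: subset_closure.
have cA : connected (p @` `[0, 1]).
  apply: connected_continuous_connected; first exact: segment_connected.
  exact: continuous_subspaceT.
have [//|D] := pselect (U (p 1)).
have sub : p @` `[0, 1] `<=` U°.
  have <- : p @` `[0, 1] `&` U° = p @` `[0, 1].
    apply: cA.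
    - exists (p 0); split; last by apply: E; rewrite ?lexx ?ler01.
      by exists 0 => //; rewrite /= in_itv/= lexx ler01.
    - by exists U° => //; exact: open_interior.
    - exists (closure U°); first exact: closed_closure.
      apply/seteqP; split => [_ [[t tI <-] h]|_ [[t tI <-] h]]; split; try by exists t.
        exact: subset_closure.
      rewrite /= in_itv/= in tI.
      apply: E => //; apply: contrapT => nU; apply: (nb _ tI).
      split; last by move=> /interior_subset.
      exact: (closure_subset (@interior_subset _ U)).
  exact: subIsetr.
by apply: interior_subset; apply: sub; exists 1 => //; rewrite /= in_itv/= lexx ler01.
Qed.

Section steep.
Variables (R : realType) (f df : R -> R) (s0 sg m a1 : R).
Hypotheses (sg1 : sg = 1 \/ sg = -1) (m0 : 0 < m).
Hypothesis fd : forall s : R, is_derive s 1 f (df s).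
Hypothesis steep : forall s, `|s - s0| <= a1 -> m <= sg * df s.

(** The lemmas on steep functions stand for the inverse function theorem applied to
    a coordinate of the boundary curve: f is monotone, expands distances at least by
    the factor m, and covers intervals. *)
Lemma steep_mono s s' : `|s - s0| <= a1 -> `|s' - s0| <= a1 -> s <= s' ->
  m * (s' - s) <= sg * (f s' - f s).
Proof.
rewrite !ler_distl => sI s'I ss'.
have dfa z : `[s0 - a1, s0 + a1]%classic z -> is_derive z 1 f (df z) by move=> _; exact: fd.
have sI' : `[s0 - a1, s0 + a1]%classic s by rewrite /= in_itv.
have s'I' : `[s0 - a1, s0 + a1]%classic s' by rewrite /= in_itv.
have [z [zI _] ->] := mvt_itv (@interval_is_interval _ `[s0 - a1, s0 + a1]) dfa sI' s'I'.
rewrite mulrA ler_wpM2r ?subr_ge0//; apply: steep.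
by rewrite ler_distl; move: zI; rewrite /= in_itv.
Qed.

Lemma steep_lip s s' : `|s - s0| <= a1 -> `|s' - s0| <= a1 ->
  m * `|s' - s| <= `|f s' - f s|.
Proof.
wlog ss' : s s' / s <= s'.
  move=> H h h'; have /orP[ss'|ss'] := le_total s s'; first exact: H.
  by rewrite distrC [leRHS]distrC; exact: H.
move=> h h'; rewrite ger0_norm ?subr_ge0//.
apply: le_trans (steep_mono h h' ss') _.
by apply: le_trans (ler_norm _) _; rewrite normrM; case: sg1 => ->; rewrite ?normrN normr1 mul1r.
Qed.

Lemma steep_inj s s' : `|s - s0| <= a1 -> `|s' - s0| <= a1 -> f s = f s' -> s = s'.
Proof.
move=> h h' E; have := steep_lip h h'; rewrite E subrr normr0 pmulr_rle0//.
by rewrite normr_le0 subr_eq0 => /eqP ->.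
Qed.

Lemma steep_cover s b x : 0 <= b -> `|s - s0| + b <= a1 -> `|x - f s| <= m * b ->
  exists2 s', `|s' - s| <= b & f s' = x.
Proof.
move=> b0 sb; rewrite ler_distl => /andP[x1 x2].
have w z : `|z - s| <= b -> `|z - s0| <= a1.
  move=> h; apply: le_trans sb; rewrite [leRHS]addrC.
  by apply: le_trans (ler_distD s z s0) _; rewrite lerD2r.
have bb : s - b <= s + b by lra.
have h1 : `|s + b - s| <= b by rewrite addrAC subrr add0r ger0_norm.
have h2 : `|s - b - s| <= b by rewrite addrAC subrr add0r normrN ger0_norm.
have h3 : `|s - s| <= b by rewrite subrr normr0.
have l1 : m * (s + b - s) <= sg * (f (s + b) - f s).
  by apply: steep_mono; [exact: w|exact: w|rewrite lerDl].
have l2 : m * (s - (s - b)) <= sg * (f s - f (s - b)).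
  by apply: steep_mono; [exact: w|exact: w|rewrite gerBl].
have cf : {within `[s - b, s + b], continuous f}.
  by apply: continuous_subspaceT => z; exact: is_derive_continuous (fd z).
have [|z zI zE] := @IVT R f (s - b) (s + b) x bb cf.
  have e1 : s + b - s = b by ring.
  have e2 : s - (s - b) = b by ring.
  rewrite e1 in l1; rewrite e2 in l2.
  case: sg1 => e; rewrite e in l1 l2.
    by rewrite ge_min le_max; apply/andP; split; apply/orP; [left|right]; lra.
  by rewrite ge_min le_max; apply/andP; split; apply/orP; [right|left]; lra.
exists z => //; rewrite ler_distl; move: zI; rewrite in_itv/=; case/andP => z1 z2.
by apply/andP; split; lra.
Qed.
End steep.

(** In the plane, a unit vector orthogonal to d is a quarter turn of d up to sign;
    the sign is the cross product of d and N. *)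
Lemma normal_direction (R : realType) i (d N : R * R) :
  dot d d = 1 -> dot N N = 1 -> dot N d = 0 ->
  exists2 t, t = 1 \/ t = -1 & N = pt i (- t * pb i d) (t * pa i d).
Proof.
rewrite !(dot_pt i) => d1 N1 Nd.
set da := pa i d in d1 Nd *; set db := pb i d in d1 Nd *.
set Na := pa i N in N1 Nd; set Nb := pb i N in N1 Nd.
exists (Nb * da - Na * db).
  have : (Nb * da - Na * db) ^+ 2 = 1.
    have -> : (Nb * da - Na * db) ^+ 2 = (Na * Na + Nb * Nb) * (da * da + db * db) -
      (Na * da + Nb * db) ^+ 2 by ring.
    by rewrite N1 d1 Nd; ring.
  by move/eqP; rewrite sqrf_eq1 => /orP[] /eqP ->; [left|right].
rewrite -[N](ptK i) -/Na -/Nb; congr pt.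
  have -> : - (Nb * da - Na * db) * db = Na * (da * da + db * db) - (Na * da + Nb * db) * da by ring.
  by rewrite Nd d1; ring.
have -> : (Nb * da - Na * db) * da = Nb * (da * da + db * db) - (Na * da + Nb * db) * db by ring.
by rewrite Nd d1; ring.
Qed.

Lemma unit_coord_le1 (R : realType) (x y : R) : x * x + y * y = 1 -> `|x| <= 1.
Proof.
move=> xy; rewrite -(@ler_pXn2r _ 2)// ?nnegrE// expr1n real_normK ?num_real//.
by rewrite -xy expr2 lerDl -expr2 sqr_ge0.
Qed.

Lemma pt_add (R : realType) i (x y e : R) (N : R * R) :
  pt i x y + e *: N = pt i (x + e * pa i N) (y + e * pb i N).
Proof. by case: i; case: N. Qed.

(** Near gamma s0, U is the side [k * (y - gb s) <= 0] of a graph over the axis i,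
    parametrized by gamma. [sg] is the direction in which gamma runs over the axis,
    [r] the height of the strip in which U is described, and [rho] the radius of a
    box around gamma s0 which no other part of the curve meets ([bc_loc]). *)
Record boundary_chart (R : realType) (U : set (R * R)) (gamma : R -> R * R) (L : R)
    (n : R * R -> R * R) (s0 : R) (i : bool) (sg k a r rho : R) : Prop := {
  bc_sg : sg = 1 \/ sg = -1;
  bc_k : k = 1 \/ k = -1;
  bc_a : 0 < a;
  bc_aL : a < L / 2;
  bc_rho : 0 < rho;
  bc_rho_r : rho <= r / 4;
  bc_steep : exists2 m, 0 < m &
    forall s, `|s - s0| <= a -> m <= sg * pa i (gamma^`()%classic s);
  bc_height : forall s, `|s - s0| <= a -> `|pb i (gamma s) - pb i (gamma s0)| < r / 4;
  bc_dom : forall s y, `|s - s0| <= a -> `|y - pb i (gamma s0)| < r ->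
    U (pt i (pa i (gamma s)) y) <-> k * (y - pb i (gamma s)) <= 0;
  bc_int : forall s y, `|s - s0| <= a -> `|y - pb i (gamma s0)| < r ->
    k * (y - pb i (gamma s)) < 0 -> U° (pt i (pa i (gamma s)) y);
  bc_normal : forall s, `|s - s0| < a -> n (gamma s) =
    pt i (- (k * sg * pb i (gamma^`()%classic s))) (k * sg * pa i (gamma^`()%classic s));
  bc_cover : forall x, `|x - pa i (gamma s0)| < rho ->
    exists2 s, `|s - s0| < a & pa i (gamma s) = x;
  bc_loc : forall s, `|s - s0| <= L / 2 -> `|pa i (gamma s) - pa i (gamma s0)| < rho ->
    `|pb i (gamma s) - pb i (gamma s0)| < rho -> `|s - s0| < a }.

Section chart.
Variables (R : realType) (U : set (R * R)) (gamma : R -> R * R) (L : R).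
Hypothesis hU : smooth_sc_domain U gamma L.

Let arc := dom_boundary hU.
Let D (s : R) : R * R := gamma^`()%classic s.

Lemma domain_closed : closed U.
Proof. by rewrite -(dom_closure hU); exact: closed_closure. Qed.

Lemma bdryP u : bdry U u <-> U u /\ ~ U° u.
Proof. by rewrite /bdry -(closure_id U).1; last exact: domain_closed. Qed.

Lemma bdry_curve s : bdry U (gamma s).
Proof. exact: curve_in arc s. Qed.

(** The part of the curve away from s0 is compact and, the curve being simple,
    avoids gamma s0. *)
Lemma curve_separation i s0 a1 : 0 < a1 -> a1 < L / 2 ->
  exists2 r1, 0 < r1 & forall s, `|s - s0| <= L / 2 ->
    `|pa i (gamma s) - pa i (gamma s0)| < r1 ->
    `|pb i (gamma s) - pb i (gamma s0)| < r1 -> `|s - s0| < a1.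
Proof.
move=> a10 a1L; have L0 := ap_length arc.
pose Rm := gamma @` `[s0 + a1, s0 + L - a1].
have cRm : closed Rm.
  apply: compact_closed; first exact: norm_hausdorff.
  apply: continuous_compact; last exact: segment_compact.
  by apply: continuous_subspaceT; exact: (curve_continuous arc).
have nRm : (~` Rm) (gamma s0).
  move=> [s]; rewrite /= in_itv/= => /andP[s1 s2] /esym E.
  have : s0 = s.
    by apply: (curve_inj arc (c := s0)) => //; apply/andP; split; lra.
  by move=> e; move: s1; rewrite e; lra.
have /(nbhs_pt i)[r1 r10 H] : nbhs (gamma s0) (~` Rm).
  by apply: open_nbhs_nbhs; split => //; exact: closed_openC.
exists r1 => // s sL h1 h2; rewrite ltNge; apply/negP => as0.
apply: (H (gamma s) h1 h2).
have [ss0|ss0] := leP s0 s.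
  exists s => //; rewrite /= in_itv/=; move: as0 sL; rewrite ger0_norm ?subr_ge0//.
  by move=> *; apply/andP; split; lra.
exists (s + L); last exact: (ap_periodic arc).
rewrite /= in_itv/=; move: as0 sL; rewrite ltr0_norm ?subr_lt0//.
by move=> *; apply/andP; split; lra.
Qed.

(** The speed is 1, hence one coordinate of the velocity is nonzero at s0; it keeps
    its sign nearby. *)
Lemma local_window s0 : exists i sg m a1, [/\ sg = 1 \/ sg = -1, 0 < m, 0 < a1, a1 < L / 2 &
  forall s, `|s - s0| <= a1 -> m <= sg * pa i (D s)].
Proof.
have L0 := ap_length arc.
have [i iD] : exists i, pa i (D s0) != 0.
  have := ap_speed arc s0; rewrite -/(D s0) /dot => E.
  have [z|nz] := eqVneq (D s0).1 0; last by exists true.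
  exists false; rewrite /pa; apply/negP => /eqP z'; move: E; rewrite z z' !mul0r addr0.
  by move=> /esym/eqP; rewrite oner_eq0.
set x := pa i (D s0) in iD.
have x0 : 0 < `|x| / 2 by rewrite divr_gt0// normr_gt0.
have cD : (fun s => pa i (D s)) s @[s --> s0] --> x.
  exact: cvg_comp (@curve_derive_continuous _ _ _ _ arc s0) (@cvg_pa R i (D s0)).
have /cvgrPdist_lt/(_ _ x0)/nbhs_ballP[e /= e0 eP] := cD.
exists i, (Num.sg x), (`|x| / 2), (Num.min e (L / 2) / 2).
have m0 : 0 < Num.min e (L / 2) by rewrite lt_min e0 divr_gt0.
have tm : Num.min e (L / 2) / 2 < Num.min e (L / 2) by rewrite ltr_pdivrMr// ltr_pMr// ltr1n.
have [te tL] : Num.min e (L / 2) / 2 < e /\ Num.min e (L / 2) / 2 < L / 2.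
  by apply/andP; rewrite -lt_min.
split => //.
- by have [x1|x1|x1] := ltgtP x 0; [right; rewrite ltr0_sg|left; rewrite gtr0_sg|rewrite x1 eqxx in iD].
- by rewrite divr_gt0.
- move=> s ss0; have := eP s; rewrite /ball/= distrC => /(_ (le_lt_trans ss0 te)).
  rewrite ltr_norml => /andP[h1 h2].
  have [x1|x1|x1] := ltgtP x 0; last by rewrite x1 eqxx in iD.
    by rewrite ltr0_sg// ltr0_norm// in h1 h2 *; lra.
  by rewrite gtr0_sg// gtr0_norm// in h1 h2 *; lra.
Qed.
End chart.

Lemma conv_lt (R : realType) (x y z t : R) : 0 <= t <= 1 -> x < z -> y < z -> x + t * (y - x) < z.
Proof.
move=> /andP[t0 t1] xz yz; rewrite -subr_gt0.
have -> : z - (x + t * (y - x)) = (1 - t) * (z - x) + t * (z - y) by ring.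
have [t1'|t1'] := ltP t 1.
  by rewrite ltr_pwDl// ?mulr_gt0 ?mulr_ge0 ?subr_gt0// ltW ?subr_gt0.
have -> : t = 1 by lra.
by rewrite subrr mul0r add0r mul1r subr_gt0.
Qed.

Lemma conv_gt (R : realType) (x y z t : R) : 0 <= t <= 1 -> z < x -> z < y -> z < x + t * (y - x).
Proof.
move=> tI xz yz; rewrite -ltrN2.
have -> : - (x + t * (y - x)) = - x + t * (- y - - x) by ring.
by apply: conv_lt; rewrite ?ltrN2.
Qed.

(** In a vertical strip around the arc, the points above the arc are joined by paths
    that avoid the boundary, and so are those below; each side is therefore inside
    U or outside U ([segment_stays]). The exterior normal shows that one side is
    outside, and the equality of U with the closure of its interior that the other
    one is inside. *)
Lemma chart_exists (R : realType) (U : set (R * R)) (gamma : R -> R * R) (L : R)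
    (n : R * R -> R * R) (s0 : R) :
  smooth_sc_domain U gamma L -> exterior_unit_normal U gamma n ->
  exists i sg k a r rho, boundary_chart U gamma L n s0 i sg k a r rho.
Proof.
move=> hU hn; have arc := dom_boundary hU; pose D (s : R) : R * R := gamma^`()%classic s.
have bdryP := bdryP hU; have bdry_curve := bdry_curve hU.
have [i [sg [m [a1 [sg1 m0 a10 a1L mono]]]]] := local_window hU s0.
have [r r0 sep] := curve_separation hU i s0 a10 a1L.
pose ga s := pa i (gamma s); pose gb s := pb i (gamma s).
have gaD (s : R) : is_derive s 1 ga (pa i (D s)) by exact: is_derive_pa (curve_derive arc s).
have gbD (s : R) : is_derive s 1 gb (pb i (D s)) by exact: is_derive_pb (curve_derive arc s).
have gaC : continuous ga by move=> s; exact: is_derive_continuous (gaD s).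
have gbC : continuous gb by move=> s; exact: is_derive_continuous (gbD s).
have gE s : gamma s = pt i (ga s) (gb s) by rewrite ptK.
have r4 : 0 < r / 4 by rewrite divr_gt0.
have r4r : r / 4 < r by rewrite ltr_pdivrMr// ltr_pMr// ltr1n.
have r2r : r / 2 < r by rewrite ltr_pdivrMr// ltr_pMr// ltr1n.
have r42 : r / 4 < r / 2 by move: r0; clear => *; lra.
have ytop t : t = 1 \/ t = -1 -> `|gb s0 + t * (r / 2) - gb s0| = r / 2.
  by move=> [] ->; rewrite ?mul1r ?mulN1r addrAC subrr add0r ?normrN gtr0_norm// divr_gt0.
have [a [a0 aa1 Ha]] : exists a, [/\ 0 < a, a <= a1 & forall s, `|s - s0| <= a ->
    `|ga s - ga s0| < r / 4 /\ `|gb s - gb s0| < r / 4].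
  have /cvgrPdist_lt/(_ _ r4)/nbhs_ballP[d1 /= d10 h1] := gaC s0.
  have /cvgrPdist_lt/(_ _ r4)/nbhs_ballP[d2 /= d20 h2] := gbC s0.
  pose mm := Num.min a1 (Num.min d1 d2).
  have mm0 : 0 < mm by rewrite !lt_min a10 d10 d20.
  have mm2 : mm / 2 < mm by rewrite ltr_pdivrMr// ltr_pMr// ltr1n.
  have /and3P[l1 l2 l3] : [&& mm / 2 < a1, mm / 2 < d1 & mm / 2 < d2] by rewrite -!lt_min.
  exists (mm / 2); split; [by rewrite divr_gt0|exact: ltW|].
  move=> s sI; split; rewrite distrC.
    by apply: h1; rewrite /ball/= distrC; exact: le_lt_trans l2.
  by apply: h2; rewrite /ball/= distrC; exact: le_lt_trans l3.
have aw s : `|s - s0| <= a -> `|s - s0| <= a1 by move=> h; exact: le_trans aa1.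
have on_bdry s y : `|s - s0| <= a -> `|y - gb s0| < r -> bdry U (pt i (ga s) y) -> y = gb s.
  move=> sI yI /(curve_bdry arc (s0 - L / 2))[s2 /andP[s21 s22] E].
  have E1 : ga s2 = ga s by rewrite /ga E pa_pt.
  have E2 : gb s2 = y by rewrite /gb E pb_pt.
  have s2L : `|s2 - s0| <= L / 2 by move: s21 s22; clear => *; rewrite ler_norml; apply/andP; split; lra.
  have s2I : `|s2 - s0| < a1.
    apply: sep => //; rewrite -/(ga s2) -/(gb s2) ?E1 ?E2//.
    by have [h _] := Ha _ sI; apply: lt_trans h r4r.
  by rewrite -E2; congr gb; apply: (steep_inj sg1 m0 gaD mono (ltW s2I) (aw _ sI)).
(* vertical segments on one side of the arc do not meet the boundary *)
have vert t s y y' : t = 1 \/ t = -1 -> `|s - s0| <= a -> `|y - gb s0| < r -> `|y' - gb s0| < r ->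
    0 < t * (y - gb s) -> 0 < t * (y' - gb s) -> U (pt i (ga s) y) -> U (pt i (ga s) y').
  move=> t1 sI yI y'I h h'.
  have := @segment_stays R U (fun x => pt i (ga s) (y + x * (y' - y))).
  rewrite mul0r addr0 mul1r [y + _]addrC subrK; apply.
    move=> x; apply: cvg_pt; first exact: cvg_cst.
    by apply: cvgD; [exact: cvg_cst|apply: cvgM; [exact: cvg_id|exact: cvg_cst]].
  move=> x xI /on_bdry E; move: h h'; rewrite !ltr_norml in yI y'I.
  have {}E : y + x * (y' - y) = gb s.
    case/andP: yI => y1 y2; case/andP: y'I => y1' y2'.
    apply: E => //; rewrite ltr_norml.
    have g1 : gb s0 - r < y + x * (y' - y).
      by apply: conv_gt => //; move: y1 y1'; clear => *; lra.
    have g2 : y + x * (y' - y) < gb s0 + r.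
      by apply: conv_lt => //; move: y2 y2'; clear => *; lra.
    by move: g1 g2; clear => *; apply/andP; split; lra.
  case: t1 => ->; rewrite ?mul1r ?mulN1r ?oppr_gt0 ?subr_gt0 ?subr_lt0 -E => h h'.
    by have := conv_gt xI h h'; rewrite ltxx.
  by have := conv_lt xI h h'; rewrite ltxx.
(* at the height r / 2, above or below an arc of height at most r / 4, one can move
   along the whole strip *)
have horiz t s s' : t = 1 \/ t = -1 -> `|s - s0| <= a -> `|s' - s0| <= a ->
    U (pt i (ga s) (gb s0 + t * (r / 2))) -> U (pt i (ga s') (gb s0 + t * (r / 2))).
  move=> t1 sI s'I.
  have := @segment_stays R U (fun x => pt i (ga (s + x * (s' - s))) (gb s0 + t * (r / 2))).
  rewrite mul0r addr0 mul1r [s + _]addrC subrK; apply.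
    move=> x; apply: cvg_pt; last exact: cvg_cst.
    apply: (cvg_comp (fun x : R => s + x * (s' - s)) ga _ (gaC _)).
    by apply: cvgD; [exact: cvg_cst|apply: cvgM; [exact: cvg_id|exact: cvg_cst]].
  move=> x xI; have wI : `|s + x * (s' - s) - s0| <= a.
    move: sI s'I xI; rewrite !ler_norml => /andP[p1 p2] /andP[q1 q2] /andP[x0 x1].
    have e1 : s + x * (s' - s) - s0 = (1 - x) * (s - s0) + x * (s' - s0) by ring.
    have e2 : a = (1 - x) * a + x * a by ring.
    have e3 : - a = (1 - x) * (- a) + x * (- a) by ring.
    rewrite e1 [X in _ && (_ <= X)]e2 [X in (X <= _) && _]e3.
    by apply/andP; split; apply: lerD; apply: ler_wpM2l => //; rewrite subr_ge0.
  move=> /on_bdry E; have [_] := Ha _ wI; rewrite -E//.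
    by rewrite (ytop t t1) ltNge (ltW r42).
  by rewrite (ytop t t1).
have side t s s' y y' : t = 1 \/ t = -1 -> `|s - s0| <= a -> `|s' - s0| <= a ->
    `|y - gb s0| < r -> `|y' - gb s0| < r -> 0 < t * (y - gb s) -> 0 < t * (y' - gb s') ->
    U (pt i (ga s) y) -> U (pt i (ga s') y').
  move=> t1 sI s'I yI y'I h h' Uy.
  have top z : `|z - s0| <= a -> 0 < t * (gb s0 + t * (r / 2) - gb z).
    move=> /Ha[_]; rewrite ltr_norml => /andP[g1 g2].
    by case: t1 => ->; rewrite ?mul1r ?mulN1r; move: g1 g2 r0; clear => *; lra.
  have topr : `|gb s0 + t * (r / 2) - gb s0| < r.
    by rewrite (ytop t t1).
  apply: (vert t s' (gb s0 + t * (r / 2)) y') => //; first exact: top.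
  apply: (horiz t s s') => //.
  by apply: (vert t s y) => //; exact: top.
(* the exterior normal at gamma s points into the side of sign t * sg *)
have normal s : `|s - s0| < a -> exists2 t, t = 1 \/ t = -1 &
    n (gamma s) = pt i (- t * pb i (D s)) (t * pa i (D s)) /\
    exists s' y, [/\ `|s' - s0| <= a, `|y - gb s0| < r, 0 < t * sg * (y - gb s') &
      ~ U (pt i (ga s') y)].
  move=> sa; have [NN ND Nout] := hn s.
  have [t t1 NE] := normal_direction i (ap_speed arc s) NN ND.
  exists t => //; split => //.
  set N := n (gamma s) in NN ND Nout NE; set Na := pa i N; set Nb := pb i N.
  have NbE : Nb = t * pa i (D s) by rewrite /Nb NE pb_pt.
  have NN' : Na * Na + Nb * Nb = 1 by rewrite -(dot_pt i).
  (* the component of gamma x - gamma s along the normal is o(x - s) *)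
  pose d x := (ga x - ga s) * Na + (gb x - gb s) * Nb.
  have m2 : 0 < m / 2 by rewrite divr_gt0.
  have [eta eta0 dsmall] : exists2 eta, 0 < eta & forall x, `|x - s| < eta ->
      `|d x| <= m / 2 * `|x - s|.
    have dd : is_derive (s : R) 1 d 0.
      have -> : 0 = (pa i (D s) - 0) * Na + (pb i (D s) - 0) * Nb.
        by move: ND; rewrite (dot_pt i) -/N => {1}<-; rewrite !subr0 ![_ * pa i (D s)]mulrC ![_ * pb i (D s)]mulrC.
      rewrite /d; apply: is_deriveD => //.
        by apply: is_derive_eq; rewrite scaler0 add0r /GRing.scale/= mulrC.
      by apply: is_derive_eq; rewrite scaler0 add0r /GRing.scale/= mulrC.
    have ds0 : d s = 0 by rewrite /d !subrr !mul0r addr0.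
    move/is_derive_cvgP: dd; rewrite ds0 => /cvgrPdist_lt/(_ _ m2).
    rewrite near_withinE => /nbhs_ballP[eta /= eta0 etaP]; exists eta => // x xs.
    have [->|xs0] := eqVneq x s; first by rewrite ds0 subrr normr0 mulr0.
    have := etaP (x - s); rewrite /ball/= sub0r normrN subr_eq0 => /(_ xs xs0).
    rewrite sub0r normrN subr0 [_ *: 1]mulr1 subrK normrM normfV.
    by rewrite mulrC ltr_pdivrMr ?normr_gt0 ?subr_eq0// => /ltW.
  have [del del0 delP] : exists2 del, 0 < del & forall e, 0 < e < del -> ~ U (gamma s + e *: N).
    move: Nout; rewrite /at_right near_withinE => /nbhs_ballP[del /= del0 delP].
    exists del => // e /andP[e0 ed]; apply: delP => //.
    by rewrite /ball/= sub0r normrN gtr0_norm.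
  pose b := Num.min (eta / 2) (a - `|s - s0|).
  have b0 : 0 < b by rewrite lt_min divr_gt0//= subr_gt0.
  pose e := Num.min del (Num.min (m * b) (r / 4)) / 2.
  have M0 : 0 < Num.min del (Num.min (m * b) (r / 4)) by rewrite !lt_min del0 r4 mulr_gt0.
  have e0 : 0 < e by rewrite divr_gt0.
  have eM : e < Num.min del (Num.min (m * b) (r / 4)) by rewrite ltr_pdivrMr// ltr_pMr// ltr1n.
  have /and3P[ed eb er] : [&& e < del, e < m * b & e < r / 4] by rewrite -!lt_min.
  clearbody e.
  have Na1 : `|Na| <= 1.
    exact: unit_coord_le1 NN'.
  have Nb1 : `|Nb| <= 1.
    by apply: (@unit_coord_le1 _ _ Na); rewrite addrC.
  have eN c : `|c| <= 1 -> `|e * c| <= e.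
    by move=> c1; rewrite normrM (gtr0_norm e0) ler_piMr// ltW.
  have bs : `|s - s0| + b <= a1 by apply: le_trans aa1; rewrite -lerBrDl ge_min lexx orbT.
  have xs : `|ga s + e * Na - ga s| <= m * b.
    by rewrite addrAC subrr add0r; apply: le_trans (eN _ Na1) (ltW eb).
  have [s' s'b s'E] := steep_cover sg1 gaD mono (ltW b0) bs xs.
  have s'a : `|s' - s0| <= a.
    apply: le_trans (ler_distD s _ _) _; apply: (@le_trans _ _ (b + `|s - s0|)).
      by rewrite lerD2r.
    by rewrite -lerBrDr ge_min lexx orbT.
  exists s', (gb s + e * Nb); split => //.
  - rewrite addrAC; apply: le_lt_trans (ler_normD _ _) _.
    have [_ g1] := Ha _ (ltW sa); have := eN _ Nb1; move: er g1 r0; clear => *; lra.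
  - have dE : (gb s + e * Nb - gb s') * Nb = e - d s'.
      transitivity (e * (Na * Na + Nb * Nb) - d s'); first by rewrite /d s'E; ring.
      by rewrite NN' mulr1.
    have ds : `|d s'| <= m / 2 * `|s' - s|.
      apply: dsmall; apply: le_lt_trans s'b _; rewrite gt_min ltr_pdivrMr//.
      by rewrite ltr_pMr// ltr1n.
    have ml : m * `|s' - s| <= e.
      apply: le_trans (steep_lip sg1 gaD mono (aw _ (ltW sa)) (aw _ s'a)) _.
      by rewrite s'E addrAC subrr add0r; exact: eN.
    have pos : 0 < (gb s + e * Nb - gb s') * Nb.
      rewrite dE; have := ler_norm (d s'); move: ds ml e0; clear => *; lra.
    have sD : 0 < sg * pa i (D s) by apply: lt_le_trans m0 (mono _ (aw _ (ltW sa))).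
    rewrite -(pmulr_lgt0 _ sD).
    have -> : t * sg * (gb s + e * Nb - gb s') * (sg * pa i (D s)) =
       (sg * sg) * ((gb s + e * Nb - gb s') * (t * pa i (D s))) by ring.
    by rewrite -NbE; case: (sg1) => ->; rewrite ?mulrNN !mul1r.
  - have -> : pt i (ga s') (gb s + e * Nb) = gamma s + e *: N.
      by rewrite s'E gE pt_add.
    by apply: delP; rewrite e0.
have sgsg t : t = 1 \/ t = -1 -> t * sg = 1 \/ t * sg = -1.
  by move=> [] ->; case: sg1 => ->; rewrite ?mulr1 ?mulrNN ?mulr1 ?mul1r; [left|right|right|left].
have [t0 t01 [N0 [s1 [y1 [s1a y1r out1 nU1]]]]] : exists2 t, t = 1 \/ t = -1 &
    n (gamma s0) = pt i (- t * pb i (D s0)) (t * pa i (D s0)) /\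
    exists s' y, [/\ `|s' - s0| <= a, `|y - gb s0| < r, 0 < t * sg * (y - gb s') &
      ~ U (pt i (ga s') y)] by apply: normal; rewrite subrr normr0.
pose k := t0 * sg; have k1 : k = 1 \/ k = -1 by exact: sgsg.
have Nk1 : - k = 1 \/ - k = -1 by case: k1 => ->; [right|left; rewrite opprK].
have up s y : `|s - s0| <= a -> `|y - gb s0| < r -> 0 < k * (y - gb s) -> ~ U (pt i (ga s) y).
  by move=> sa yr h Uy; apply: nU1; exact: (side k s s1 y y1).
(* the arc covers the interval of radius m * a of the axis around ga s0 *)
pose rho := Num.min (r / 4) (m * a).
have rho0 : 0 < rho by rewrite lt_min r4 mulr_gt0.
have cover x : `|x - ga s0| < rho -> exists2 s, `|s - s0| < a & ga s = x.
  rewrite lt_min => /andP[_ xa].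
  have [|s sa E] := steep_cover sg1 gaD mono (s := s0) (ltW a0) _ (ltW xa).
    by rewrite subrr normr0 add0r.
  exists s => //; rewrite -(ltr_pM2l m0); apply: le_lt_trans xa; rewrite -E.
  by apply: (steep_lip sg1 gaD mono); rewrite ?subrr ?normr0 ?(ltW a10)//; exact: aw.
have [s2 [y2 [s2a y2r in2 U2]]] : exists s y, [/\ `|s - s0| <= a, `|y - gb s0| < r,
    0 < - k * (y - gb s) & U (pt i (ga s) y)].
  have : closure U° (gamma s0).
    by rewrite (dom_closure hU); have /bdryP[] := bdry_curve s0.
  move=> /(_ [set v | `|pa i v - ga s0| < rho /\ `|pb i v - gb s0| < rho]) [].
    by apply/(nbhs_pt i); exists rho => // v; split.
  move=> v [iv [va vb]]; have [s sa E] := cover _ va.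
  have vE : v = pt i (ga s) (pb i v) by rewrite E ptK.
  have vr : `|pb i v - gb s0| < r.
    by apply: lt_trans vb _; rewrite gt_min r4r.
  exists s, (pb i v); split => //; [exact: ltW| |by rewrite -vE; exact: interior_subset].
  have [h|h|h] := ltgtP 0 (k * (pb i v - gb s)).
  - by exfalso; apply: (up s (pb i v)) => //; [exact: ltW|rewrite -vE; exact: interior_subset].
  - by rewrite mulNr oppr_gt0.
  - exfalso; have k0 : k != 0 by case: k1 => ->; rewrite ?oppr_eq0 oner_eq0.
    have /eqP := esym h; rewrite mulf_eq0 (negbTE k0)/= subr_eq0 => /eqP E2.
    have /bdryP[_] := bdry_curve s; apply.
    by rewrite gE -E2 -vE.
have down s y : `|s - s0| <= a -> `|y - gb s0| < r -> k * (y - gb s) < 0 -> U (pt i (ga s) y).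
  move=> sa yr h; apply: (side (- k) s2 s y2 y) => //.
  by rewrite mulNr oppr_gt0.
exists i, sg, k, a, r, rho; split.
- exact: sg1.
- exact: k1.
- exact: a0.
- exact: le_lt_trans aa1 a1L.
- exact: rho0.
- by rewrite ge_min lexx.
- by exists m => // s /aw/mono.
- by move=> s /Ha[].
- move=> s y sa yr; split => [Uy|].
    by rewrite leNgt; apply/negP => h; exact: (up s y).
  rewrite le_eqVlt => /orP[/eqP h|]; last exact: down.
  have k0 : k != 0 by case: k1 => ->; rewrite ?oppr_eq0 oner_eq0.
  move/eqP: h; rewrite mulf_eq0 (negbTE k0)/= subr_eq0 => /eqP ->.
  by rewrite ptK; have /bdryP[] := bdry_curve s.
- move=> s y sa yr h; apply: contrapT => nI.
  have B : bdry U (pt i (ga s) y) by apply/bdryP; split => //; exact: down.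
  by move: h; rewrite (on_bdry s y sa yr B) subrr mulr0 ltxx.
- move=> s sa; have [t t1 [NE [s' [y [s'a yr h nU]]]]] := normal s sa.
  have E : t * sg = k.
    have [//|ne] := eqVneq (t * sg) k; exfalso.
    have E' : t * sg = - k.
      by case: (sgsg t t1) (k1) ne => -> [] ->; rewrite ?opprK ?eqxx.
    by apply: nU; apply: down => //; rewrite -oppr_gt0 -mulNr -E'.
  have sgK : sg * sg = 1 by case: (sg1) => ->; rewrite ?mulrNN mulr1.
  have tE : k * sg = t by rewrite -E -mulrA sgK mulr1.
  rewrite NE tE mulNr; reflexivity.
- exact: cover.
- move=> s sL h1 h2; have hr : rho < r.
    by rewrite gt_min r4r.
  have sa1 := sep s sL (lt_trans h1 hr) (lt_trans h2 hr).
  have [s' s'a E] := cover _ h1.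
  by rewrite (steep_inj sg1 m0 gaD mono (ltW sa1) (aw _ (ltW s'a)) (esym E)).
Qed.

(** * Fields supported near a boundary point *)

Lemma chain_pt (R : realType) i (O : set (R * R)) (f p q : R * R -> R)
    (c1 c2 : R -> R) (s d1 d2 : R) :
  nbhs (pt i (c1 s) (c2 s)) O ->
  (forall v, O v -> is_derive v (ev i) f (p v)) ->
  (forall v, O v -> is_derive v (ev (~~ i)) f (q v)) ->
  {for pt i (c1 s) (c2 s), continuous p} -> {for pt i (c1 s) (c2 s), continuous q} ->
  is_derive s 1 c1 d1 -> is_derive s 1 c2 d2 ->
  is_derive s 1 (fun z => f (pt i (c1 z) (c2 z)))
    (p (pt i (c1 s) (c2 s)) * d1 + q (pt i (c1 s) (c2 s)) * d2).
Proof.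
case: i => Os fp fq cp cq h1 h2; first exact: (chain_curve Os fp fq cp cq h1 h2).
by rewrite addrC; exact: (chain_curve Os fq fp cq cp h2 h1).
Qed.

Lemma within_compose (R : realType) (T : topologicalType) (U : set (R * R))
    (g : R * R -> R) (K : set T) (phi : T -> R * R) :
  {within U, continuous g} -> (forall x, K x -> phi y @[y --> x] --> phi x) ->
  (forall x, K x -> U (phi x)) ->
  {within K, continuous (fun x => g (phi x))}.
Proof.
move=> /subspace_continuousP cg cphi KU; apply/subspace_continuousP => x Kx.
apply: (cvg_comp phi g) (cg _ (KU _ Kx)) => B.
rewrite !/nbhs/= /within/= => /(cphi _ Kx); rewrite /= !/nbhs/=.
by apply: filterS => y h /KU Uy; exact: h.
Qed.

Lemma RFTC_subst_increasing (R : realType) (F f G : R -> R) (a b : R) : a <= b ->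
  (forall x : R, is_derive x 1 F (f x)) -> continuous f ->
  {in `[a, b] &, {homo F : x y / x < y}} ->
  {within `[F a, F b], continuous G} ->
  \int[lebesgue_measure]_(x in `[F a, F b]) G x =
  \int[lebesgue_measure]_(x in `[a, b]) (G (F x) * f x).
Proof.
move=> ab dF cf inc cG; rewrite /Rintegral.
have F' : F^`()%classic = f by apply/funext => x; rewrite derive1E; have [_ ->] := dF x.
rewrite (@integration_by_substitution_increasing _ F G)// ?F'//.
- by apply/cvg_ex; exists (f a); apply: cvg_at_right_filter; exact: cf.
- by apply/cvg_ex; exists (f b); apply: cvg_at_left_filter; exact: cf.
- split.
  + by move=> x _; have [] := dF x.
  + by apply: cvg_at_right_filter; exact: is_derive_continuous (dF a).
  + by apply: cvg_at_left_filter; exact: is_derive_continuous (dF b).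
Qed.

Lemma RFTC_subst_decreasing (R : realType) (F f G : R -> R) (a b : R) : a <= b ->
  (forall x : R, is_derive x 1 F (f x)) -> continuous f ->
  {in `[a, b] &, {homo F : x y /~ x < y}} ->
  {within `[F b, F a], continuous G} ->
  \int[lebesgue_measure]_(x in `[F b, F a]) G x =
  \int[lebesgue_measure]_(x in `[a, b]) (G (F x) * - f x).
Proof.
move=> ab dF cf dec cG; rewrite /Rintegral.
have F' : F^`()%classic = f by apply/funext => x; rewrite derive1E; have [_ ->] := dF x.
rewrite (@integration_by_substitution_decreasing _ F G)// ?F'//.
- by apply/cvg_ex; exists (f a); apply: cvg_at_right_filter; exact: cf.
- by apply/cvg_ex; exists (f b); apply: cvg_at_left_filter; exact: cf.
- split.
  + by move=> x _; have [] := dF x.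
  + by apply: cvg_at_right_filter; exact: is_derive_continuous (dF a).
  + by apply: cvg_at_left_filter; exact: is_derive_continuous (dF b).
Qed.

(** J is the image of the segment, for either monotonicity of f. The inverse of f is
    Lipschitz, hence G is continuous on J as soon as G o f is on the segment. *)
Lemma steep_subst (R : realType) (f df G : R -> R) (s0 sg m a : R) :
  sg = 1 \/ sg = -1 -> 0 < m -> 0 <= a ->
  (forall s : R, is_derive s 1 f (df s)) -> continuous df ->
  (forall s, `|s - s0| <= a -> m <= sg * df s) ->
  {within `[s0 - a, s0 + a], continuous (G \o f)} ->
  let J := `[Num.min (f (s0 - a)) (f (s0 + a)), Num.max (f (s0 - a)) (f (s0 + a))]%classic in
  \int[lebesgue_measure]_(x in J) G x =
  \int[lebesgue_measure]_(s in `[s0 - a, s0 + a]) (G (f s) * (sg * df s)).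
Proof.
move=> sg1 m0 a0 fd cdf st /subspace_continuousP cG J.
have I s : s \in `[s0 - a, s0 + a] -> `|s - s0| <= a by rewrite in_itv/= ler_distl.
have cJ : {within J, continuous G}.
  apply/subspace_continuousP => x Jx.
  have cf : {within `[s0 - a, s0 + a], continuous f}.
    by apply: continuous_subspaceT => z; exact: is_derive_continuous (fd z).
  have surj y : J y -> exists2 s, `[s0 - a, s0 + a]%classic s & f s = y.
    by rewrite /J/= in_itv/= => yJ; apply: IVT => //; lra.
  have [s sI sE] := surj _ Jx; apply/cvgrPdist_lt => e e0.
  have /cvgrPdist_lt/(_ _ e0) := cG s sI.
  rewrite !near_withinE => /nbhs_ballP[d /= d0 dP].
  apply/nbhs_ballP; exists (m * d) => /=; first exact: mulr_gt0.
  move=> y; rewrite /ball/= => xy Jy; have [s' s'I s'E] := surj _ Jy.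
  have := dP s'; rewrite /ball/= => h.
  rewrite -sE -s'E; apply: h => //.
  rewrite -(ltr_pM2l m0); apply: le_lt_trans xy.
  by rewrite -sE -s'E; apply: (steep_lip sg1 fd st); apply: I.
have aa : s0 - a <= s0 + a by lra.
have mono s s' : s \in `[s0 - a, s0 + a] -> s' \in `[s0 - a, s0 + a] -> s < s' ->
    0 < sg * (f s' - f s).
  move=> /I sI /I s'I ss'; apply: lt_le_trans (steep_mono fd st sI s'I (ltW ss')).
  by rewrite mulr_gt0// subr_gt0.
have endl : s0 - a \in `[s0 - a, s0 + a] by rewrite in_itv/= lexx.
have endr : s0 + a \in `[s0 - a, s0 + a] by rewrite in_itv/= lexx andbT.
have ends : 0 <= sg * (f (s0 + a) - f (s0 - a)).
  have [->|ane] := eqVneq a 0; first by rewrite subr0 addr0 subrr mulr0.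
  have a1 : 0 < a by rewrite lt_def ane.
  by apply/ltW/mono => //; lra.
case: sg1 => e; rewrite e in mono ends *.
  have fe : f (s0 - a) <= f (s0 + a) by rewrite mul1r subr_ge0 in ends.
  rewrite /J (min_l fe) (max_r fe) in cJ *.
  rewrite (RFTC_subst_increasing aa fd cdf)//; last first.
    by move=> s s' sI s'I ss'; have := mono _ _ sI s'I ss'; rewrite mul1r subr_gt0.
  by apply: eq_Rintegral => s _; rewrite mul1r.
have fe : f (s0 + a) <= f (s0 - a) by rewrite mulN1r oppr_ge0 subr_le0 in ends.
rewrite /J (min_r fe) (max_l fe) in cJ *.
rewrite (RFTC_subst_decreasing aa fd cdf)//; last first.
  by move=> s s' sI s'I ss'; have := mono _ _ s'I sI ss'; rewrite mulN1r oppr_gt0 subr_lt0.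
by apply: eq_Rintegral => s _; rewrite mulN1r.
Qed.

Lemma withinM (T : topologicalType) (R : realType) (A : set T) (f g : T -> R) :
  {within A, continuous f} -> {within A, continuous g} ->
  {within A, continuous (fun x => f x * g x)}.
Proof.
move=> /subspace_continuousP cf /subspace_continuousP cg.
by apply/subspace_continuousP => x Ax; apply: cvgM; [exact: cf|exact: cg].
Qed.

Lemma within_cst (T : topologicalType) (R : realType) (A : set T) (c : R) :
  {within A, continuous (fun _ : T => c)}.
Proof. by apply: continuous_subspaceT => x; exact: cvg_cst. Qed.

Lemma is_derive_affine (R : realType) (b k z : R) : is_derive z 1 (fun z => b - k * z) (- k).
Proof. by apply: is_derive_eq; rewrite /GRing.scale/=; ring. Qed.

Lemma continuous_fst (R : realType) (h : R -> R) (w : R * R) :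
  {for w.1, continuous h} -> {for w, continuous (fun w => h w.1)}.
Proof. by move=> ch; apply: (@continuous_comp _ _ _ fst h) => //; exact: cvg_fst. Qed.

Lemma affine_subst (R : realType) (f : R -> R) (b k c : R) : k = 1 \/ k = -1 -> 0 <= c ->
  {within [set b - k * z | z in `[0, c]], continuous f} ->
  \int[lebesgue_measure]_(y in [set b - k * z | z in `[0, c]]) f y =
  \int[lebesgue_measure]_(z in `[0, c]) f (b - k * z).
Proof.
move=> k1 c0; pose F z := b - k * z.
have dF (z : R) : is_derive z 1 F (- k) by exact: is_derive_affine.
have cst : continuous (fun _ : R => - k) by move=> z; exact: cvg_cst.
case: k1 => e.
  have -> : [set b - k * z | z in `[0, c]] = `[F c, F 0]%classic.
    apply/seteqP; split => [_ [z /= + <-]|y /=]; rewrite !in_itv/= /F e.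
      by move=> /andP[z0 zc]; apply/andP; split; lra.
    move=> /andP[y1 y2]; exists (b - y); last by ring.
    by rewrite in_itv/=; apply/andP; split; lra.
  move=> cf; rewrite (RFTC_subst_decreasing c0 dF cst)//.
    by apply: eq_Rintegral => z _; rewrite e opprK mulr1 /F e.
  by move=> x y _ _ xy; rewrite /F e; lra.
have -> : [set b - k * z | z in `[0, c]] = `[F 0, F c]%classic.
  apply/seteqP; split => [_ [z /= + <-]|y /=]; rewrite !in_itv/= /F e.
    by move=> /andP[z0 zc]; apply/andP; split; lra.
  move=> /andP[y1 y2]; exists (y - b); last by ring.
  by rewrite in_itv/=; apply/andP; split; lra.
move=> cf; rewrite (RFTC_subst_increasing c0 dF cst)//.
  by apply: eq_Rintegral => z _; rewrite e opprK mulr1 /F e.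
by move=> x y _ _ xy; rewrite /F e; lra.
Qed.

Section boundary_divergence.
Variables (R : realType) (U : set (R * R)) (gamma : R -> R * R) (L : R).
Variables (n : R * R -> R * R) (s0 : R) (i : bool) (sg k a r rho : R).
Hypothesis hU : smooth_sc_domain U gamma L.
Hypothesis bc : boundary_chart U gamma L n s0 i sg k a r rho.
Let ga s := pa i (gamma s).
Let gb s := pb i (gamma s).
Let da s := pa i (gamma^`()%classic s).
Let db s := pb i (gamma^`()%classic s).
(* phi (s, z) lies at depth z below the boundary point gamma s *)
Let phi (w : R * R) := pt i (ga w.1) (gb w.1 - k * w.2).

Lemma chart_derive_a (s : R) : is_derive s 1 ga (da s).
Proof. exact: is_derive_pa (curve_derive (dom_boundary hU) s). Qed.

Lemma chart_derive_b (s : R) : is_derive s 1 gb (db s).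
Proof. exact: is_derive_pb (curve_derive (dom_boundary hU) s). Qed.

Lemma chart_cont_da : continuous da.
Proof.
move=> s; exact: cvg_comp (@curve_derive_continuous _ _ _ _ (dom_boundary hU) s)
  (@cvg_pa R i (gamma^`()%classic s)).
Qed.

Lemma chart_cont_db : continuous db.
Proof.
move=> s; exact: cvg_comp (@curve_derive_continuous _ _ _ _ (dom_boundary hU) s)
  (@cvg_pb R i (gamma^`()%classic s)).
Qed.

Lemma chart_cont_phi : continuous phi.
Proof.
move=> w; apply: cvg_pt.
  by apply: continuous_fst; exact: is_derive_continuous (chart_derive_a w.1).
apply: cvgB.
  by apply: continuous_fst; exact: is_derive_continuous (chart_derive_b w.1).
by apply: cvgM; [exact: cvg_cst|exact: cvg_snd].
Qed.

Lemma chart_k2 : k * k = 1.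
Proof. by case: (bc_k bc) => ->; rewrite ?mulrNN mulr1. Qed.

Lemma chart_r0 : 0 < r.
Proof.
have := bc_rho bc; have := bc_rho_r bc => h1 h2.
by lra.
Qed.

Lemma chart_height_phi s z : `|s - s0| <= a -> 0 <= z <= r / 2 ->
  `|gb s - k * z - gb s0| < r.
Proof.
move=> sa /andP[z0 zr]; have h := bc_height bc sa.
rewrite addrAC; apply: le_lt_trans (ler_normB _ _) _.
have -> : `|k * z| = z.
  by rewrite normrM (ger0_norm z0); case: (bc_k bc) => ->; rewrite ?normrN normr1 mul1r.
move: h zr chart_r0; rewrite -/(gb s) -/(gb s0); move: `|_| => x; lra.
Qed.

Lemma chart_phi_in s z : `|s - s0| <= a -> 0 <= z <= r / 2 -> U (phi (s, z)).
Proof.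
move=> sa zr; apply/(bc_dom bc sa); first exact: chart_height_phi.
rewrite -/(gb s) addrAC subrr add0r mulrN mulrA chart_k2 mul1r oppr_le0.
by case/andP: zr.
Qed.

Lemma chart_phi_int s z : `|s - s0| <= a -> 0 < z <= r / 2 -> U° (phi (s, z)).
Proof.
move=> sa /andP[z0 zr]; apply: (bc_int bc sa).
  by apply: chart_height_phi => //; rewrite ltW.
by rewrite -/(gb s) addrAC subrr add0r mulrN mulrA chart_k2 mul1r oppr_lt0.
Qed.

Variables (A B g Aa Ab Bb : R * R -> R).
Hypothesis cU : compact U.
Hypotheses (cA : {within U, continuous A}) (cB : {within U, continuous B})
  (cg : {within U, continuous g}).
Hypothesis dAa : forall v, U° v -> is_derive v (ev i) A (Aa v).
Hypothesis dAb : forall v, U° v -> is_derive v (ev (~~ i)) A (Ab v).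
Hypothesis dBb : forall v, U° v -> is_derive v (ev (~~ i)) B (Bb v).
Hypothesis cAa : forall v, U° v -> {for v, continuous Aa}.
Hypothesis cAb : forall v, U° v -> {for v, continuous Ab}.
Hypothesis gE : forall v, U° v -> g v = Aa v + Bb v.
Hypothesis supp : forall v, U v ->
  ~ (`|pa i v - ga s0| < rho /\ `|pb i v - gb s0| < rho) ->
  [/\ A v = 0, B v = 0 & g v = 0].

Let c := r / 2.
Let c0 : 0 < c. Proof. by rewrite divr_gt0// chart_r0. Qed.
Let a0 : 0 < a. Proof. exact: bc_a bc. Qed.
Let I s : s \in `[s0 - a, s0 + a] -> `|s - s0| <= a.
Proof. by rewrite in_itv/= ler_distl. Qed.

Let end_supp s z : s = s0 - a \/ s = s0 + a -> 0 <= z <= c ->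
  [/\ A (phi (s, z)) = 0, B (phi (s, z)) = 0 & g (phi (s, z)) = 0].
Proof.
move=> se zc.
have as0 : `|s - s0| = a.
  by case: se => ->; rewrite addrAC subrr add0r ?normrN gtr0_norm.
have sI : `|s - s0| <= a by rewrite as0.
apply: supp; first exact: chart_phi_in.
rewrite pa_pt => -[h _]; have [s' s'a E] := bc_cover bc h.
have [m m0 st] := bc_steep bc.
have e : s' = s.
  by apply: (steep_inj (bc_sg bc) m0 chart_derive_a st) => //; exact: ltW.
by move: s'a; rewrite e as0 ltxx.
Qed.

Let low_supp s : `|s - s0| <= a ->
  [/\ A (phi (s, c)) = 0, B (phi (s, c)) = 0 & g (phi (s, c)) = 0].
Proof.
move=> sa; apply: supp; first by apply: chart_phi_in => //; rewrite lexx ltW.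
rewrite pb_pt/= => -[_]; have := bc_height bc sa; have := bc_rho_r bc.
rewrite -/(gb s) -/(gb s0).
have -> : gb s - k * c - gb s0 = - (k * c - (gb s - gb s0)) by ring.
rewrite normrN; have := lerB_dist (k * c) (gb s - gb s0).
have -> : `|k * c| = c.
  by rewrite normrM (gtr0_norm c0); case: (bc_k bc) => ->; rewrite ?normrN normr1 mul1r.
rewrite /c; move: `|_| => x; move: `|_| => y; have := chart_r0.
move=> *; lra.
Qed.

Let K := `[s0 - a, s0 + a] `*` `[0, c].
Let KI w : K w -> `|w.1 - s0| <= a /\ 0 <= w.2 <= c.
Proof. by move=> [/= /I h1]; rewrite in_itv/=. Qed.

Let within_phi (h : R * R -> R) : {within U, continuous h} -> {within K, continuous (h \o phi)}.
Proof.
move=> ch; apply: within_compose => // w Kw; first exact: chart_cont_phi.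
by have [h1 h2] := KI Kw; rewrite [w]surjective_pairing; exact: chart_phi_in.
Qed.

Let within_fst (h : R -> R) (D : set (R * R)) :
  continuous h -> {within D, continuous (fun w => h w.1)}.
Proof.
move=> ch; apply: continuous_subspaceT => w.
by apply: continuous_fst; exact: ch.
Qed.

Let within_gamma (h : R * R -> R) : {within U, continuous h} ->
  {within `[s0 - a, s0 + a], continuous (h \o gamma)}.
Proof.
move=> ch; apply: within_compose => // s _; first exact: (curve_continuous (dom_boundary hU)).
by have /(bdryP hU)[] := bdry_curve hU s.
Qed.

Let integrable_line : (@lebesgue_measure R).-integrable `[s0 - a, s0 + a]
  (EFin \o (fun s => k * (da s * B (gamma s) - db s * A (gamma s)))).
Proof.
apply: integrable_seg; apply: withinM; first exact: within_cst.
apply: within_continuousB; apply: withinM.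
- exact: (continuous_subspaceT chart_cont_da).
- exact: (within_gamma cB).
- exact: (continuous_subspaceT chart_cont_db).
- exact: (within_gamma cA).
Qed.

(** In the coordinates (s, z), the divergence times the Jacobian [da] is the
    divergence of (P, E), where E is the flux density through the curve at depth z. *)
Lemma chart_line_integral :
  \int[lebesgue_measure]_(s in `[s0 - a, s0 + a])
    \int[lebesgue_measure]_(z in `[0, c]) (da s * g (phi (s, z))) =
  \int[lebesgue_measure]_(s in `[s0 - a, s0 + a])
    (k * (da s * B (gamma s) - db s * A (gamma s))).
Proof.
pose P w := A (phi w).
pose E w := k * (db w.1 * A (phi w) - da w.1 * B (phi w)).
pose G w := da w.1 * g (phi w).
pose Ps w := Aa (phi w) * da w.1 + Ab (phi w) * db w.1.
pose Ez w := da w.1 * Bb (phi w) - db w.1 * Ab (phi w).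
have sI s : s0 - a <= s <= s0 + a -> `|s - s0| <= a by rewrite ler_distl.
transitivity (\int[lebesgue_measure]_(s in `[s0 - a, s0 + a]) E (s, c) -
    \int[lebesgue_measure]_(s in `[s0 - a, s0 + a]) E (s, 0)); last first.
  have -> : \int[lebesgue_measure]_(s in `[s0 - a, s0 + a]) E (s, c) = 0.
    transitivity (\int[@lebesgue_measure R]_(s in `[s0 - a, s0 + a]) (0 : R)).
      apply: eq_Rintegral => s; rewrite inE => /I/low_supp[h1 h2 _].
      by rewrite /E h1 h2 !mulr0 subrr mulr0.
    by rewrite Rintegral_cst// mul0r.
  rewrite sub0r; pose f s := k * (da s * B (gamma s) - db s * A (gamma s)).
  transitivity (- \int[lebesgue_measure]_(s in `[s0 - a, s0 + a]) (- 1 * f s)).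
    congr (- _); apply: eq_Rintegral => s _; rewrite /E /phi/= mulr0 subr0 ptK /f; ring.
  by rewrite (RintegralZl _ _ integrable_line)// mulN1r opprK.
apply: (@rectangle_divergence R P E G Ps Ez).
- by have := a0; lra.
- exact: ltW.
- apply: withinM; first exact: within_cst.
  apply: within_continuousB; apply: withinM.
  + exact: (within_fst chart_cont_db).
  + exact: (within_phi cA).
  + exact: (within_fst chart_cont_da).
  + exact: (within_phi cB).
- apply: withinM; first exact: (within_fst chart_cont_da).
  exact: (within_phi cg).
- apply: continuous_in_subspaceT => w; rewrite inE => -[/= w1]; rewrite in_itv/= => /andP[w2 w3].
  have Iphi : U° (phi w).
    by rewrite [w]surjective_pairing; apply: chart_phi_int; [exact: I|rewrite w2 ltW].
  apply: cvgD; apply: cvgM.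
  + exact: (cvg_comp phi Aa (@chart_cont_phi w) (cAa Iphi)).
  + exact: (continuous_fst (@chart_cont_da w.1)).
  + exact: (cvg_comp phi Ab (@chart_cont_phi w) (cAb Iphi)).
  + exact: (continuous_fst (@chart_cont_db w.1)).
- move=> s z sI' /andP[z0 zc]; have zc' : 0 < z <= c by rewrite z0 ltW.
  have Iphi := chart_phi_int (sI _ sI') zc'.
  apply: (@chain_pt R i U° A Aa Ab ga (fun s => gb s - k * z)) => //.
  + by apply: open_nbhs_nbhs; split => //; exact: open_interior.
  + exact: cAa.
  + exact: cAb.
  + exact: chart_derive_a.
  + by rewrite -[db s]subr0; apply: is_deriveB; exact: chart_derive_b.
- move=> s z sI' /andP[z0 zc]; have zc' : 0 < z <= c by rewrite z0 ltW.
  have Iphi := chart_phi_int (sI _ sI') zc'.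
  have vert (f df : R * R -> R) : (forall v, U° v -> is_derive v (ev (~~ i)) f (df v)) ->
      is_derive z 1 (fun z => f (phi (s, z))) (df (phi (s, z)) * - k).
    move=> /(_ _ Iphi) /is_derive_ptP' h.
    exact: (@is_derive_compR R _ (fun z => gb s - k * z) (fun y => f (pt i (ga s) y)) z 1
      (- k) _ h (is_derive_affine (gb s) k z)).
  have dA := vert A Ab dAb; have dB := vert B Bb dBb.
  have dE := is_deriveZ k (is_deriveB (is_deriveZ (db s) dA) (is_deriveZ (da s) dB)).
  have -> : Ez (s, z) = k *: (db s *: (Ab (phi (s, z)) * - k) - da s *: (Bb (phi (s, z)) * - k)).
    transitivity (k * k * (da s * Bb (phi (s, z)) - db s * Ab (phi (s, z)))).
      by rewrite chart_k2 mul1r.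
    by rewrite /GRing.scale/=; ring.
  exact: dE.
- move=> s z sI' /andP[z0 zc]; have zc' : 0 < z <= c by rewrite z0 ltW.
  have Iphi := chart_phi_int (sI _ sI') zc'.
  by rewrite /G /Ps /Ez /= gE//; ring.
- move=> z /andP[z0 zc]; have zc' : 0 <= z <= c by rewrite !ltW.
  by split; rewrite /P; [have [] := end_supp (or_introl erefl) zc'|have [] := end_supp (or_intror erefl) zc'].
Qed.

Lemma chart_slice s : `|s - s0| <= a ->
  \int[lebesgue_measure]_y (g \_ U) (pt i (ga s) y) =
  \int[lebesgue_measure]_(z in `[0, c]) g (phi (s, z)).
Proof.
move=> sa; pose D := [set gb s - k * z | z in `[0, c]].
have DU y : D y -> U (pt i (ga s) y).
  move=> [z]; rewrite /= in_itv/= => zI <-; exact: chart_phi_in.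
transitivity (\int[lebesgue_measure]_(y in D) (g \_ U) (pt i (ga s) y)).
  apply: Rintegral_restrict => // y _ nD; rewrite patchE; case: ifPn => //; rewrite inE => Uy.
  have [//|] := pselect (g (pt i (ga s) y) = 0) => gn; exfalso; apply: nD.
  have [_ yr] : `|pa i (pt i (ga s) y) - ga s0| < rho /\ `|pb i (pt i (ga s) y) - gb s0| < rho.
    by apply: contrapT => h; apply: gn; have [] := supp Uy h.
  rewrite pb_pt in yr; have yr4 := lt_le_trans yr (bc_rho_r bc).
  have h := bc_height bc sa; rewrite -/(gb s) -/(gb s0) in h.
  have Uk : k * (y - gb s) <= 0.
    by apply/(bc_dom bc sa) => //; have := chart_r0; lra.
  exists (- (k * (y - gb s))).
    rewrite /= in_itv/= oppr_ge0 Uk/= /c; move: h yr4; rewrite !ltr_norml.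
    by move=> /andP[? ?] /andP[? ?]; case: (bc_k bc) => ->; rewrite ?mul1r ?mulN1r; lra.
  by rewrite mulrN mulrA chart_k2 mul1r; ring.
transitivity (\int[lebesgue_measure]_(y in D) g (pt i (ga s) y)).
  by apply: eq_Rintegral => y; rewrite inE => Dy; rewrite patchT// inE; exact: DU.
rewrite (affine_subst (bc_k bc) (ltW c0))//.
apply: within_compose cg _ _ => // y _.
by apply: cvg_pt; [exact: cvg_cst|exact: cvg_id].
Qed.

(** Fubini with the coordinate along the axis outside, followed by the substitution
    x = ga s, whose Jacobian is sg * da. *)
Lemma chart_area :
  \int[(@lebesgue_measure R \x @lebesgue_measure R)%E]_(u in U) g u =
  sg * \int[lebesgue_measure]_(s in `[s0 - a, s0 + a])
    \int[lebesgue_measure]_(z in `[0, c]) (da s * g (phi (s, z))).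
Proof.
rewrite (Rfubini i cU cg).
pose H x := \int[@lebesgue_measure R]_y (g \_ U) (pt i x y).
have [m m0 st] := bc_steep bc.
pose h s := \int[lebesgue_measure]_(z in `[0, c]) g (phi (s, z)).
have Hh s : s \in `[s0 - a, s0 + a] -> H (ga s) = h s by move=> /I /chart_slice.
have cK : {within K, continuous (g \o phi)} by exact: within_phi.
have ih s : `[s0 - a, s0 + a]%classic s ->
    (@lebesgue_measure R).-integrable `[0, c] (EFin \o (fun z => g (phi (s, z)))).
  move=> sI; apply: integrable_seg.
  apply: (continuous_subspaceW _ (@within_slice _ _ _ true s cK)) => z zI.
  by split.
have ch : {within `[s0 - a, s0 + a], continuous h}.
  apply/subspace_continuousP => s sI.
  have cK' : {within `[0, c] `*` `[s0 - a, s0 + a], continuous (fun w => g (phi (w.2, w.1)))}.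
    apply: (within_compose (phi := fun w : R * R => phi (w.2, w.1)) cg) => [w _|w [w1 w2]].
      apply: (cvg_comp (fun w : R * R => (w.2, w.1)) phi _ (@chart_cont_phi _)).
      by apply: (@cvg_pt R true); [exact: cvg_snd|exact: cvg_fst].
    by apply: chart_phi_in; [exact: I|move: w1; rewrite /= in_itv].
  exact: (@cvg_param_integral R _ _ _ lebesgue_measure _ _ (fun z s => g (phi (s, z))) s
    (measurable_itv _) (segment_measure_fin _ _) sI ih
    (unif_near (@segment_compact _ _ _) sI cK')).
have ch' : {within `[s0 - a, s0 + a], continuous (H \o ga)}.
  by apply: (subspace_eq_continuous _ ch) => s sI; apply/esym/Hh; rewrite inE in sI.
have := steep_subst (bc_sg bc) m0 (ltW a0) chart_derive_a chart_cont_da st ch'.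
set J := `[_, _]%classic => /= E.
transitivity (\int[lebesgue_measure]_(x in J) H x).
  apply: Rintegral_restrict => // x _ nJ; rewrite (_ : (fun y => _) = cst 0).
    by rewrite Rintegral_cst// mul0r.
  apply/funext => y; rewrite patchE/=; case: ifPn => //; rewrite inE => Uy.
  have [//|gn] := pselect (g (pt i x y) = 0); exfalso; apply: nJ.
  have [xr _] : `|pa i (pt i x y) - ga s0| < rho /\ `|pb i (pt i x y) - gb s0| < rho.
    by apply: contrapT => hh; apply: gn; have [] := supp Uy hh.
  rewrite pa_pt in xr; have [s sa <-] := bc_cover bc xr.
  rewrite -/(ga s) /J /= in_itv/=.
  have sI : `|s - s0| <= a by exact: ltW.
  have a0' := a0.
  have lI : `|s0 - a - s0| <= a by rewrite addrAC subrr add0r normrN gtr0_norm.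
  have rI : `|s0 + a - s0| <= a by rewrite addrAC subrr add0r gtr0_norm.
  move: sa; rewrite ltr_norml => /andP[sa1 sa2].
  have l1 : s0 - a <= s by lra.
  have l2 : s <= s0 + a by lra.
  have h1 := steep_mono chart_derive_a st lI sI l1.
  have h2 := steep_mono chart_derive_a st sI rI l2.
  have p1 : 0 <= m * (s - (s0 - a)) by rewrite mulr_ge0 ?subr_ge0// ltW.
  have p2 : 0 <= m * (s0 + a - s) by rewrite mulr_ge0 ?subr_ge0// ltW.
  have {p1}h1 := le_trans p1 h1; have {p2}h2 := le_trans p2 h2.
  move: h1 h2; case: (bc_sg bc) => ->; rewrite ?mul1r ?mulN1r ?oppr_ge0 ?subr_ge0 ?subr_le0 => h1 h2.
    by rewrite ge_min le_max h1 h2 orbT.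
  by rewrite ge_min le_max h1 h2 orbT.
have -> : \int[lebesgue_measure]_(s in `[s0 - a, s0 + a])
    \int[lebesgue_measure]_(z in `[0, c]) (da s * g (phi (s, z))) =
  \int[lebesgue_measure]_(s in `[s0 - a, s0 + a]) (da s * h s).
  by apply: eq_Rintegral => s; rewrite inE => sI; rewrite RintegralZl//; exact: ih.
rewrite E -RintegralZl//; last first.
  by apply: integrable_seg; apply: withinM => //; exact: (continuous_subspaceT chart_cont_da).
by apply: eq_Rintegral => s; rewrite inE => sI; rewrite Hh//; ring.
Qed.

Lemma chart_divergence :
  \int[(@lebesgue_measure R \x @lebesgue_measure R)%E]_(u in U) g u =
  \int[lebesgue_measure]_(s in `[s0 - a, s0 + a])
    (k * sg * (da s * B (gamma s) - db s * A (gamma s))).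
Proof.
rewrite chart_area chart_line_integral -RintegralZl//.
by apply: eq_Rintegral => s _; ring.
Qed.
End boundary_divergence.

(** * Vector fields and their flux *)

Lemma continuous_into (R : realType) (T : topologicalType) (U : set (R * R))
    (g : R * R -> R) (phi : T -> R * R) x :
  {within U, continuous g} -> {for x, continuous phi} -> (forall y, U (phi y)) ->
  {for x, continuous (fun y => g (phi y))}.
Proof.
move=> /subspace_continuousP cg cphi UT; apply: (cvg_comp phi g) (cg _ (UT x)) => B.
rewrite !/nbhs/= /within/= => /cphi; rewrite /= !/nbhs/=.
by apply: filterS => y h; exact: h.
Qed.

Lemma antiderivative (R : realType) (f : R -> R) (m : R) : continuous f ->
  exists F : R -> R, forall x, m < x -> is_derive x 1 F (f x).
Proof.
move=> cf; exists (fun x => \int[lebesgue_measure]_(t in `[m, x]) f t) => x mx.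
have fi : (@lebesgue_measure R).-integrable `[m, x + 1] (EFin \o f).
  by apply: integrable_seg; exact: continuous_subspaceT.
have [|d <-] := @continuous_FTC1 R f (BLeft m) x (x + 1) _ fi mx (cf x).
  by rewrite ltrDl.
by rewrite derive1E; exact/derivableP.
Qed.

(** By periodicity, F (x + L) - F x has derivative 0 for an antiderivative F. *)
Lemma periodic_integral (R : realType) (f : R -> R) (L c : R) : 0 < L ->
  continuous f -> (forall s, f (s + L) = f s) ->
  \int[lebesgue_measure]_(s in `[c, c + L]) f s =
  \int[lebesgue_measure]_(s in `[0, L]) f s.
Proof.
move=> L0 cf per; pose m := Num.min 0 c - 1.
have [F dF] := antiderivative m cf.
have m0 : m < 0 by rewrite /m ltrBlDr gt_min ltr_wpDl//.
have mc : m < c by rewrite /m ltrBlDr gt_min ltrDl ltr01 orbT.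
have FTC x : m < x -> \int[lebesgue_measure]_(s in `[x, x + L]) f s = F (x + L) - F x.
  move=> mx; apply: RFTC2; first by rewrite lerDl ltW.
  - exact: continuous_subspaceT.
  - apply: continuous_in_subspaceT => y; rewrite inE/= in_itv/= => /andP[xy _].
    exact: is_derive_continuous (dF _ (lt_le_trans mx xy)).
  - by move=> y /andP[xy _]; apply: dF; exact: lt_trans xy.
rewrite FTC//; have := FTC 0 m0; rewrite add0r => ->.
have dD z : `]m, +oo[%classic z -> is_derive z 1 (fun x => F (x + L) - F x) ((fun=> 0) z).
  rewrite /= in_itv/= andbT => mz.
  have d1 : is_derive (z : R) 1 (fun x => F (x + L)) (f (z + L) * 1).
    apply: (@is_derive_compR R _ (fun x => x + L) F z 1 1); last first.
      by apply: is_derive_eq; rewrite addr0.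
    by apply: dF; apply: lt_trans mz _; rewrite ltrDl.
  by have := is_deriveB d1 (dF z mz); rewrite mulr1 per subrr.
have mI x : m < x -> `]m, +oo[%classic x by rewrite /= in_itv/= andbT.
have [z _] := mvt_itv (@interval_is_interval _ `]m, +oo[) dD (mI _ m0) (mI _ mc).
by rewrite mul0r add0r => /eqP; rewrite subr_eq0 => /eqP.
Qed.

(** A vector field (F1, F2) with divergence g. Only g, not the partial derivatives,
    extends to the boundary: for the field W of a gradient, g is the time derivative
    of the solution, while its second space derivatives may blow up there. *)
Record field (R : realType) (U : set (R * R)) (F1 F2 g p1 q1 p2 q2 : R * R -> R) : Prop := {
  f_c1 : {within U, continuous F1};
  f_c2 : {within U, continuous F2};
  f_cg : {within U, continuous g};
  f_d11 : forall v, U° v -> is_derive v (ev true) F1 (p1 v);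
  f_d12 : forall v, U° v -> is_derive v (ev false) F1 (q1 v);
  f_d21 : forall v, U° v -> is_derive v (ev true) F2 (p2 v);
  f_d22 : forall v, U° v -> is_derive v (ev false) F2 (q2 v);
  f_cp1 : forall v, U° v -> {for v, continuous p1};
  f_cq1 : forall v, U° v -> {for v, continuous q1};
  f_cp2 : forall v, U° v -> {for v, continuous p2};
  f_cq2 : forall v, U° v -> {for v, continuous q2};
  f_div : forall v, U° v -> g v = p1 v + q2 v }.

Definition supported {R : realType} (U : set (R * R)) (u : R * R) (rho : R)
    (F1 F2 g : R * R -> R) := forall v, U v ->
  ~ (`|v.1 - u.1| < rho /\ `|v.2 - u.2| < rho) -> [/\ F1 v = 0, F2 v = 0 & g v = 0].

Section flux.
Variables (R : realType) (U : set (R * R)) (gamma : R -> R * R) (L : R).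
Variables (n : R * R -> R * R).
Hypothesis hU : smooth_sc_domain U gamma L.
Hypothesis hn : exterior_unit_normal U gamma n.
Let arc := dom_boundary hU.

Definition flux (F1 F2 : R * R -> R) : R :=
  curve_integral gamma L (fun u => dot (F1 u, F2 u) (n u)).

Lemma domain_compact : compact U.
Proof.
have [M M0 UM] := bounded_box (dom_bounded hU).
apply: (subclosed_compact (domain_closed hU) _ UM).
by apply: compact_setX; exact: segment_compact.
Qed.

Lemma normal_continuous i : continuous (fun s => pa i (n (gamma s))).
Proof.
move=> s0; have [j [sg [k [a [r [rho bc]]]]]] := chart_exists s0 hU hn.
have nearE : \forall s \near s0, n (gamma s) =
    pt j (- (k * sg * pb j (gamma^`()%classic s))) (k * sg * pa j (gamma^`()%classic s)).
  apply/nbhs_ballP; exists a => /=; first exact: bc_a bc.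
  by move=> s; rewrite /ball/= distrC => sa; exact: bc_normal bc _ sa.
have c : {for s0, continuous (fun s => pt j (- (k * sg * pb j (gamma^`()%classic s)))
    (k * sg * pa j (gamma^`()%classic s)))}.
  have ca : pa j (gamma^`()%classic s) @[s --> s0] --> pa j (gamma^`()%classic s0).
    exact: (@chart_cont_da _ _ _ _ j hU s0).
  have cb : pb j (gamma^`()%classic s) @[s --> s0] --> pb j (gamma^`()%classic s0).
    exact: (@chart_cont_db _ _ _ _ j hU s0).
  have ca' : k * sg * pa j (gamma^`()%classic s) @[s --> s0] --> k * sg * pa j (gamma^`()%classic s0).
    by apply: cvgM; [exact: cvg_cst|exact: ca].
  have cb' : - (k * sg * pb j (gamma^`()%classic s)) @[s --> s0] --> - (k * sg * pb j (gamma^`()%classic s0)).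
    by apply: cvgN; apply: cvgM; [exact: cvg_cst|exact: cb].
  exact: (cvg_pt _ cb' ca').
apply: (@cvg_trans _ ((fun s => pa i (pt j (- (k * sg * pb j (gamma^`()%classic s)))
    (k * sg * pa j (gamma^`()%classic s)))) @ s0)).
  by apply: near_eq_cvg; apply: filterS nearE => s ->.
rewrite (nbhs_singleton nearE).
exact: cvg_comp c (@cvg_pa R i _).
Qed.

Lemma flux_integrand_continuous (F1 F2 : R * R -> R) :
  {within U, continuous F1} -> {within U, continuous F2} ->
  continuous (fun s => dot (F1 (gamma s), F2 (gamma s)) (n (gamma s))).
Proof.
move=> c1 c2 s.
have on (F : R * R -> R) : {within U, continuous F} -> {for s, continuous (fun s => F (gamma s))}.
  have Ug x : U (gamma x) by have /(bdryP hU)[] := bdry_curve hU x.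
  by move=> cF; exact: (continuous_into cF (curve_continuous arc (x := s)) Ug).
rewrite /dot/=; apply: cvgD; apply: cvgM.
- exact: on.
- exact: (@normal_continuous true s).
- exact: on.
- exact: (@normal_continuous false s).
Qed.

(** The period of integration is centred at s0, so that the integrand vanishes
    outside the chart by [bc_loc]. *)
Lemma boundary_local (u : R * R) : bdry U u -> exists2 rho, 0 < rho &
  forall F1 F2 g p1 q1 p2 q2, field U F1 F2 g p1 q1 p2 q2 -> supported U u rho F1 F2 g ->
  \int[(@lebesgue_measure R \x @lebesgue_measure R)%E]_(v in U) g v = flux F1 F2.
Proof.
move=> /(curve_bdry arc 0)[s0 _ <-].
have [i [sg [k [a [r [rho bc]]]]]] := chart_exists s0 hU hn.
exists rho => [|F1 F2 g p1 q1 p2 q2 fF supp]; first exact: bc_rho bc.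
have L0 := ap_length arc; have a0 := bc_a bc; have aL := bc_aL bc.
pose A := if i then F1 else F2; pose B := if i then F2 else F1.
pose Aa := if i then p1 else q2; pose Ab := if i then q1 else p2; pose Bb := if i then q2 else p1.
have supp' v : U v -> ~ (`|pa i v - pa i (gamma s0)| < rho /\ `|pb i v - pb i (gamma s0)| < rho) ->
    [/\ A v = 0, B v = 0 & g v = 0].
  move=> Uv h; have [|h1 h2 h3] := supp v Uv.
    by move: h; case: (i) => h; move=> [? ?]; apply: h.
  by rewrite /A /B; case: (i).
have E : \int[(@lebesgue_measure R \x @lebesgue_measure R)%E]_(v in U) g v =
    \int[lebesgue_measure]_(s in `[s0 - a, s0 + a])
    (k * sg * (pa i (gamma^`()%classic s) * B (gamma s) - pb i (gamma^`()%classic s) * A (gamma s))).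
  apply: (@chart_divergence R U gamma L n s0 i sg k a r rho hU bc A B g Aa Ab Bb domain_compact).
  - by rewrite /A; case: (i); [exact: f_c1 fF|exact: f_c2 fF].
  - by rewrite /B; case: (i); [exact: f_c2 fF|exact: f_c1 fF].
  - exact: f_cg fF.
  - by rewrite /A/Aa; case: (i); [exact: f_d11 fF|exact: f_d22 fF].
  - by rewrite /A/Ab; case: (i); [exact: f_d12 fF|exact: f_d21 fF].
  - by rewrite /B/Bb; case: (i); [exact: f_d22 fF|exact: f_d11 fF].
  - by rewrite /Aa; case: (i); [exact: f_cp1 fF|exact: f_cq2 fF].
  - by rewrite /Ab; case: (i); [exact: f_cq1 fF|exact: f_cp2 fF].
  - by move=> v Iv; rewrite (f_div fF Iv) /Aa /Bb; case: (i) => //; rewrite addrC.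
  - exact: supp'.
rewrite E /flux /curve_integral.
pose f s := dot (F1 (gamma s), F2 (gamma s)) (n (gamma s)).
have cf : continuous f by apply: flux_integrand_continuous; [exact: f_c1 fF|exact: f_c2 fF].
have pf s : f (s + L) = f s by rewrite /f (ap_periodic arc).
have fE s : f s = A (gamma s) * pa i (n (gamma s)) + B (gamma s) * pb i (n (gamma s)).
  by rewrite /f (dot_pt i) /A /B; case: (i).
have Ug s : U (gamma s) by have /(bdryP hU)[] := bdry_curve hU s.
have zero s : `|s - s0| <= L / 2 -> a <= `|s - s0| -> A (gamma s) = 0 /\ B (gamma s) = 0.
  move=> sL sa; have [] // := supp' (gamma s) (Ug s).
  by move=> [h1 h2]; have := bc_loc bc sL h1 h2; rewrite ltNge sa.
rewrite -/f -(periodic_integral (s0 - L / 2) L0 cf pf).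
have -> : s0 - L / 2 + L = s0 + L / 2 by lra.
have win s : s0 - L / 2 <= s <= s0 + L / 2 -> `|s - s0| <= L / 2 by rewrite ler_distl.
transitivity (\int[lebesgue_measure]_(s in `[s0 - a, s0 + a]) f s); last first.
  symmetry; apply: Rintegral_restrict.
    by move=> s; rewrite /= !in_itv/= => /andP[h1 h2]; apply/andP; split; lra.
  move=> s; rewrite /= !in_itv/= => sI /negP; rewrite -ler_distl -ltNge => /ltW sa.
  have sL := win _ sI.
  by have [h1 h2] := zero _ sL sa; rewrite fE h1 h2 !mul0r addr0.
apply: eq_Rintegral => s; rewrite inE/= in_itv/= -ler_distl => sa.
have [sa'|sa'] := ltP `|s - s0| a.
  by rewrite fE (bc_normal bc sa') pa_pt pb_pt; ring.
have sL : `|s - s0| <= L / 2 by apply: le_trans sa (ltW aL).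
by have [h1 h2] := zero _ sL sa'; rewrite fE h1 h2 !mul0r !mulr0 addr0 subrr mulr0.
Qed.
End flux.
(** The field vanishes on the sides of the box. *)
Lemma interior_local (R : realType) (U : set (R * R)) (u : R * R) : compact U -> U° u ->
  exists2 rho, 0 < rho &
  (forall v, `|v.1 - u.1| < rho -> `|v.2 - u.2| < rho -> U° v) /\
  forall F1 F2 g p1 q1 p2 q2, field U F1 F2 g p1 q1 p2 q2 -> supported U u rho F1 F2 g ->
  \int[(@lebesgue_measure R \x @lebesgue_measure R)%E]_(v in U) g v = 0.
Proof.
move=> cU Iu.
have /nbhs_box[e e0 eU] : nbhs u U° by apply: open_nbhs_nbhs; split => //; exact: open_interior.
exists (e / 2) => [|]; first by rewrite divr_gt0.
have ee : e / 2 < e by rewrite ltr_pdivrMr// ltr_pMr// ltr1n.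
split=> [v h1 h2|F1 F2 g p1 q1 p2 q2 fF supp].
  by apply: eU; apply: lt_trans ee.
set rho := e / 2 in ee supp *.
have rho0 : 0 < rho by rewrite divr_gt0.
pose K := `[u.1 - rho, u.1 + rho] `*` `[u.2 - rho, u.2 + rho] : set (R * R).
have KI x y : u.1 - rho <= x <= u.1 + rho -> u.2 - rho <= y <= u.2 + rho -> U° (x, y).
  move=> xI yI; apply: eU => /=; apply: le_lt_trans ee; rewrite ler_distl.
    exact: xI.
  exact: yI.
have KU : K `<=` U.
  by move=> [x y] [/=]; rewrite !in_itv/= => h1 h2; apply: interior_subset; exact: KI.
have lo (c : R) : c - rho <= c - rho <= c + rho by apply/andP; split; lra.
have hi (c : R) : c - rho <= c + rho <= c + rho by apply/andP; split; lra.
have far (c x : R) : x = c - rho \/ x = c + rho -> ~ `|x - c| < rho.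
  by move=> [] ->; rewrite addrAC subrr add0r ?normrN gtr0_norm// ltxx.
have edge1 x y : x = u.1 - rho \/ x = u.1 + rho -> U° (x, y) -> F1 (x, y) = 0.
  by move=> xE /interior_subset Uxy; have [|->] := supp _ Uxy; first by move=> [/(far _ _ xE)].
have edge2 x y : y = u.2 - rho \/ y = u.2 + rho -> U° (x, y) -> F2 (x, y) = 0.
  by move=> yE /interior_subset Uxy; have [|_ ->] := supp _ Uxy; first by move=> [_ /(far _ _ yE)].
transitivity (\int[(@lebesgue_measure R \x @lebesgue_measure R)%E]_(v in K) g v).
  apply: Rintegral_restrict => // v Uv nK; have [|_ _ ->//] := supp v Uv.
  rewrite !ltr_norml => -[/andP[h1 h2] /andP[h3 h4]]; apply: nK.
  by split; rewrite /= in_itv/=; apply/andP; split; lra.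
have cg : {within K, continuous g} by exact: continuous_subspaceW KU (f_cg fF).
rewrite (Rfubini_box true cg)/=.
transitivity (\int[lebesgue_measure]_(x in `[u.1 - rho, u.1 + rho]) F2 (x, u.2 + rho) -
    \int[lebesgue_measure]_(x in `[u.1 - rho, u.1 + rho]) F2 (x, u.2 - rho)); last first.
  have zero y : y = u.2 - rho \/ y = u.2 + rho -> u.2 - rho <= y <= u.2 + rho ->
      \int[lebesgue_measure]_(x in `[u.1 - rho, u.1 + rho]) F2 (x, y) = 0.
    move=> yE yI; transitivity (\int[@lebesgue_measure R]_(x in `[u.1 - rho, u.1 + rho]) (0 : R)).
      by apply: eq_Rintegral => x; rewrite inE/= in_itv/= => xI; apply: edge2 yE _; exact: KI.
    by rewrite Rintegral_cst// mul0r.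
  by rewrite !zero ?subrr//; [left|right].
apply: (@rectangle_divergence R F1 F2 g p1 q2).
- by lra.
- by lra.
- exact: continuous_subspaceW KU (f_c2 fF).
- exact: cg.
- apply: continuous_in_subspaceT => -[x y]; rewrite inE => -[/=].
  rewrite !in_itv/= => xI /andP[y1 y2]; apply: (f_cp1 fF); apply: KI => //.
  by rewrite !ltW.
- move=> x y xI /andP[y1 y2]; apply/(is_derive_ptP true); apply: (f_d11 fF).
  by apply: KI => //; rewrite !ltW.
- move=> x y xI /andP[y1 y2]; apply/(is_derive_ptP' true); apply: (f_d22 fF).
  by apply: KI => //; rewrite !ltW.
- move=> x y xI /andP[y1 y2]; apply: (f_div fF).
  by apply: KI => //; rewrite !ltW.
- move=> y /andP[y1 y2]; have yI : u.2 - rho <= y <= u.2 + rho by rewrite !ltW.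
  by split; apply: edge1; [left|exact: KI|right|exact: KI].
Qed.

(** * The divergence theorem *)

Lemma derive_quadratic_bound (R : realType) (f : R -> R) (y d : R) :
  (forall t, `|f (y + t) - f y - d * t| <= t ^+ 2) -> is_derive y 1 f d.
Proof.
move=> H; apply/is_derive_cvgP/cvgrPdist_lt => e e0.
rewrite near_withinE; apply/nbhs_ballP; exists e => //= t.
rewrite /ball/= sub0r normrN => te t0; apply: le_lt_trans te.
rewrite [t *: 1]mulr1 [_ *: _]/(_ * _).
have -> : d - t^-1 * (f (t + y) - f y) = - t^-1 * (f (y + t) - f y - d * t).
  by rewrite [t + y]addrC; field.
rewrite normrM normrN normfV mulrC ler_pdivrMr ?normr_gt0//.
by apply: le_trans (H t) _; rewrite -expr2 real_normK ?num_real.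
Qed.

Definition pos_part {R : realType} (y : R) : R := (y + `|y|) / 2.

Lemma pos_partE (R : realType) (y : R) : 0 <= y -> pos_part y = y.
Proof. by move=> y0; rewrite /pos_part ger0_norm//; field. Qed.

Lemma pos_part0 (R : realType) (y : R) : y <= 0 -> pos_part y = 0.
Proof. by move=> y0; rewrite /pos_part ler0_norm// subrr mul0r. Qed.

Lemma pos_part_sq_derive (R : realType) (y : R) :
  is_derive y 1 (fun y => pos_part y ^+ 2) (2 * pos_part y).
Proof.
apply: derive_quadratic_bound => t; rewrite ler_norml.
have [h1|/ltW h1] := leP 0 y; have [h2|/ltW h2] := leP 0 (y + t);
  rewrite ?(pos_partE h1) ?(pos_part0 h1) ?(pos_partE h2) ?(pos_part0 h2).
- by apply/andP; split; nra.
- by apply/andP; split; nra.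
- by apply/andP; split; nra.
- by apply/andP; split; nra.
Qed.

Lemma pos_part_continuous (R : realType) : continuous (@pos_part R).
Proof.
move=> y; apply: cvgM; last exact: cvg_cst.
by apply: cvgD; [exact: cvg_id|apply: cvg_norm; exact: cvg_id].
Qed.

(** A C^1 bump of radius rho around c, the square of the positive part of a
    parabola; [dbeta] is its derivative. *)
Definition beta {R : realType} (c rho x : R) : R := pos_part (1 - ((x - c) / rho) ^+ 2) ^+ 2.
Definition dbeta {R : realType} (c rho x : R) : R :=
  2 * pos_part (1 - ((x - c) / rho) ^+ 2) * - (2 / rho ^+ 2 * (x - c)).

Lemma beta_derive (R : realType) (c rho x : R) : is_derive x 1 (beta c rho) (dbeta c rho x).
Proof.
apply: (@is_derive_compR R _ (fun x => 1 - ((x - c) / rho) ^+ 2) (fun y => pos_part y ^+ 2)).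
  exact: pos_part_sq_derive.
have h : is_derive x 1 (fun x : R => (x - c) / rho) rho^-1.
  by apply: is_derive_eq; rewrite /GRing.scale/=; ring.
by apply: is_derive_eq; rewrite /GRing.scale/= -?exprVn !expr2 ?invfM; ring.
Qed.

Lemma beta_continuous (R : realType) (c rho : R) : continuous (beta c rho).
Proof. by move=> x; exact: is_derive_continuous (beta_derive c rho x). Qed.

Lemma dbeta_continuous (R : realType) (c rho : R) : continuous (dbeta c rho).
Proof.
move=> x; have cl : (y - c) @[y --> x] --> x - c by apply: cvgB; [exact: cvg_id|exact: cvg_cst].
apply: cvgM; last by apply: cvgN; apply: cvgM; [exact: cvg_cst|exact: cl].
apply: cvgM; first exact: cvg_cst.
apply: (cvg_comp (fun y => 1 - ((y - c) / rho) ^+ 2) pos_part _ (@pos_part_continuous R _)).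
apply: cvgB; first exact: cvg_cst.
by rewrite !expr2; apply: cvgM; apply: cvgM => //; exact: cvg_cst.
Qed.

Lemma beta_ge0 (R : realType) (c rho x : R) : 0 <= beta c rho x.
Proof. exact: sqr_ge0. Qed.

Lemma beta_gt0 (R : realType) (c rho x : R) : 0 < rho -> `|x - c| < rho -> 0 < beta c rho x.
Proof.
move=> r0 xc; have h : 0 < 1 - ((x - c) / rho) ^+ 2.
  rewrite subr_gt0 -real_normK ?num_real// expr_lt1// normrM normfV (gtr0_norm r0).
  by rewrite ltr_pdivrMr// mul1r.
by rewrite /beta pos_partE ?ltW// exprn_gt0.
Qed.

Lemma beta_out (R : realType) (c rho x : R) : 0 < rho -> rho <= `|x - c| ->
  beta c rho x = 0 /\ dbeta c rho x = 0.
Proof.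
move=> r0 xc; have h : 1 - ((x - c) / rho) ^+ 2 <= 0.
  rewrite subr_le0 -real_normK ?num_real// expr_ge1// normrM normfV (gtr0_norm r0).
  by rewrite ler_pdivlMr// mul1r.
by rewrite /beta /dbeta pos_part0// expr0n/= !mulr0 mul0r.
Qed.

(** b1 and b2 extend the partial derivatives of b continuously from the interior
    of U to U. *)
Record c1fun (R : realType) (U : set (R * R)) (b b1 b2 : R * R -> R) : Prop := {
  c1_c : {within U, continuous b};
  c1_c1 : {within U, continuous b1};
  c1_c2 : {within U, continuous b2};
  c1_d1 : forall v, U° v -> is_derive v (ev true) b (b1 v);
  c1_d2 : forall v, U° v -> is_derive v (ev false) b (b2 v) }.

Lemma interior_continuous (R : realType) (U : set (R * R)) (f : R * R -> R) v :
  {within U, continuous f} -> U° v -> {for v, continuous f}.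
Proof.
move=> /subspace_continuousP cf Iv; have := cf v (interior_subset Iv).
by apply: cvg_within_mem; exact: Iv.
Qed.

Definition bump {R : realType} (u : R * R) (rho : R) (v : R * R) : R :=
  beta u.1 rho v.1 * beta u.2 rho v.2.
Definition bump1 {R : realType} (u : R * R) (rho : R) (v : R * R) : R :=
  dbeta u.1 rho v.1 * beta u.2 rho v.2.
Definition bump2 {R : realType} (u : R * R) (rho : R) (v : R * R) : R :=
  beta u.1 rho v.1 * dbeta u.2 rho v.2.

Lemma continuous_prod2 (R : realType) (f g : R -> R) : continuous f -> continuous g ->
  continuous (fun v : R * R => f v.1 * g v.2).
Proof.
move=> cf cg v; apply: cvgM.
  by apply: continuous_fst; exact: cf.
by apply: (@continuous_comp _ _ _ snd g); [exact: cvg_snd|exact: cg].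
Qed.

Lemma bump_c1 (R : realType) (U : set (R * R)) u rho :
  c1fun U (bump u rho) (bump1 u rho) (bump2 u rho).
Proof.
split.
- by apply: continuous_subspaceT; apply: continuous_prod2; exact: beta_continuous.
- by apply: continuous_subspaceT; apply: continuous_prod2; [exact: dbeta_continuous|exact: beta_continuous].
- by apply: continuous_subspaceT; apply: continuous_prod2; [exact: beta_continuous|exact: dbeta_continuous].
- move=> [x y] _; apply/(is_derive_ptP true); rewrite /bump/=.
  have h := beta_derive u.1 rho x.
  by apply: is_derive_eq; rewrite /GRing.scale/= /bump1/=; ring.
- move=> [x y] _; apply/(is_derive_ptP' true); rewrite /bump/=.
  have h := beta_derive u.2 rho y.
  by apply: is_derive_eq; rewrite /GRing.scale/= /bump2/=; ring.
Qed.

Lemma c1funD (R : realType) (U : set (R * R)) (b b1 b2 c c1 c2 : R * R -> R) :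
  c1fun U b b1 b2 -> c1fun U c c1 c2 ->
  c1fun U (fun v => b v + c v) (fun v => b1 v + c1 v) (fun v => b2 v + c2 v).
Proof.
move=> hb hc; split.
- by apply: within_continuousD; [exact: (c1_c hb)|exact: (c1_c hc)].
- by apply: within_continuousD; [exact: (c1_c1 hb)|exact: (c1_c1 hc)].
- by apply: within_continuousD; [exact: (c1_c2 hb)|exact: (c1_c2 hc)].
- by move=> v Iv; exact: (is_deriveD (c1_d1 hb Iv) (c1_d1 hc Iv)).
- by move=> v Iv; exact: (is_deriveD (c1_d2 hb Iv) (c1_d2 hc Iv)).
Qed.

Lemma c1fun0 (R : realType) (U : set (R * R)) :
  c1fun U (fun _ => 0 : R) (fun _ => 0) (fun _ => 0).
Proof. by split; try exact: within_cst; move=> v _; exact: is_derive_cst. Qed.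

Lemma c1funV (R : realType) (U : set (R * R)) (b b1 b2 : R * R -> R) :
  (forall v, U v -> b v != 0) -> c1fun U b b1 b2 ->
  c1fun U (fun v => (b v)^-1) (fun v => - b1 v * ((b v)^-1 * (b v)^-1))
    (fun v => - b2 v * ((b v)^-1 * (b v)^-1)).
Proof.
move=> b0 hb.
have cV : {within U, continuous (fun v => (b v)^-1)}.
  have /subspace_continuousP cb := c1_c hb.
  by apply/subspace_continuousP => v Uv; apply: cvgV; [exact: b0|exact: cb].
have cN (f : R * R -> R) : {within U, continuous f} -> {within U, continuous (fun v => - f v)}.
  by move=> /subspace_continuousP cf; apply/subspace_continuousP => v Uv; apply: cvgN; exact: cf.
have dV v e d : U° v -> is_derive v e b d ->
    is_derive v e (fun v => (b v)^-1) (- d * ((b v)^-1 * (b v)^-1)).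
  move=> Iv db; have bv := b0 v (interior_subset Iv).
  have dinv : is_derive (b v) 1 (fun y : R => y^-1) (- (b v) ^- 2).
    have := @is_deriveV R id (b v) 1 1 bv (is_derive_id _ _).
    by rewrite [_ *: 1]mulr1.
  have := is_derive_compR dinv db; congr is_derive.
  by rewrite -exprVn expr2; ring.
split => //.
- by apply: withinM; [exact: (cN _ (c1_c1 hb))|exact: withinM].
- by apply: withinM; [exact: (cN _ (c1_c2 hb))|exact: withinM].
- by move=> v Iv; apply: dV => //; exact: (c1_d1 hb Iv).
- by move=> v Iv; apply: dV => //; exact: (c1_d2 hb Iv).
Qed.

Lemma field_scale (R : realType) (U : set (R * R)) (b b1 b2 F1 F2 g p1 q1 p2 q2 : R * R -> R) :
  c1fun U b b1 b2 -> field U F1 F2 g p1 q1 p2 q2 ->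
  field U (fun v => b v * F1 v) (fun v => b v * F2 v)
    (fun v => b v * g v + b1 v * F1 v + b2 v * F2 v)
    (fun v => b v * p1 v + b1 v * F1 v) (fun v => b v * q1 v + b2 v * F1 v)
    (fun v => b v * p2 v + b1 v * F2 v) (fun v => b v * q2 v + b2 v * F2 v).
Proof.
move=> hb hF.
have dM v e (F : R * R -> R) d d' : is_derive v e b d -> is_derive v e F d' ->
    is_derive v e (fun v => b v * F v) (b v * d' + d * F v).
  move=> h h'; have := is_deriveM h h'; congr is_derive.
  by rewrite /GRing.scale/=; ring.
have cc v (F p c : R * R -> R) : U° v -> {within U, continuous F} -> {within U, continuous c} ->
    {for v, continuous p} -> {for v, continuous (fun v => b v * p v + c v * F v)}.
  move=> Iv cF ccc cp; apply: cvgD; apply: cvgM => //; apply: interior_continuous Iv => //.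
  exact: (c1_c hb).
split.
- by apply: withinM; [exact: (c1_c hb)|exact: f_c1 hF].
- by apply: withinM; [exact: (c1_c hb)|exact: f_c2 hF].
- apply: within_continuousD; last by apply: withinM; [exact: (c1_c2 hb)|exact: f_c2 hF].
  apply: within_continuousD; apply: withinM; [exact: (c1_c hb)|exact: f_cg hF|exact: (c1_c1 hb)|exact: f_c1 hF].
- by move=> v Iv; apply: dM; [exact: (c1_d1 hb Iv)|exact: (f_d11 hF Iv)].
- by move=> v Iv; apply: dM; [exact: (c1_d2 hb Iv)|exact: (f_d12 hF Iv)].
- by move=> v Iv; apply: dM; [exact: (c1_d1 hb Iv)|exact: (f_d21 hF Iv)].
- by move=> v Iv; apply: dM; [exact: (c1_d2 hb Iv)|exact: (f_d22 hF Iv)].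
- by move=> v Iv; apply: cc => //; [exact: f_c1 hF|exact: (c1_c1 hb)|exact: (f_cp1 hF Iv)].
- by move=> v Iv; apply: cc => //; [exact: f_c1 hF|exact: (c1_c2 hb)|exact: (f_cq1 hF Iv)].
- by move=> v Iv; apply: cc => //; [exact: f_c2 hF|exact: (c1_c1 hb)|exact: (f_cp2 hF Iv)].
- by move=> v Iv; apply: cc => //; [exact: f_c2 hF|exact: (c1_c2 hb)|exact: (f_cq2 hF Iv)].
- by move=> v Iv; rewrite (f_div hF Iv); ring.
Qed.

(** The covering property of compact sets is stated for pointed spaces. *)
Definition pointed_plane (R : realType) : ptopologicalType :=
  HB.pack (R * R)%type (Topological.class (R * R)%type) (Pointed.class (R * R)%type).

Lemma plane_cover_compact (R : realType) (U : set (R * R)) : compact U -> cover_compact U.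
Proof. by have /(congr1 (fun f => f U)) /= <- := @compact_cover (pointed_plane R). Qed.

Lemma c1fun_integrand (R : realType) (U : set (R * R)) (b b1 b2 F1 F2 g p1 q1 p2 q2 : R * R -> R) :
  c1fun U b b1 b2 -> field U F1 F2 g p1 q1 p2 q2 ->
  {within U, continuous (fun v => b v * g v + b1 v * F1 v + b2 v * F2 v)}.
Proof. by move=> hb hF; exact: (f_cg (field_scale hb hF)). Qed.

Section divergence.
Variables (R : realType) (U : set (R * R)) (gamma : R -> R * R) (L : R).
Variables (n : R * R -> R * R).
Hypothesis hU : smooth_sc_domain U gamma L.
Hypothesis hn : exterior_unit_normal U gamma n.
Let arc := dom_boundary hU.
Let lambda2 := (@lebesgue_measure R \x @lebesgue_measure R)%E.

Lemma curve_in_domain s : U (gamma s).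
Proof. by have /(bdryP hU)[] := bdry_curve hU s. Qed.

Lemma local_flux (u : R * R) : U u -> exists2 rho, 0 < rho &
  forall F1 F2 g p1 q1 p2 q2, field U F1 F2 g p1 q1 p2 q2 -> supported U u rho F1 F2 g ->
  \int[lambda2]_(v in U) g v = flux gamma L n F1 F2.
Proof.
move=> Uu; have [Iu|Iu] := pselect (U° u); last first.
  have bu : bdry U u by apply/(bdryP hU).
  exact: (boundary_local hU hn bu).
have [rho rho0 [box H]] := interior_local (domain_compact hU) Iu.
exists rho => // F1 F2 g p1 q1 p2 q2 hF supp; rewrite (H _ _ _ _ _ _ _ hF supp).
rewrite /flux /curve_integral.
transitivity (\int[@lebesgue_measure R]_(s in `[0, L]) (0 : R)).
  by rewrite Rintegral_cst// mul0r.
apply: eq_Rintegral => s _.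
have [] := supp _ (curve_in_domain s).
  have /(bdryP hU)[_ nI] := bdry_curve hU s.
  by move=> [h1 h2]; exact: nI (box _ h1 h2).
by move=> -> -> _; rewrite /dot/= !mul0r addr0.
Qed.

(** The divergence theorem for the products b * F. It is additive in b. *)
Definition flux_weight (b b1 b2 : R * R -> R) := forall F1 F2 g p1 q1 p2 q2,
  field U F1 F2 g p1 q1 p2 q2 ->
  \int[lambda2]_(v in U) (b v * g v + b1 v * F1 v + b2 v * F2 v) =
  flux gamma L n (fun v => b v * F1 v) (fun v => b v * F2 v).

Lemma flux_weightD (b b1 b2 c c1 c2 : R * R -> R) :
  c1fun U b b1 b2 -> c1fun U c c1 c2 ->
  flux_weight b b1 b2 -> flux_weight c c1 c2 ->
  flux_weight (fun v => b v + c v) (fun v => b1 v + c1 v) (fun v => b2 v + c2 v).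
Proof.
move=> hb hc wb wc F1 F2 g p1 q1 p2 q2 hF.
have cU := domain_compact hU.
transitivity (\int[lambda2]_(v in U) ((b v * g v + b1 v * F1 v + b2 v * F2 v) +
    (c v * g v + c1 v * F1 v + c2 v * F2 v))).
  by apply: eq_Rintegral => v _; ring.
rewrite RintegralD; last 3 first.
- exact: compact_measurable2.
- exact: (integrable2 cU (c1fun_integrand hb hF)).
- exact: (integrable2 cU (c1fun_integrand hc hF)).
rewrite (wb _ _ _ _ _ _ _ hF) (wc _ _ _ _ _ _ _ hF) /flux /curve_integral.
have ci (d d1 d2 : R * R -> R) : c1fun U d d1 d2 -> (@lebesgue_measure R).-integrable `[0, L]
    (EFin \o (fun s => dot (d (gamma s) * F1 (gamma s), d (gamma s) * F2 (gamma s)) (n (gamma s)))).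
  move=> hd; apply: integrable_seg; apply: continuous_subspaceT.
  apply: (flux_integrand_continuous hU hn (F1 := fun v => d v * F1 v) (F2 := fun v => d v * F2 v)).
    by apply: withinM; [exact: (c1_c hd)|exact: (f_c1 hF)].
  by apply: withinM; [exact: (c1_c hd)|exact: (f_c2 hF)].
rewrite -RintegralD//; [|exact: (ci _ _ _ hb)|exact: (ci _ _ _ hc)].
by apply: eq_Rintegral => s _; rewrite /dot/=; ring.
Qed.

Lemma flux_weight0 : flux_weight (fun _ => 0) (fun _ => 0) (fun _ => 0).
Proof.
move=> F1 F2 g p1 q1 p2 q2 _; rewrite /flux /curve_integral.
transitivity (\int[lambda2]_(v in U) (0 : R)).
  by apply: eq_Rintegral => v _; rewrite !mul0r !addr0.
transitivity (\int[@lebesgue_measure R]_(s in `[0, L]) (0 : R)).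
  by rewrite /Rintegral !integral0.
by apply: eq_Rintegral => s _; rewrite /dot/= !mul0r addr0.
Qed.

Lemma bump_out (u v : R * R) rho : 0 < rho ->
  ~ (`|v.1 - u.1| < rho /\ `|v.2 - u.2| < rho) ->
  [/\ bump u rho v = 0, bump1 u rho v = 0 & bump2 u rho v = 0].
Proof.
move=> rho0 out; rewrite /bump/bump1/bump2.
have [h1|h1] := ltP `|v.1 - u.1| rho; last first.
  by have [-> ->] := beta_out rho0 h1; rewrite !mul0r.
have [h2|h2] := ltP `|v.2 - u.2| rho; first by exfalso; exact: out.
by have [-> ->] := beta_out rho0 h2; rewrite !mulr0.
Qed.

(** b is the sum of the bumps over a finite cover of U by boxes in which
    [local_flux] holds. *)
Lemma cover_weight : exists b b1 b2 : R * R -> R,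
  [/\ c1fun U b b1 b2, forall v, U v -> 0 < b v & flux_weight b b1 b2].
Proof.
have /choice[rho Hrho] : forall u, exists rho, U u -> 0 < rho /\
    forall F1 F2 g p1 q1 p2 q2, field U F1 F2 g p1 q1 p2 q2 -> supported U u rho F1 F2 g ->
    \int[lambda2]_(v in U) g v = flux gamma L n F1 F2.
  move=> u; have [/local_flux[rho r0 H]|nU] := pselect (U u); first by exists rho.
  by exists 0 => /nU.
pose box u := [set v : R * R | `|v.1 - u.1| < rho u /\ `|v.2 - u.2| < rho u].
have finite_weight (s : seq (R * R)) : (forall u, u \in s -> U u) ->
    exists b b1 b2 : R * R -> R, [/\ c1fun U b b1 b2, forall v, 0 <= b v,
      forall u v, u \in s -> box u v -> 0 < b v & flux_weight b b1 b2].
  elim: s => [_|u s IH sU].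
    exists (fun _ => 0), (fun _ => 0), (fun _ => 0); split => //; first exact: c1fun0.
    exact: flux_weight0.
  have [|b [b1 [b2 [hb b0 bpos wb]]]] := IH.
    by move=> v vs; apply: sU; rewrite inE vs orbT.
  have [r0 Hu] := Hrho u (sU u (mem_head _ _)).
  exists (fun v => bump u (rho u) v + b v), (fun v => bump1 u (rho u) v + b1 v),
    (fun v => bump2 u (rho u) v + b2 v).
  have bump0 v : 0 <= bump u (rho u) v by rewrite mulr_ge0// beta_ge0.
  split.
  - by apply: c1funD => //; exact: bump_c1.
  - by move=> v; rewrite addr_ge0.
  - move=> w v; rewrite inE => /orP[/eqP->|ws] bv.
      by apply: ltr_pwDl => //; case: bv => v1 v2; rewrite mulr_gt0// beta_gt0.
    by apply: ltr_wpDl => //; exact: (bpos w).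
  - apply: flux_weightD => //; first exact: bump_c1.
    move=> F1 F2 g p1 q1 p2 q2 hF.
    apply: (Hu _ _ _ _ _ _ _ (field_scale (bump_c1 U u (rho u)) hF)).
    move=> v _ out; have [-> -> ->] := bump_out r0 out.
    by rewrite !mul0r !addr0.
have /(_ (R * R)%type U box)[] := plane_cover_compact (domain_compact hU).
- move=> u Uu; rewrite openE => v [v1 v2].
  have c1 : \forall w \near v, `|w.1 - u.1| < rho u.
    have c : `|w.1 - u.1| @[w --> v] --> `|v.1 - u.1|.
      by apply: cvg_norm; apply: cvgB; [exact: cvg_fst|exact: cvg_cst].
    exact: (cvgr_lt _ c _ v1).
  have c2 : \forall w \near v, `|w.2 - u.2| < rho u.
    have c : `|w.2 - u.2| @[w --> v] --> `|v.2 - u.2|.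
      by apply: cvg_norm; apply: cvgB; [exact: cvg_snd|exact: cvg_cst].
    exact: (cvgr_lt _ c _ v2).
  by apply: filterS2 c1 c2 => w.
- move=> u Uu; exists u => //; have [r0 _] := Hrho u Uu.
  by rewrite /box/= !subrr normr0.
move=> D DU cov.
have [|b [b1 [b2 [hb b0 bpos wb]]]] := finite_weight (finmap.enum_fset D).
  by move=> u uD; have := DU u uD; rewrite inE.
exists b, b1, b2; split => // v Uv; have [u /= uD] := cov v Uv.
exact: bpos.
Qed.

(** [flux_weight] for the field F / b is the theorem for F. *)
Theorem divergence_theorem F1 F2 g p1 q1 p2 q2 : field U F1 F2 g p1 q1 p2 q2 ->
  \int[lambda2]_(v in U) g v = flux gamma L n F1 F2.
Proof.
move=> hF; have [b [b1 [b2 [hb bpos wb]]]] := cover_weight.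
have bn v : U v -> b v != 0 by move=> /bpos; exact: lt0r_neq0.
have := wb _ _ _ _ _ _ _ (field_scale (c1funV bn hb) hF).
set lhs := Rintegral _ _ _; set rhs := flux _ _ _ _ _ => E.
transitivity lhs; first by apply: eq_Rintegral => v; rewrite inE => /bn bv; field.
rewrite E; apply: eq_Rintegral => s _; rewrite /dot/=.
by have bs := bn _ (curve_in_domain s); rewrite !mulVKf.
Qed.
End divergence.

(** * The surface tension, the mobility and the field W *)

Lemma sin_ge_cos (R : realType) (s : R) : 0 <= s <= pi / 2 -> s * cos s <= sin s.
Proof.
move=> /andP[s0 s1]; have d z : `[0, s]%classic z -> is_derive z 1 (fun z : R => sin z - z * cos s) (cos z - cos s).
  by move=> _; apply: is_derive_eq; rewrite /GRing.scale/= !mulr1 mulr0 add0r.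
have I0 : `[0, s]%classic 0 by rewrite /= in_itv/= lexx.
have I1 : `[0, s]%classic s by rewrite /= in_itv/= lexx andbT.
have [z [zI _]] := mvt_itv (@interval_is_interval _ `[0, s]) d I0 I1.
rewrite sin0 mul0r !subr0 => E; rewrite -subr_ge0 E mulr_ge0// subr_ge0.
move: zI; rewrite /= in_itv/= => /andP[z0 zs].
have pi2 : pi / 2 <= pi :> R by have := pi_ge0 R; lra.
have zp : z \in `[0, pi] by rewrite in_itv/= z0 (le_trans zs)// (le_trans s1).
have sp : s \in `[0, pi] by rewrite in_itv/= s0 (le_trans s1).
by rewrite leNgt ltr_cos// -leNgt.
Qed.

(** Apply [sin_ge_cos] at t / 2 in the formula for the sine of twice an angle. The
    bound makes ln (2 sin t) comparable with ln t near 0. *)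
Lemma sin_lower_bound (R : realType) (u t : R) : u < pi -> 0 <= t <= u ->
  t * cos (u / 2) ^+ 2 <= sin t.
Proof.
move=> up /andP[t0 tu]; have -> : t = t / 2 + t / 2 by field.
have p2 : pi / 2 <= pi :> R by have := pi_ge0 R; lra.
have h1 : 0 <= t / 2 <= pi / 2 by apply/andP; split; lra.
have h2 : 0 <= u / 2 <= pi / 2 by apply/andP; split; lra.
have cu : 0 <= cos (u / 2) by apply: cos_ge0_pihalf; have := pi_ge0 R; lra.
have ct : cos (u / 2) <= cos (t / 2).
  by rewrite leNgt ltr_cos ?in_itv/= -?leNgt; lra.
have := sin_ge_cos h1; rewrite sinD.
move: h1 => /andP[h1 _]; move: h1 cu ct; set c := cos (t / 2); set C := cos (u / 2); set s := sin _.
move: (t / 2) => x x0 C0 Cc xs.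
have h : x * C <= s by apply: le_trans xs; rewrite ler_wpM2l.
have s0 : 0 <= s by apply: le_trans h; rewrite mulr_ge0.
have : x * C * C <= s * c by apply: ler_pM => //; rewrite mulr_ge0.
by rewrite expr2; lra.
Qed.

(** The nonnegative function ln u - ln t has the bounded antiderivative
    t ln u - t ln t + t; exhaust ]0, u] by segments. *)
Lemma ln_integrable (R : realType) (u : R) : 0 < u ->
  (@lebesgue_measure R).-integrable `]0, u] (EFin \o (fun t => ln u - ln t)).
Proof.
move=> u0; pose f (t : R) := ln u - ln t.
have mf (D : set R) : measurable D -> measurable_fun D (EFin \o f).
  move=> mD; apply/measurable_EFinP; apply: (@measurable_funS _ _ _ _ setT) => //.
  by apply: measurable_funB => //; exact: measurable_ln.
pose F (i : nat) : set R := `[u / i.+1%:R, u]%classic.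
have FU : \bigcup_i F i = `]0, u]%classic.
  apply/seteqP; split=> [t [i _]|t]; rewrite /F/= !in_itv/= => /andP[h1 h2].
    by rewrite h2 andbT (lt_le_trans _ h1)// divr_gt0// ltr0n.
  have [i Hi] : exists i : nat, u / t < i.+1%:R.
    exists (Num.truncn (u / t)); have := truncnS_gt (u / t).
    by rewrite -natr1.
  exists i => //=; rewrite in_itv/= h2 andbT.
  by rewrite ler_pdivrMr ?ltr0n// -ler_pdivrMl// mulrC ltW.
have f0 t : 0 < t -> t <= u -> 0 <= f t.
  by move=> t0 tu; rewrite subr_ge0 ler_ln.
pose G (t : R) := t * ln u - t * ln t + t.
have dG (t : R) : 0 < t -> is_derive t 1 G (f t).
  move=> t0; have dl := is_derive1_ln t0.
  apply: is_derive_eq; rewrite /GRing.scale/= !mulr1 divff ?gt_eqF// mulr0 /f; lra.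
have If i : (\int[lebesgue_measure]_(t in F i) (f t)%:E <= u%:E)%E.
  have ui : 0 < u / i.+1%:R by rewrite divr_gt0// ltr0n.
  have ui1 : u / i.+1%:R <= u by rewrite ler_pdivrMr ?ltr0n// ler_peMr ?ler1n// ltW.
  have cf : {within F i, continuous f}.
    apply: continuous_in_subspaceT => t; rewrite inE /F/= in_itv/= => /andP[t1 _].
    by apply: cvgB; [exact: cvg_cst|apply: continuous_ln; exact: lt_le_trans t1].
  have intf := integrable_seg cf.
  have mF : measurable (`[u / i.+1%:R, u]%classic : set R) by exact: measurable_itv.
  have fin := @integrable_fin_num _ _ R (@lebesgue_measure R) _ mF _ intf.
  rewrite -(fineK fin) lee_fin (_ : fine _ = G u - G (u / i.+1%:R)); last first.
    apply: (@RFTC2 R G f) => //.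
      apply: continuous_in_subspaceT => t; rewrite inE/= in_itv/= => /andP[t1 _].
      by apply: is_derive_continuous (dG t _); exact: lt_le_trans t1.
    by move=> t /andP[t1 _]; apply: dG; exact: lt_trans t1.
  have e0 : 0 < (i.+1%:R : R)^-1 <= 1 by rewrite invr_gt0 ltr0n/= invf_le1 ?ltr0n// ler1n.
  rewrite /G; have [e0' _] := andP e0; rewrite lnM ?posrE//.
  have le0 : ln (i.+1%:R : R)^-1 <= 0 by apply: ln_le0; case/andP: e0.
  move: e0 le0 => /andP[]; move: (_^-1) => e e0 e1 l0.
  have : 0 <= u * e * - ln e by apply: mulr_ge0; [rewrite mulr_ge0 ?ltW|rewrite oppr_ge0].
  have : 0 <= u * e by rewrite mulr_ge0// ltW.
  by move: (ln u) (ln e) => a b; lra.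
apply/integrableP; split; first by apply: mf.
rewrite (_ : (\int[_]_(x in _) _)%E = (\int[lebesgue_measure]_(x in `]0%R, u]) (f x)%:E)%E); last first.
  apply: eq_integral => t; rewrite inE/= in_itv/= => /andP[t0 tu].
  by rewrite ger0_norm// f0.
apply: (@le_lt_trans _ _ u%:E); last exact: ltry.
have cv : (\int[lebesgue_measure]_(t in F i) (f t)%:E)%E @[i --> \oo] -->
    (\int[lebesgue_measure]_(t in `]0%R, u]) (f t)%:E)%E.
  rewrite -FU; apply: ge0_nondecreasing_set_cvg_integral.
  - move=> i j ij; rewrite subsetEset => t; rewrite /F/= !in_itv/= => /andP[h1 ->].
    rewrite andbT (le_trans _ h1)//; apply: ler_wpM2l; first exact: ltW.
    by rewrite lef_pV2 ?posrE ?ltr0n// ler_nat.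
  - by move=> i; exact: measurable_itv.
  - by move=> i; apply: mf; exact: measurable_itv.
  - move=> i t; rewrite /F/= in_itv/= lee_fin => /andP[h1 h2]; apply: f0 => //.
    by apply: lt_le_trans h1; rewrite divr_gt0// ltr0n.
rewrite -(cvg_lim _ cv)//.
apply: lime_le; first by apply/cvg_ex; eexists; exact: cv.
by apply: nearW => i; exact: If.
Qed.

Lemma Lobachevsky_integrable (R : realType) (u : R) : 0 < u < pi ->
  (@lebesgue_measure R).-integrable `[0, u] (EFin \o (fun t => ln (2 * sin t))).
Proof.
move=> /andP[u0 up]; pose f (t : R) := ln (2 * sin t).
have mf (D : set R) : measurable D -> measurable_fun D (EFin \o f).
  move=> mD; apply/measurable_EFinP; apply: (@measurable_funS _ _ _ _ setT) => //.
  apply: (@measurableT_comp _ _ _ _ _ _ (@ln R)); first exact: measurable_ln.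
  by apply: measurable_funM => //; apply: continuous_measurable_fun; exact: continuous_sin.
have [_ -> //] := @negligible_integrable _ _ R (@lebesgue_measure R) `[0, u] [set 0] (EFin \o f)
  (measurable_set1 _) (measurable_itv _) (mf _ (measurable_itv _)) (lebesgue_measure_set1 _).
have -> : `[0, u] `\` [set 0] = `]0, u]%classic :> set R.
  apply/seteqP; split=> t; rewrite /= !in_itv/=.
    by move=> [/andP[t0 ->] /eqP tn]; rewrite andbT lt_neqAle eq_sym tn t0.
  by move=> /andP[t0 ->]; split; [rewrite ltW|move=> E; rewrite E ltxx in t0].
(* C + (ln u - ln t) dominates |ln (2 sin t)| *)
pose C := `|ln 2| + `|ln (2 * cos (u / 2) ^+ 2 * u)| : R.
have ci : (@lebesgue_measure R).-integrable `]0, u] (EFin \o (fun t => C + (ln u - ln t))).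
  have -> : EFin \o (fun t => C + (ln u - ln t)) =
      ((EFin \o cst C) \+ (EFin \o (fun t => (ln u - ln t)%R)))%E by [].
  apply: integrableD; [exact: measurable_itv| |exact: ln_integrable].
  apply: (@integrableS _ _ R (@lebesgue_measure R) `[0, u]%classic) => //; first exact: subset_itv_oc_cc.
  exact: (integrable_seg (@within_cst _ _ _ _)).
apply: le_integrable ci; [exact: measurable_itv|exact: mf|].
move=> t; rewrite /= in_itv/= => /andP[t0 tu].
have cu : 0 < cos (u / 2) by apply: cos_gt0_pihalf; have := pi_ge0 R => p0; apply/andP; split; lra.
have lb : t * cos (u / 2) ^+ 2 <= sin t by apply: sin_lower_bound => //; rewrite ltW.
have s0 : 0 < sin t by apply: lt_le_trans lb; rewrite mulr_gt0// exprn_gt0.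
have g0 : 0 <= ln u - ln t by rewrite subr_ge0 ler_ln.
have C0 : 0 <= C + (ln u - ln t) by rewrite addr_ge0// /C addr_ge0.
rewrite lee_fin (ger0_norm C0) /f ler_norml.
apply/andP; split; last first.
  apply: (@le_trans _ _ (ln 2)).
    by rewrite ler_ln ?posrE ?mulr_gt0//; have := sin_le1 t; lra.
  by rewrite -addrA; apply: ler_wpDr; [rewrite addr_ge0|exact: ler_norm].
apply: (@le_trans _ _ (ln (2 * cos (u / 2) ^+ 2 * u) - (ln u - ln t))).
  have := ler_norm (- ln (2 * cos (u / 2) ^+ 2 * u)); rewrite normrN.
  have := normr_ge0 (ln 2 : R); rewrite /C.
  by move: (ln _) (ln _) => a b; lra.
have c2 : 0 < 2 * cos (u / 2) ^+ 2 by rewrite mulr_gt0// exprn_gt0.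
rewrite lnM ?posrE//.
rewrite (_ : _ - _ = ln (2 * cos (u / 2) ^+ 2) + ln t); last by ring.
by rewrite -lnM ?posrE// ler_ln ?posrE ?mulr_gt0//; lra.
Qed.

Lemma Lobachevsky_derive (R : realType) (x : R) : 0 < x < pi ->
  is_derive x 1 (@Lobachevsky R) (ln (2 * sin x)).
Proof.
move=> /andP[x0 xp]; pose u := (x + pi) / 2.
have xu : x < u by rewrite /u; lra.
have up : 0 < u < pi by rewrite /u; apply/andP; split; lra.
have s0 : 0 < 2 * sin x by rewrite mulr_gt0// sin_gt0_pi// x0.
have [||d <-] := @continuous_FTC1 R (fun t => ln (2 * sin t)) (BLeft 0) x u xu (Lobachevsky_integrable up).
- by rewrite lte_fin.
- apply: (@continuous_comp _ _ _ (fun t : R => 2 * sin t) (@ln R)).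
    by apply: cvgM; [exact: cvg_cst|exact: continuous_sin].
  exact: continuous_ln.
by rewrite derive1E; exact/derivableP.
Qed.

Lemma cot_derive (R : realType) (x : R) : sin x != 0 ->
  is_derive x 1 (@cot R) (- (sin x)^-1 ^+ 2).
Proof.
move=> sx; have dV := @is_deriveV R sin x (cos x) 1 sx (is_derive_sin x).
have := is_deriveM (is_derive_cos x) dV; congr is_derive.
have := cos2Dsin2 x; rewrite /GRing.scale/= => h.
transitivity (- (cos x ^+ 2 + sin x ^+ 2) * (sin x)^-1 ^+ 2); last by rewrite h mulN1r.
by rewrite -exprVn; field.
Qed.

(** [w1] and [w2] are the partial derivatives of [W1], see [W1_derive]. *)
Definition w1 {R : realType} (r1 r2 : R) : R :=
  sin (pi * r2) ^+ 2 / (2 * sin (pi * (r1 + r2)) ^+ 2).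
Definition w2 {R : realType} (r1 r2 : R) : R :=
  w1 r1 r2 - cot (pi * (r1 + r2)) * sin (pi * r2) * cos (pi * r2) - 1 / 4 + cos (2 * pi * r2) / 2.

(** r1 and r2 depend on a variable in an arbitrary normed space because the formula
    is used both for fields on U and along segments of the triangle. *)
Lemma W1_derive (R : realType) (V : normedModType R) (r1 r2 : V -> R) (v e : V) (d1 d2 : R) :
  is_derive v e r1 d1 -> is_derive v e r2 d2 -> sin (pi * (r1 v + r2 v)) != 0 ->
  is_derive v e (fun v => W1 (r1 v) (r2 v)) (w1 (r1 v) (r2 v) * d1 + w2 (r1 v) (r2 v) * d2).
Proof.
move=> h1 h2 s0.
have p0 : pi != 0 :> R by rewrite gt_eqF// pi_gt0.
have hs : is_derive v e (fun v => pi * (r1 v + r2 v)) (pi * (d1 + d2)).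
  have := is_deriveZ pi (is_deriveD h1 h2); exact.
have hb : is_derive v e (fun v => pi * r2 v) (pi * d2) by have := is_deriveZ pi h2; exact.
have h2b : is_derive v e (fun v => 2 * pi * r2 v) (2 * pi * d2).
  by have := is_deriveZ (2 * pi) h2; exact.
have dcot := is_derive_compR (f := fun v => pi * (r1 v + r2 v)) (cot_derive s0) hs.
have dsin := is_derive_compR (f := fun v => pi * r2 v) (is_derive_sin (pi * r2 v)) hb.
have dsin2 := is_derive_compR (f := fun v => 2 * pi * r2 v) (is_derive_sin (2 * pi * r2 v)) h2b.
have dsq : is_derive v e (fun v => sin (pi * r2 v) * sin (pi * r2 v)) _ := is_deriveM dsin dsin.
have := is_deriveD (is_deriveB (is_deriveZ (- (2 * pi)^-1) (is_deriveM dcot dsq))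
  (is_deriveZ (4^-1) h2)) (is_deriveZ ((4 * pi)^-1) dsin2).
rewrite /GRing.scale/=; set F := (F in is_derive _ _ F _) => H.
have -> : (fun v => W1 (r1 v) (r2 v)) = F.
  apply/funext => z; rewrite /W1/F/=.
  change (- (2 * pi)^-1 * cot (pi * (r1 z + r2 z)) * sin (pi * r2 z) ^+ 2 - r2 z / 4 +
    (4 * pi)^-1 * sin (2 * pi * r2 z) = - (2 * pi)^-1 * (cot (pi * (r1 z + r2 z)) *
    (sin (pi * r2 z) * sin (pi * r2 z))) - 4^-1 * r2 z + (4 * pi)^-1 * sin (2 * pi * r2 z)).
  by ring.
move: H; congr is_derive; rewrite /w2 /w1.
move: p0 s0; move: (sin (pi * (r1 v + r2 v))) (cot _) (sin (pi * r2 v)) (cos (pi * r2 v)) (cos _).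
by move: pi => p s c sb cb c2 p0 s0; field; rewrite s0 p0.
Qed.

Lemma coord_derive (R : realType) (v e : R * R) :
  is_derive v e (fun r : R * R => r.1) e.1 /\ is_derive v e (fun r : R * R => r.2) e.2.
Proof.
have dq (c d : R) : h^-1 * (h * c + d - d) @[h --> 0^'] --> c.
  apply: cvg_near_cst; rewrite near_withinE; near=> h => h0.
  by rewrite addrK mulKf.
split; apply/is_derive_cvgP; exact: dq.
Unshelve. all: by end_near. Qed.

Lemma ln_sin_derive (R : realType) (V : normedModType R) (r : V -> R) (v e : V) (d : R) :
  is_derive v e r d -> 0 < r v < 1 ->
  is_derive v e (fun v => ln (2 * sin (pi * r v))) (pi * cot (pi * r v) * d).
Proof.
move=> hr /andP[r0 r1]; have p0 := pi_gt0 R.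
have s0 : 0 < sin (pi * r v) by rewrite sin_gt0_pi// mulr_gt0//= -[ltRHS]mulr1 ltr_pM2l.
have hb : is_derive v e (fun v => pi * r v) (pi * d) by have := is_deriveZ pi hr; exact.
have dsin := is_derive_compR (f := fun v => pi * r v) (is_derive_sin (pi * r v)) hb.
have d2 : is_derive v e (fun v => 2 * sin (pi * r v)) _ := is_deriveZ 2 dsin.
have s2 : 0 < 2 * sin (pi * r v) by rewrite mulr_gt0.
have := is_derive_compR (f := fun v => 2 * sin (pi * r v)) (is_derive1_ln s2) d2.
congr is_derive; rewrite /GRing.scale/= /cot.
by move: s0; move: (sin _) (cos _) => s c s0; field; rewrite gt_eqF.
Qed.

Lemma Lobachevsky_comp_derive (R : realType) (V : normedModType R) (r : V -> R) (v e : V) (d : R) :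
  is_derive v e r d -> 0 < r v < 1 ->
  is_derive v e (fun v => Lobachevsky (pi * r v)) (ln (2 * sin (pi * r v)) * (pi * d)).
Proof.
move=> hr /andP[r0 r1]; have p0 := pi_gt0 R.
have hb : is_derive v e (fun v => pi * r v) (pi * d) by have := is_deriveZ pi hr; exact.
apply: (is_derive_compR (f := fun v => pi * r v)) hb; apply: Lobachevsky_derive.
by rewrite mulr_gt0//= -[ltRHS]mulr1 ltr_pM2l.
Qed.

(** The derivative of [sigma] at rho in the direction e. *)
Definition dsigma {R : realType} (e rho : R * R) : R :=
  ln (2 * sin (pi * rho.1)) * e.1 + ln (2 * sin (pi * rho.2)) * e.2 +
  ln (2 * sin (pi * (1 - rho.1 - rho.2))) * (- e.1 - e.2).

Lemma third_coord_derive (R : realType) (v e : R * R) :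
  is_derive v e (fun r : R * R => 1 - r.1 - r.2) (- e.1 - e.2).
Proof.
have [h1 h2] := coord_derive v e.
have := is_deriveB (is_deriveB (is_derive_cst (1 : R) v e) h1) h2.
by congr is_derive; rewrite sub0r.
Qed.

Lemma triangle_coords (R : realType) (rho : R * R) : triangle rho ->
  [/\ 0 < rho.1 < 1, 0 < rho.2 < 1 & 0 < 1 - rho.1 - rho.2 < 1].
Proof. by move=> [h1 h2 h3]; split; apply/andP; split; lra. Qed.

Lemma triangle_open (R : realType) (rho : R * R) : triangle rho -> \forall r \near rho, triangle r.
Proof.
move=> [h1 h2 h3].
have n1 : \forall r \near rho, 0 < r.1 by exact: (cvgr_gt _ (@cvg_fst _ _ _ _ _) _ h1).
have n2 : \forall r \near rho, 0 < r.2 by exact: (cvgr_gt _ (@cvg_snd _ _ _ _ _) _ h2).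
have n3 : \forall r \near rho, r.1 + r.2 < 1.
  have c : r.1 + r.2 @[r --> rho] --> rho.1 + rho.2 by apply: cvgD; [exact: cvg_fst|exact: cvg_snd].
  exact: (cvgr_lt _ c _ h3).
by apply: filterS3 n1 n2 n3.
Qed.

Lemma sigma_derive (R : realType) (rho e : R * R) : triangle rho ->
  is_derive rho e (@sigma R) (dsigma e rho).
Proof.
move=> /triangle_coords[t1 t2 t3]; have [h1 h2] := coord_derive rho e.
have h3 := third_coord_derive rho e.
have := is_deriveZ pi^-1 (is_deriveD (is_deriveD (Lobachevsky_comp_derive h1 t1)
  (Lobachevsky_comp_derive h2 t2)) (Lobachevsky_comp_derive h3 t3)).
congr is_derive; rewrite /GRing.scale/= /dsigma.
have p0 : pi != 0 :> R by rewrite gt_eqF// pi_gt0.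
by move: (ln _) (ln _) (ln _) => a b c; move: pi p0 => p p0; field.
Qed.

Lemma dsigma_derive (R : realType) (rho e e' : R * R) : triangle rho ->
  is_derive rho e' (dsigma e) (pi * (cot (pi * rho.1) * (e.1 * e'.1) + cot (pi * rho.2) * (e.2 * e'.2)
    + cot (pi * (1 - rho.1 - rho.2)) * ((e.1 + e.2) * (e'.1 + e'.2)))).
Proof.
move=> /triangle_coords[t1 t2 t3]; have [h1 h2] := coord_derive rho e'.
have h3 := third_coord_derive rho e'.
have := is_deriveD (is_deriveD (is_deriveZ e.1 (ln_sin_derive h1 t1))
  (is_deriveZ e.2 (ln_sin_derive h2 t2))) (is_deriveZ (- e.1 - e.2) (ln_sin_derive h3 t3)).
rewrite /GRing.scale/=; set F := (F in is_derive _ _ F _) => H.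
have -> : dsigma e = F.
  apply/funext => r; rewrite /dsigma /F.
  change (ln (2 * sin (pi * r.1)) * e.1 + ln (2 * sin (pi * r.2)) * e.2 +
    ln (2 * sin (pi * (1 - r.1 - r.2))) * (- e.1 - e.2) =
    e.1 * ln (2 * sin (pi * r.1)) + e.2 * ln (2 * sin (pi * r.2)) +
    (- e.1 - e.2) * ln (2 * sin (pi * (1 - r.1 - r.2)))).
  by ring.
by move: H; congr is_derive; ring.
Qed.

Lemma sigma2E (R : realType) (i j : 'I_2) (rho : R * R) : triangle rho ->
  sigma2 i j rho = pi * (cot (pi * rho.1) * ((e2 R j).1 * (e2 R i).1) +
    cot (pi * rho.2) * ((e2 R j).2 * (e2 R i).2)
    + cot (pi * (1 - rho.1 - rho.2)) * (((e2 R j).1 + (e2 R j).2) * ((e2 R i).1 + (e2 R i).2))).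
Proof.
move=> T; rewrite /sigma2.
have [_ <-] := dsigma_derive (e2 R j) (e2 R i) T.
apply: near_eq_derive; apply: filterS (triangle_open T) => r Tr.
by have [_ ->] := sigma_derive (e2 R j) Tr.
Qed.

(** For the sines and cosines of two angles a and b, with S = sin (a + b) and
    C = cos (a + b). The auxiliary D is cos (a - b), and h1, h2, h3 are
    product-to-sum formulas. *)
Lemma w_cross_algebra (R : realType) (sa ca sb cb S C : R) :
  ca ^+ 2 + sa ^+ 2 = 1 -> cb ^+ 2 + sb ^+ 2 = 1 -> S != 0 ->
  S = sa * cb + ca * sb -> C = ca * cb - sa * sb ->
  sb ^+ 2 / (2 * S ^+ 2) - C / S * sb * cb - 1 / 4 + (cb ^+ 2 - sb ^+ 2) / 2 +
  (sa ^+ 2 / (2 * S ^+ 2) - C / S * sa * ca - 1 / 4 + (ca ^+ 2 - sa ^+ 2) / 2) =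
  - (sa * sb * C) / S ^+ 2.
Proof.
move=> a2 b2 S0 ES EC; pose D := ca * cb + sa * sb.
have ca2 : ca ^+ 2 = 1 - sa ^+ 2 by rewrite -a2; ring.
have cb2 : cb ^+ 2 = 1 - sb ^+ 2 by rewrite -b2; ring.
have h1 : sb * cb + sa * ca = S * D by rewrite ES /D; ring: ca2 cb2.
have h2 : C * D = 1 - sa ^+ 2 - sb ^+ 2 by rewrite EC /D; ring: ca2 cb2.
have h3 : sa ^+ 2 + sb ^+ 2 = S ^+ 2 - 2 * (sa * sb * C) by rewrite ES EC; ring: ca2 cb2.
transitivity ((sa ^+ 2 + sb ^+ 2) / (2 * S ^+ 2) - C / S * (sb * cb + sa * ca) - 1 / 2 +
  (ca ^+ 2 + cb ^+ 2 - sa ^+ 2 - sb ^+ 2) / 2); first by field.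
rewrite h1 h3 ca2 cb2; transitivity (- (sa * sb * C) / S ^+ 2 + ((1 - sa ^+ 2 - sb ^+ 2) - C * D)).
  by field.
by rewrite h2 subrr addr0.
Qed.

Lemma w_cross (R : realType) (r1 r2 : R) : sin (pi * (r1 + r2)) != 0 ->
  w2 r1 r2 + w2 r2 r1 =
  - (sin (pi * r1) * sin (pi * r2) * cos (pi * (r1 + r2))) / sin (pi * (r1 + r2)) ^+ 2.
Proof.
move=> s0; rewrite /w2 /w1 /cot [r2 + r1]addrC.
have c2 (r : R) : cos (2 * pi * r) = cos (pi * r) ^+ 2 - sin (pi * r) ^+ 2.
  by rewrite (_ : 2 * pi * r = pi * r + pi * r) ?cosD; ring.
rewrite !c2; apply: w_cross_algebra => //; try exact: cos2Dsin2.
  by rewrite mulrDr sinD.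
by rewrite mulrDr cosD.
Qed.

Lemma sin_triangle (R : realType) (rho : R * R) : triangle rho ->
  [/\ 0 < sin (pi * rho.1), 0 < sin (pi * rho.2) & 0 < sin (pi * (rho.1 + rho.2))].
Proof.
move=> [h1 h2 h3]; have p0 := pi_gt0 R.
have h (r : R) : 0 < r -> r < 1 -> 0 < sin (pi * r).
  by move=> r0 r1; rewrite sin_gt0_pi// mulr_gt0//= -[ltRHS]mulr1 ltr_pM2l.
by split; apply: h; lra.
Qed.

(** The matrix mu * sigma_ij is the symmetric part of the Jacobian matrix of W; this
    puts the equation in divergence form. *)
Lemma pde_operator (R : realType) (rho : R * R) (H : 'I_2 -> 'I_2 -> R) : triangle rho ->
  mu rho * \sum_(i < 2) \sum_(j < 2) sigma2 i j rho * H i j =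
  w1 rho.1 rho.2 * H 0 0 + (w2 rho.1 rho.2 + w2 rho.2 rho.1) / 2 * (H 0 1 + H 1 0)
  + w1 rho.2 rho.1 * H 1 1.
Proof.
move=> T; have [s1 s2 s3] := sin_triangle T.
rewrite !big_ord_recl !big_ord0 !addr0 !sigma2E// /e2/=.
have -> : lift ord0 ord0 = 1 :> 'I_2 by apply/val_inj.
rewrite !(mulr0, mulr1, mul0r, mul1r, addr0, add0r) w_cross ?gt_eqF//.
rewrite /w1 [rho.2 + rho.1]addrC /mu.
have E : pi * (1 - rho.1 - rho.2) = pi - pi * (rho.1 + rho.2) by ring.
rewrite E /cot sinB sinpi cospi cosB sinpi cospi !mul0r !addr0 sub0r mulN1r opprK mulN1r.
have {}p0 : pi != 0 :> R by rewrite gt_eqF// pi_gt0.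
have [a2 b2] := (cos2Dsin2 (pi * rho.1), cos2Dsin2 (pi * rho.2)).
have [ES EC] := (sinD (pi * rho.1) (pi * rho.2), cosD (pi * rho.1) (pi * rho.2)).
rewrite -mulrDr in ES EC; move: ES EC a2 b2 s1 s2 s3.
move: (sin (pi * (rho.1 + rho.2))) (cos (pi * (rho.1 + rho.2))) => S C.
move: (sin (pi * rho.1)) (sin (pi * rho.2)) (cos (pi * rho.1)) (cos (pi * rho.2)) => sa sb ca cb.
move: pi p0 (H 0 0) (H 0 1) (H 1 0) (H 1 1) => p p0 H00 H01 H10 H11 ES EC a2 b2 s1 s2 s3.
have [n1 n2 n3] : [/\ sa != 0, sb != 0 & S != 0] by split; exact: lt0r_neq0.
have ca2 : ca ^+ 2 = 1 - sa ^+ 2 by rewrite -a2; ring.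
have cb2 : cb ^+ 2 = 1 - sb ^+ 2 by rewrite -b2; ring.
have -> : ca / sa + - C / S = sb / (sa * S).
  have -> : sb = ca * S - C * sa by rewrite ES EC; ring: ca2 cb2.
  by field; rewrite n1 n3.
have -> : cb / sb + - C / S = sa / (sb * S).
  have -> : sa = cb * S - C * sb by rewrite ES EC; ring: ca2 cb2.
  by field; rewrite n2 n3.
by field; rewrite p0 n1 n2 n3.
Qed.

(** Let a and b be the sines of pi * rho.1 and pi * rho.2, and S and C the sine and
    cosine of the sum of these angles. Then 2 S^2 times the matrix of the
    coefficients is v v^T + w w^T for v = (b, - C a) and w = (0, S a). *)
Lemma elliptic (R : realType) (rho : R * R) (H00 H01 H10 H11 : R) : triangle rho ->
  (forall x y, 0 <= x ^+ 2 * H00 + x * y * (H01 + H10) + y ^+ 2 * H11) ->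
  0 <= w1 rho.1 rho.2 * H00 + (w2 rho.1 rho.2 + w2 rho.2 rho.1) / 2 * (H01 + H10)
    + w1 rho.2 rho.1 * H11.
Proof.
move=> T q; have [s1 s2 s3] := sin_triangle T.
rewrite w_cross ?gt_eqF// /w1 [rho.2 + _]addrC.
have cs := cos2Dsin2 (pi * (rho.1 + rho.2)).
move: s3 cs; move: (sin (pi * (rho.1 + rho.2))) (cos (pi * (rho.1 + rho.2))) => S C S0 cs.
move: (sin (pi * rho.1)) (sin (pi * rho.2)) => a b.
have := addr_ge0 (q b (- C * a)) (q 0 (S * a)) => h.
set X := (X in 0 <= X); set Y := (Y in 0 <= Y) in h.
have -> : X = (2 * S ^+ 2)^-1 * Y.
  have C2 : C ^+ 2 = 1 - S ^+ 2 by rewrite -cs; ring.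
  have -> : Y = b ^+ 2 * H00 - a * b * C * (H01 + H10) + a ^+ 2 * H11 by rewrite /Y; ring: C2.
  by rewrite /X; field; rewrite gt_eqF.
by rewrite mulr_ge0// invr_ge0 mulr_ge0// sqr_ge0.
Qed.

(** The derivative of l |-> W (r - l n) . n is minus the quadratic form of the
    Jacobian matrix of W at n, hence nonpositive by [elliptic]; the segment stays in
    the triangle by convexity. *)
Lemma W_monotone (R : realType) (r n : R * R) (l : R) : 0 <= l ->
  triangle r -> triangle (r - l *: n) ->
  dot (W (r - l *: n) - W r) n <= 0.
Proof.
move=> l0 T1 T2.
pose c (z : R) : R * R := (r.1 - z * n.1, r.2 - z * n.2).
have Tc z : `[0, l]%classic z -> triangle (c z).
  rewrite /= in_itv/= => /andP[z0 z1].
  case: T1 => a1 a2 a3; case: T2 => /= b1 b2 b3.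
  have {}b1 : 0 < r.1 - l * n.1 by exact: b1.
  have {}b2 : 0 < r.2 - l * n.2 by exact: b2.
  have {}b3 : r.1 - l * n.1 + (r.2 - l * n.2) < 1 by exact: b3.
  have conv (A B : R) : 0 < A -> 0 < A - l * B -> 0 < A - z * B.
    by move=> A0 AB; have [B0|B0] := leP 0 B; [apply: lt_le_trans AB _|apply: lt_le_trans A0 _]; nra.
  split => /=; [exact: conv|exact: conv|].
  by have := conv (1 - r.1 - r.2) (- n.1 - n.2); lra.
pose g z := dot (W (c z) - W r) n.
pose dg z := - (w1 (c z).1 (c z).2 * n.1 ^+ 2 + (w2 (c z).1 (c z).2 + w2 (c z).2 (c z).1) * (n.1 * n.2)
  + w1 (c z).2 (c z).1 * n.2 ^+ 2).
have dgE z : `[0, l]%classic z -> is_derive z 1 g (dg z).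
  move=> /Tc Tz; have [_ _ s3] := sin_triangle Tz.
  have h (k : R) (m : R) : is_derive z 1 (fun z : R => k - z * m) (- m).
    by apply: is_derive_eq; rewrite /GRing.scale/=; ring.
  have d1 := W1_derive (h r.1 n.1) (h r.2 n.2) (lt0r_neq0 s3).
  rewrite [X in sin (pi * X)]addrC in s3.
  have d2 := W1_derive (h r.2 n.2) (h r.1 n.1) (lt0r_neq0 s3).
  have c1 := is_derive_cst (W r).1 z (1 : R).
  have c2 := is_derive_cst (W r).2 z (1 : R).
  have := is_deriveD (is_deriveZ n.1 (is_deriveB d1 c1)) (is_deriveZ n.2 (is_deriveB d2 c2)).
  rewrite /GRing.scale/=; set F := (F in is_derive _ _ F _) => H.
  have -> : g = F.
    apply/funext => y; rewrite /g /dot.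
    change (((W (c y)).1 - (W r).1) * n.1 + ((W (c y)).2 - (W r).2) * n.2 =
      n.1 * (W1 (c y).1 (c y).2 - (W r).1) + n.2 * (W1 (c y).2 (c y).1 - (W r).2)).
    by rewrite ![n.1 * _]mulrC ![n.2 * _]mulrC.
  by move: H; congr is_derive; rewrite /dg /c/=; ring.
have I0 : `[0, l]%classic 0 by rewrite /= in_itv/= lexx.
have I1 : `[0, l]%classic l by rewrite /= in_itv/= lexx andbT.
have [z [zI _]] := mvt_itv (@interval_is_interval _ `[0, l]) dgE I0 I1.
have -> : g 0 = 0.
  rewrite /g (_ : c 0 = r) ?subrr ?/dot/= ?mul0r ?addr0//.
  by rewrite /c !mul0r !subr0; case: (r).
rewrite !subr0 /g (_ : c l = r - l *: n); last by [].
move=> ->; rewrite mulNr oppr_le0 mulr_ge0//.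
have alg (A B C x y : R) : A * x ^+ 2 + B * (x * y) + C * y ^+ 2 =
    A * x ^+ 2 + B / 2 * (x * y + x * y) + C * y ^+ 2 by field.
rewrite alg; apply: elliptic (Tc z zI) _ => x y.
have -> : x ^+ 2 * n.1 ^+ 2 + x * y * (n.1 * n.2 + n.1 * n.2) + y ^+ 2 * n.2 ^+ 2 =
  (x * n.1 + y * n.2) ^+ 2 by ring.
exact: sqr_ge0.
Qed.

(** * Regularity up to the boundary and up to time zero *)

(** [grad] is a limit along the interior of U, where the derivatives are p and q;
    these are continuous on U, the closure of the interior. *)
Lemma c1fun_grad (R : realType) (U : set (R * R)) (f p q : R * R -> R) u :
  closure U° = U -> c1fun U f p q -> U u -> grad U f u = (p u, q u).
Proof.
move=> cl hf Uu.
have PF : ProperFilter (within U° (nbhs u)) by apply: within_nbhs_proper; rewrite /infer cl.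
have ext e (g : R * R -> R) : {within U, continuous g} -> (forall v, U° v -> is_derive v e f (g v)) ->
    lim ('D_e f v @[v --> within U° (nbhs u)]) = g u.
  move=> /subspace_continuousP/(_ u Uu) cg dg; apply: cvg_lim => //.
  apply: cvg_trans (_ : g v @[v --> within U° (nbhs u)] --> _).
    apply: near_eq_cvg; rewrite near_withinE; apply: nearW => v Iv.
    by have [_ ->] := dg v Iv.
  apply: cvg_trans cg; apply: cvg_app; apply: within_subset.
  exact: interior_subset.
by rewrite /grad (ext _ _ (c1_c1 hf) (c1_d1 hf)) (ext _ _ (c1_c2 hf) (c1_d2 hf)).
Qed.

Lemma smooth_c1fun (R : realType) (U : set (R * R)) (f : R * R -> R) : smooth_on U f ->
  exists p q, c1fun U f p q.
Proof.
move=> /(_ 1%N)[cf H].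
have [p [cp _] dp] := H (e2 R 0) (mem_head _ _).
have [|q [cq _] dq] := H (e2 R 1); first by rewrite !inE eqxx orbT.
by exists p, q.
Qed.

Definition future {R : realType} : set R := [set t | 0 <= t].

(** g1, g2 and g3 extend the two space derivatives and the time derivative of Psi
    continuously to the boundary and to time 0. *)
Record evolution (R : realType) (U : set (R * R)) (Psi : R * R -> R -> R)
    (g1 g2 g3 : (R * R) * R -> R) : Prop := {
  ev_c : {within U `*` future, continuous (fun p : (R * R) * R => Psi p.1 p.2)};
  ev_c1 : {within U `*` future, continuous g1};
  ev_c2 : {within U `*` future, continuous g2};
  ev_c3 : {within U `*` future, continuous g3};
  ev_d1 : forall (u : R * R) (t : R), U° u -> 0 < t -> is_derive u (ev true) (Psi ^~ t) (g1 (u, t));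
  ev_d2 : forall (u : R * R) (t : R), U° u -> 0 < t -> is_derive u (ev false) (Psi ^~ t) (g2 (u, t));
  ev_d3 : forall (u : R * R) (t : R), U° u -> 0 < t -> is_derive t 1 (Psi u) (g3 (u, t)) }.

Lemma interior_setX (R : realType) (U : set (R * R)) (u : R * R) (t : R) : U° u -> 0 < t ->
  (U `*` future)° (u, t).
Proof.
move=> Uu t0; exists (U, future) => //=; split=> //.
by apply: filterS (lt_nbhsr t0) => x /ltW.
Qed.

Lemma solution_evolution (R : realType) (U : set (R * R)) psi0 (Psi : R * R -> R -> R) :
  classical_solution U psi0 Psi -> exists g1 g2 g3, evolution U Psi g1 g2 g3.
Proof.
move=> /sol_C1[cP H].
have [g1 [c1 _] d1] := H (e2 R 0, 0) (mem_head _ _).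
have [|g2 [c2 _] d2] := H (e2 R 1, 0); first by rewrite !inE eqxx orbT.
have [|g3 [c3 _] d3] := H ((0, 0), 1); first by rewrite !inE eqxx !orbT.
have space e u (t d : R) : is_derive (u, t) (e, 0) (fun p : (R * R) * R => Psi p.1 p.2) d ->
    is_derive u e (Psi ^~ t) d.
  move=> /is_derive_cvgP/= h; apply/is_derive_cvgP; move: h.
  suff -> : (fun h : R => h^-1 *: (Psi (h *: e + u) (h *: (0 : R) + t) - Psi u t)) =
    (fun h : R => h^-1 *: (Psi (h *: e + u) t - Psi u t)) by [].
  by apply/funext => h; rewrite scaler0 add0r.
exists g1, g2, g3; split => // u t Iu t0.
- by apply: space; apply: d1; exact: interior_setX.
- by apply: space; apply: d2; exact: interior_setX.
- have /is_derive_cvgP/= h := d3 _ (interior_setX Iu t0); apply/is_derive_cvgP; move: h.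
  suff -> : (fun h : R => h^-1 *: (Psi (h *: ((0, 0) : R * R) + u) (h *: (1 : R) + t) - Psi u t)) =
    (fun h : R => h^-1 *: (Psi u (h *: (1 : R) + t) - Psi u t)) by [].
  apply/funext => h; rewrite (_ : h *: ((0, 0) : R * R) = 0) ?add0r//.
  exact: (@scaler0 R (R * R)%type h).
Qed.

Section evolution.
Variables (R : realType) (U : set (R * R)) (Psi : R * R -> R -> R) (g1 g2 g3 : (R * R) * R -> R).
Hypothesis hP : evolution U Psi g1 g2 g3.

Lemma space_slice (f : (R * R) * R -> R) t : {within U `*` future, continuous f} -> 0 <= t ->
  {within U, continuous (fun u => f (u, t))}.
Proof.
move=> /subspace_continuousP cf t0; apply/subspace_continuousP => u Uu.
apply: cvg_trans (cf (u, t) (conj Uu t0)).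
move=> B [[P Q] /= [PU QT] PQ]; rewrite /within/= in PQ *.
apply: filterS PU => v Pv Uv; apply: (PQ (v, t)); split => //=.
exact: nbhs_singleton QT.
Qed.

Lemma time_slice (f : (R * R) * R -> R) u : {within U `*` future, continuous f} -> U u ->
  {within future, continuous (fun t => f (u, t))}.
Proof.
move=> /subspace_continuousP cf Uu; apply/subspace_continuousP => t t0.
apply: cvg_trans (cf (u, t) (conj Uu t0)).
move=> B [[P Q] /= [PU QT] PQ]; rewrite /within/= in PQ *.
apply: filterS QT => s Qs s0; apply: (PQ (u, s)); split => //=.
exact: nbhs_singleton PU.
Qed.

(** For t > 0 the mean value theorem bounds the increments of Psi ^~ t over segments
    starting at u; the bound passes to the limit t = 0. *)
Lemma initial_derive i (g : (R * R) * R -> R) :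
  {within U `*` future, continuous g} ->
  (forall (u : R * R) (t : R), U° u -> 0 < t -> is_derive u (ev i) (Psi ^~ t) (g (u, t))) ->
  forall u, U° u -> is_derive u (ev i) (Psi ^~ 0) (g (u, 0)).
Proof.
move=> cg dg u Iu.
apply/is_derive_cvgP/cvgrPdist_le => e e0.
have gu : \forall p \near within (U `*` future) (nbhs (u, 0 : R)), `|g (u, 0) - g p| <= e.
  have /subspace_continuousP/(_ (u, 0)) c := cg.
  have {}c := c (conj (interior_subset Iu) (lexx 0)).
  by move/cvgrPdist_le : c => /(_ e e0).
have [[P Q] /= [PU QT] PQ] := gu; rewrite /= in PQ.
have line : \forall h \near 0, P (u + h *: ev i) /\ U° (u + h *: ev i).
  have c : u + h *: ev i @[h --> (0 : R)] --> u.
    rewrite -[X in _ --> X]addr0 -(scale0r (ev i)).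
    by apply: cvgD; [exact: cvg_cst|apply: cvgZ; [exact: cvg_id|exact: cvg_cst]].
  apply: (c (fun v => P v /\ U° v)); apply: filterI => //.
  by apply: open_nbhs_nbhs; split => //; exact: open_interior.
have [d d0 dline] := (nbhs_ballP _ _).1 line.
have [d' d'0 dQ] := (nbhs_ballP _ _).1 QT.
rewrite near_withinE; apply/nbhs_ballP; exists d => //= h hd h0.
have bnd t : 0 < t -> t < d' -> `|Psi (u + h *: ev i) t - Psi u t - h * g (u, 0)| <= e * `|h|.
  move=> t0 td.
  have Qt : Q t by apply: dQ; rewrite /ball/= sub0r normrN gtr0_norm.
  have dl (z : R) : `|z - 0| <= `|h - 0| -> is_derive z 1 (fun z => Psi (u + z *: ev i) t) (g (u + z *: ev i, t)).
    rewrite [z - 0]subr0 [h - 0]subr0 => zh.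
    apply: ((is_derive_lineP (Psi ^~ t) u (ev i) (g (u + z *: ev i, t)) z).1 _); apply: dg => //.
    have [] // := dline z _; move: hd; rewrite /ball/= !sub0r !normrN.
    exact: le_lt_trans.
  have [z] := mvt_sym dl; rewrite [z - 0]subr0 [h - 0]subr0 => zh; rewrite scale0r addr0 => ->.
  rewrite [h * _]mulrC -mulrBl normrM ler_wpM2r// distrC.
  have [|Pz Iz] := dline z.
    by move: hd; rewrite /ball/= !sub0r !normrN; exact: le_lt_trans.
  apply: (PQ (u + z *: ev i, t)) => //; split => /=; first exact: interior_subset.
  exact: ltW.
have bnd0 : `|Psi (u + h *: ev i) 0 - Psi u 0 - h * g (u, 0)| <= e * `|h|.
  have tl v : U v -> Psi v t @[t --> 0^'+] --> Psi v 0.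
    move=> Uv; have /subspace_continuousP/(_ 0 (lexx 0)) c := time_slice (ev_c hP) Uv.
    apply: cvg_trans c; apply: cvg_app; apply: within_subset.
    by move=> x /= /ltW.
  have [|_ Ih] := dline h; first exact: hd.
  have cv : `|Psi (u + h *: ev i) t - Psi u t - h * g (u, 0)| @[t --> 0^'+] -->
      `|Psi (u + h *: ev i) 0 - Psi u 0 - h * g (u, 0)|.
    apply: cvg_norm; apply: cvgB; last exact: cvg_cst.
    by apply: cvgB; apply: tl; exact: interior_subset.
  apply: (ler_cvg_to cv (cvg_cst (e * `|h|))); near=> t; apply: bnd.
    by near: t; exact: nbhs_right_gt.
  by near: t; exact: nbhs_right_lt.
rewrite /= distrC [h *: ev i + u]addrC.
have -> : h^-1 *: (Psi (u + h *: ev i) 0 - Psi u 0) - g (u, 0) =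
    h^-1 * (Psi (u + h *: ev i) 0 - Psi u 0 - h * g (u, 0)).
  by rewrite [in RHS]mulrBr mulKf.
by rewrite normrM normfV ler_pdivrMl ?normr_gt0// [_ * e]mulrC.
Unshelve. all: by end_near. Qed.

Lemma slice_c1fun t : 0 <= t ->
  c1fun U (Psi ^~ t) (fun u => g1 (u, t)) (fun u => g2 (u, t)).
Proof.
move=> t0; split.
- exact: (space_slice (ev_c hP) t0).
- exact: (space_slice (ev_c1 hP) t0).
- exact: (space_slice (ev_c2 hP) t0).
- move: t0; rewrite le_eqVlt => /orP[/eqP<-|t0] v Iv.
    exact: (initial_derive (ev_c1 hP) (ev_d1 hP)).
  exact: (ev_d1 hP).
- move: t0; rewrite le_eqVlt => /orP[/eqP<-|t0] v Iv.
    exact: (initial_derive (ev_c2 hP) (ev_d2 hP)).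
  exact: (ev_d2 hP).
Qed.
End evolution.

(** * The gradient of the difference at the boundary *)

Section boundary_gradient.
Variables (R : realType) (U : set (R * R)) (gamma : R -> R * R) (L : R).
Variables (n : R * R -> R * R) (s0 : R) (i : bool) (sg k a r rho : R).
Hypothesis hU : smooth_sc_domain U gamma L.
Hypothesis bc : boundary_chart U gamma L n s0 i sg k a r rho.
Variables (f P Q : R * R -> R).
Hypotheses (cf : {within U, continuous f}) (cP : {within U, continuous P})
  (cQ : {within U, continuous Q}).
Hypothesis dP : forall v, U° v -> is_derive v (ev i) f (P v).
Hypothesis dQ : forall v, U° v -> is_derive v (ev (~~ i)) f (Q v).
Hypothesis f_bdry : forall s, f (gamma s) = 0.
Let ga s := pa i (gamma s).
Let gb s := pb i (gamma s).
Let da s := pa i (gamma^`()%classic s).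
Let db s := pb i (gamma^`()%classic s).
Let phi (w : R * R) := pt i (ga w.1) (gb w.1 - k * w.2).
Let K : set (R * R) := `[s0 - a, s0 + a] `*` `[0, r / 2].
Let a0 : 0 < a. Proof. exact: bc_a bc. Qed.
Let c0 : 0 < r / 2. Proof. by rewrite divr_gt0// (chart_r0 bc). Qed.

Let KI w : K w -> `|w.1 - s0| <= a /\ 0 <= w.2 <= r / 2.
Proof. by rewrite ler_distl => -[/=]; rewrite !in_itv/=. Qed.

Let within_chart (h : R * R -> R) : {within U, continuous h} -> {within K, continuous (h \o phi)}.
Proof.
move=> ch; apply: within_compose => // w Kw; first exact: (@chart_cont_phi _ _ _ _ i k hU w).
by have [h1 h2] := KI Kw; rewrite [w]surjective_pairing; exact: (chart_phi_in bc).
Qed.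

Let phi0 s : phi (s, 0) = gamma s.
Proof. by rewrite /phi/= mulr0 subr0 ptK. Qed.

Let near_base (h : R * R -> R) (e : R) : {within K, continuous h} -> 0 < e ->
  exists2 d, 0 < d & forall s z, `|s - s0| < d -> 0 <= z < d ->
    [/\ `|s - s0| <= a, z <= r / 2 & `|h (s, z) - h (s0, 0)| < e].
Proof.
move=> /subspace_continuousP ch e0.
have K0 : K (s0, 0).
  by split; rewrite /= in_itv/= -?ler_distl ?subrr ?normr0 ?lexx/= ltW.
have /cvgrPdist_lt/(_ e e0) := ch _ K0.
rewrite near_withinE => /nbhs_box[d d0 H].
exists (Num.min d (Num.min a (r / 2))) => [|s z].
  by rewrite !lt_min d0 c0; have := a0 => ->.
rewrite !lt_min => /and3P[s1 s2 s3] /andP[z0 /and3P[z1 z2 z3]].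
split; [exact: ltW|exact: ltW|].
rewrite distrC; apply: H => //=; first by rewrite subr0 ger0_norm.
by split; rewrite /= in_itv/= -?ler_distl ?z0 ltW.
Qed.

Let phi_vertical (s z : R) : phi (s, y) @[y --> z] --> phi (s, z).
Proof.
have c : (s, y) @[y --> z] --> (s, z).
  by apply: (@cvg_pt R true _ (nbhs z)); [exact: cvg_cst|exact: cvg_id].
exact: (cvg_comp _ _ c (@chart_cont_phi _ _ _ _ i k hU (s, z))).
Qed.

(** f vanishes at gamma s0 and is nonnegative at the points phi (s0, z) at depth z
    below it; the left side is the derivative of f in z. *)
Lemma normal_derivative_ge0 : (forall u, U u -> 0 <= f u) -> 0 <= - k * Q (gamma s0).
Proof.
move=> f0; rewrite leNgt; apply/negP => neg.
have cG : {within K, continuous (fun w => - k * Q (phi w))}.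
  by apply: withinM; [exact: within_cst|exact: (within_chart cQ)].
have [|d d0 H] := near_base cG (e := - (- k * Q (gamma s0))); first by rewrite oppr_gt0.
have d2 : 0 < d / 2 by rewrite divr_gt0.
have dd : d / 2 < d by rewrite ltr_pdivrMr// ltr_pMr// ltr1n.
have ss : `|s0 - s0| < d by rewrite subrr normr0.
have Hz z : 0 <= z -> z <= d / 2 -> z <= r / 2 /\ - k * Q (phi (s0, z)) < 0.
  move=> z0 zd; have [|_ zr] := H s0 z ss; first by rewrite z0 (le_lt_trans zd).
  by rewrite phi0 ltr_norml => /andP[_]; rewrite ltrBlDr addNr.
have sa : `|s0 - s0| <= a by rewrite subrr normr0 ltW.
have dh (z : R) : z \in `]0, d / 2[ -> is_derive z 1 (fun z => f (phi (s0, z))) (- k * Q (phi (s0, z))).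
  rewrite in_itv/= => /andP[z0 z1]; have [zr _] := Hz z (ltW z0) (ltW z1).
  have Iz : U° (phi (s0, z)) by apply: (chart_phi_int bc) => //; rewrite z0.
  have h := (is_derive_ptP' i f (gb s0 - k * z) (ga s0) _).1 (dQ Iz).
  have := is_derive_compR (f := fun z : R => gb s0 - k * z) h (is_derive_affine _ _ _).
  by rewrite mulrC.
have ch : {within `[0, d / 2], continuous (fun z => f (phi (s0, z)))}.
  apply: (within_compose cf) => z.
    by move=> _; exact: phi_vertical.
  rewrite /= in_itv/= => /andP[z0 z1]; have [zr _] := Hz z z0 z1.
  by apply: (chart_phi_in bc) => //; rewrite z0.
have [z] := MVT d2 dh ch.
rewrite in_itv/= => /andP[z0 z1]; rewrite phi0 f_bdry !subr0.
have [zr neg'] := Hz z (ltW z0) (ltW z1).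
have [dr _] := Hz (d / 2) (ltW d2) (lexx _).
have : 0 <= f (phi (s0, d / 2)) by apply: f0; apply: (chart_phi_in bc) => //; rewrite ltW.
by rewrite leNgt => /negP h E; apply: h; rewrite E nmulr_rlt0.
Qed.

(** f is differentiable only inside U, hence the derivative is not taken along the
    boundary. If it were c <> 0, the increment of f from phi (s0, z) to
    phi (s0 + h, z) would be at least |c| h / 2 for a fixed h and all small z > 0,
    but it tends to 0 with z. *)
Lemma tangential_derivative0 : P (gamma s0) * da s0 + Q (gamma s0) * db s0 = 0.
Proof.
apply: contrapT => /eqP neg.
set c := P (gamma s0) * da s0 + Q (gamma s0) * db s0 in neg.
pose G w := P (phi w) * da w.1 + Q (phi w) * db w.1.
have wfst (h : R -> R) : continuous h -> {within K, continuous (fun w => h w.1)}.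
  by move=> ch; apply: continuous_subspaceT => w; apply: continuous_fst; exact: ch.
have cG : {within K, continuous G}.
  apply: within_continuousD; apply: withinM.
  - exact: (within_chart cP).
  - by apply: wfst; exact: (@chart_cont_da _ _ _ _ i hU).
  - exact: (within_chart cQ).
  - by apply: wfst; exact: (@chart_cont_db _ _ _ _ i hU).
have G0 : G (s0, 0) = c by rewrite /G phi0.
have [|d d0 H] := near_base cG (e := `|c| / 2); first by rewrite divr_gt0// normr_gt0.
rewrite G0 in H; pose h := d / 2.
have h0 : 0 < h by rewrite divr_gt0.
have hd : h < d by rewrite ltr_pdivrMr// ltr_pMr// ltr1n.
have incr z : 0 < z -> z < d -> `|c| / 2 * h <= `|f (phi (s0 + h, z)) - f (phi (s0, z))|.
  move=> z0 zd.
  have zI : 0 <= z < d by rewrite ltW.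
  have win s : `|s - s0| <= `|s0 + h - s0| -> `|s - s0| < d.
    by move=> hs; apply: le_lt_trans hs _; rewrite [s0 + h]addrC addrK gtr0_norm.
  have dh (s : R) : `|s - s0| <= `|s0 + h - s0| ->
      is_derive s 1 (fun s => f (phi (s, z))) (G (s, z)).
    move=> /win sd; have [sa zr _] := H s z sd zI.
    have Iz : U° (phi (s, z)) by apply: (chart_phi_int bc) => //; rewrite z0.
    have NI : nbhs (phi (s, z)) U° by apply: open_nbhs_nbhs; split => //; exact: open_interior.
    have dgb : is_derive s 1 (fun s => gb s - k * z) (db s).
      have := is_deriveB (@chart_derive_b _ _ _ _ i hU s) (is_derive_cst (k * z) s (1 : R)).
      by rewrite subr0.
    apply: (chain_pt (i := i) (c1 := ga) (c2 := fun s => gb s - k * z) NI dP dQ) => //.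
    - exact: (interior_continuous cP Iz).
    - exact: (interior_continuous cQ Iz).
    - exact: (@chart_derive_a _ _ _ _ i hU s).
  have [s /win sd ->] := mvt_sym dh; have [_ _ Gs] := H s z sd zI.
  rewrite [s0 + h]addrC addrK normrM (gtr0_norm h0) ler_wpM2r ?(ltW h0)//.
  have h1 : `|c| <= `|G (s, z)| + `|G (s, z) - c|.
    by rewrite -{1}[c](subKr (G (s, z))); apply: ler_normB.
  have h2 : `|c| <= `|G (s, z)| + `|c| / 2 by apply: le_trans h1 _; rewrite lerD2l ltW.
  by rewrite {1}[`|c|]splitr lerD2r in h2.
have lim s : `|s - s0| <= a -> f (phi (s, z)) @[z --> 0^'+] --> (0 : R).
  move=> sa.
  have cz : {within `[0, r / 2], continuous (fun z => f (phi (s, z)))}.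
    apply: (within_compose cf) => z.
      by move=> _; exact: phi_vertical.
    by rewrite /= in_itv/= => zI; exact: (chart_phi_in bc).
  have [_ cr _] := (continuous_within_itvP _ c0).1 cz.
  by rewrite phi0 f_bdry in cr.
have sh : `|s0 + h - s0| <= a.
  have [||//] := H (s0 + h) 0; first by rewrite [s0 + h]addrC addrK gtr0_norm.
  by rewrite lexx.
have ss : `|s0 - s0| <= a by rewrite subrr normr0 ltW.
have cv : `|f (phi (s0 + h, z)) - f (phi (s0, z))| @[z --> 0^'+] --> `|0 - 0 : R|.
  by apply: cvg_norm; apply: cvgB; exact: lim.
have : `|c| / 2 * h <= `|0 - 0 : R|.
  apply: (ler_cvg_to (cvg_cst (`|c| / 2 * h)) cv); near=> z; apply: incr.
    by near: z; exact: nbhs_right_gt.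
  by near: z; exact: nbhs_right_lt.
rewrite subr0 normr0 leNgt => /negP; apply.
by rewrite mulr_gt0// divr_gt0// normr_gt0.
Unshelve. all: by end_near. Qed.
End boundary_gradient.

(** By [tangential_derivative0] the gradient is a multiple of the normal, and
    [normal_derivative_ge0] gives the sign. *)
Lemma boundary_gradient (R : realType) (U : set (R * R)) (gamma : R -> R * R) (L : R)
    (n : R * R -> R * R) (f p q : R * R -> R) (s : R) :
  smooth_sc_domain U gamma L -> exterior_unit_normal U gamma n ->
  c1fun U f p q -> (forall u, U u -> 0 <= f u) -> (forall u, bdry U u -> f u = 0) ->
  exists2 l, 0 <= l & (p (gamma s), q (gamma s)) = - (l *: n (gamma s)).
Proof.
move=> hU hn hf f0 fb.
have [i [sg [k [a [r [rho bc]]]]]] := chart_exists s hU hn.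
pose P := if i then p else q; pose Q := if i then q else p.
have cP : {within U, continuous P} by rewrite /P; case: (i); [exact: (c1_c1 hf)|exact: (c1_c2 hf)].
have cQ : {within U, continuous Q} by rewrite /Q; case: (i); [exact: (c1_c2 hf)|exact: (c1_c1 hf)].
have dP v : U° v -> is_derive v (ev i) f (P v).
  by rewrite /P => Iv; case: (i); [exact: (c1_d1 hf Iv)|exact: (c1_d2 hf Iv)].
have dQ v : U° v -> is_derive v (ev (~~ i)) f (Q v).
  by rewrite /Q => Iv; case: (i); [exact: (c1_d2 hf Iv)|exact: (c1_d1 hf Iv)].
have fg t : f (gamma t) = 0 by apply: fb; exact: (bdry_curve hU).
have tan := tangential_derivative0 hU bc (c1_c hf) cP cQ dP dQ fg.
have nor := normal_derivative_ge0 hU bc (c1_c hf) cQ dQ fg f0.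
have -> : (p (gamma s), q (gamma s)) = pt i (P (gamma s)) (Q (gamma s)).
  by rewrite /P /Q; case: (i).
have ss : `|s - s| < a by rewrite subrr normr0 (bc_a bc).
rewrite (bc_normal bc ss).
have speed : pa i (gamma^`()%classic s) ^+ 2 + pb i (gamma^`()%classic s) ^+ 2 = 1.
  by rewrite !expr2 -dot_pt (ap_speed (dom_boundary hU)).
have pos : 0 < sg * pa i (gamma^`()%classic s).
  by have [m m0 H] := bc_steep bc; apply: lt_le_trans m0 (H s (ltW ss)).
move: tan nor speed pos.
move: (pa i (gamma^`()%classic s)) (pb i (gamma^`()%classic s)) (P _) (Q _) => x y A B tan nor speed pos.
(* the component of the gradient along the quarter turn (- y, x) of the velocity *)
pose m := - A * y + B * x.
have k2 : k ^+ 2 = 1 by case: (bc_k bc) => ->; rewrite ?sqrrN expr1n.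
have sg2 : sg ^+ 2 = 1 by case: (bc_sg bc) => ->; rewrite ?sqrrN expr1n.
have y2 : y ^+ 2 = 1 - x ^+ 2 by rewrite -speed; ring.
have EA : A = - m * y.
  transitivity (A * (x ^+ 2 + y ^+ 2) - x * (A * x + B * y)); last by rewrite /m; ring.
  by rewrite speed tan mulr0 subr0 mulr1.
have EB : B = m * x.
  transitivity (B * (x ^+ 2 + y ^+ 2) - y * (A * x + B * y)); last by rewrite /m; ring.
  by rewrite speed tan mulr0 subr0 mulr1.
exists (- (m * k * sg)).
  have h : 0 <= (- (m * k * sg)) * (sg * x).
    have -> : - (m * k * sg) * (sg * x) = - k * (m * x) * sg ^+ 2 by ring.
    by rewrite sg2 mulr1 -EB.
  by rewrite -(pmulr_lge0 _ pos).
have X : - (- (m * k * sg) *: pt i (- (k * sg * y)) (k * sg * x)) =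
    pt i (m * - y * (k ^+ 2 * sg ^+ 2)) (m * x * (k ^+ 2 * sg ^+ 2)).
  by case: (i); rewrite /pt; congr pair; rewrite /= /GRing.scale/=; ring.
by rewrite X k2 sg2 !mulr1 mulrN -mulNr -EA -EB.
Qed.

(** * The sign of the boundary flux *)

Lemma Rintegral_le0 (R : realType) (D : set R) (f : R -> R) : (forall x, D x -> f x <= 0) ->
  \int[lebesgue_measure]_(x in D) f x <= 0.
Proof.
move=> f0; apply: fine_le0.
have -> : (\int[lebesgue_measure]_(x in D) (f x)%:E)%E =
    (\int[lebesgue_measure]_(x in D) (- (- f x)%:E))%E.
  by apply: eq_integral => x _; rewrite EFinN oppeK.
rewrite integral_ge0N => [|x Dx]; last by rewrite lee_fin oppr_ge0 f0.
by rewrite oppe_le0; apply: integral_ge0 => x Dx; rewrite lee_fin oppr_ge0 f0.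
Qed.

Lemma c1funB (R : realType) (U : set (R * R)) (b b1 b2 c c1 c2 : R * R -> R) :
  c1fun U b b1 b2 -> c1fun U c c1 c2 ->
  c1fun U (fun v => b v - c v) (fun v => b1 v - c1 v) (fun v => b2 v - c2 v).
Proof.
move=> hb hc; split.
- by apply: within_continuousB; [exact: (c1_c hb)|exact: (c1_c hc)].
- by apply: within_continuousB; [exact: (c1_c1 hb)|exact: (c1_c1 hc)].
- by apply: within_continuousB; [exact: (c1_c2 hb)|exact: (c1_c2 hc)].
- by move=> v Iv; exact: (is_deriveB (c1_d1 hb Iv) (c1_d1 hc Iv)).
- by move=> v Iv; exact: (is_deriveB (c1_d2 hb Iv) (c1_d2 hc Iv)).
Qed.

Lemma flux_comparison (R : realType) (U : set (R * R)) (gamma : R -> R * R) (L : R)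
    (n : R * R -> R * R) (f1 f2 : R * R -> R) (G1 G2 : R * R -> R * R) :
  smooth_sc_domain U gamma L -> exterior_unit_normal U gamma n ->
  c1fun U f1 (fun u => (G1 u).1) (fun u => (G1 u).2) ->
  c1fun U f2 (fun u => (G2 u).1) (fun u => (G2 u).2) ->
  (forall u, U u -> triangle (G1 u)) -> (forall u, U u -> triangle (G2 u)) ->
  (forall u, U u -> f2 u <= f1 u) -> (forall u, bdry U u -> f1 u = f2 u) ->
  curve_integral gamma L (fun u => dot (W (G1 u) - W (G2 u)) (n u)) <= 0.
Proof.
move=> hU hn h1 h2 T1 T2 le eq; apply: Rintegral_le0 => s _.
have [|u bu|l l0] := boundary_gradient s hU hn (c1funB h1 h2).
- by move=> u Uu; rewrite subr_ge0 le.
- by rewrite eq// subrr.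
move=> E; have Us := curve_in_domain hU s.
have G1E : G1 (gamma s) = G2 (gamma s) - l *: n (gamma s).
  by rewrite -E; case: (G1 _) => a b; case: (G2 _) => c d; congr pair; rewrite /= addrC subrK.
have t1 := T1 _ Us; rewrite G1E in t1 *.
exact: (W_monotone l0 (T2 _ Us) t1).
Qed.

(** * The equation in divergence form *)

Section W_continuous.
Variables (R : realType) (T : Type) (F : set_system T) (FF : Filter F).
Variables (a b : T -> R) (x y : R).
Hypotheses (ca : a z @[z --> F] --> x) (cb : b z @[z --> F] --> y).
Hypothesis (xy : triangle (x, y)).

Let sxy : 0 < sin (pi * (x + y)). Proof. by have [] := sin_triangle xy. Qed.

Let cvg_sin (f : T -> R) (l c : R) : f z @[z --> F] --> l -> sin (c * f z) @[z --> F] --> sin (c * l).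
Proof.
move=> cf; have h : c * f z @[z --> F] --> c * l by apply: cvgM; [exact: cvg_cst|].
exact: cvg_comp h (@continuous_sin R _).
Qed.

Let cvg_cos (f : T -> R) (l c : R) : f z @[z --> F] --> l -> cos (c * f z) @[z --> F] --> cos (c * l).
Proof.
move=> cf; have h : c * f z @[z --> F] --> c * l by apply: cvgM; [exact: cvg_cst|].
exact: cvg_comp h (@continuous_cos R _).
Qed.

Let cab : a z + b z @[z --> F] --> x + y. Proof. exact: cvgD. Qed.

Let cvg_cot : cot (pi * (a z + b z)) @[z --> F] --> cot (pi * (x + y)).
Proof.
have h1 := cvg_cos (c := pi) cab; have h2 := cvg_sin (c := pi) cab.
by apply: cvgM => //; apply: cvgV => //; rewrite gt_eqF.
Qed.

Let cvg_sq (f : T -> R) (l : R) : f z @[z --> F] --> l -> f z ^+ 2 @[z --> F] --> l ^+ 2.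
Proof. by move=> h; rewrite expr2; apply: cvgM. Qed.

Lemma W1_cvg : W1 (a z) (b z) @[z --> F] --> W1 x y.
Proof.
have h1 := cvg_sq (cvg_sin (c := pi) cb); have h2 := cvg_sin (c := (2 * pi)) cb.
apply: cvgD; last by apply: cvgM => //; exact: cvg_cst.
apply: cvgB; last by apply: cvgM => //; exact: cvg_cst.
apply: cvgM => //; apply: cvgM => //; exact: cvg_cst.
Qed.

Lemma w1_cvg : w1 (a z) (b z) @[z --> F] --> w1 x y.
Proof.
have h1 := cvg_sq (cvg_sin (c := pi) cb); have h2 := cvg_sq (cvg_sin (c := pi) cab).
apply: cvgM => //; apply: cvgV; first by rewrite mulf_neq0// expf_neq0// gt_eqF.
by apply: cvgM => //; exact: cvg_cst.
Qed.

Lemma w2_cvg : w2 (a z) (b z) @[z --> F] --> w2 x y.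
Proof.
have h1 := cvg_sin (c := pi) cb; have h2 := cvg_cos (c := pi) cb; have h3 := cvg_cos (c := (2 * pi)) cb.
apply: cvgD; last by apply: cvgM => //; exact: cvg_cst.
apply: cvgB; last exact: cvg_cst.
apply: cvgB; first exact: w1_cvg.
by apply: cvgM => //; apply: cvgM.
Qed.
End W_continuous.

Lemma triangle_sym (R : realType) (x y : R) : triangle (x, y) -> triangle (y, x).
Proof. by move=> [/= h1 h2 h3]; split=> //=; rewrite addrC. Qed.

Section solution.
Variables (R : realType) (U : set (R * R)) (psi0 : R * R -> R) (Psi : R * R -> R -> R).
Variables (g1 g2 g3 : (R * R) * R -> R).
Hypothesis clU : closure U° = U.
Hypothesis hS : classical_solution U psi0 Psi.
Hypothesis hP : evolution U Psi g1 g2 g3.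

Definition hess (i j : 'I_2) (t : R) (u : R * R) : R := 'D_(e2 R i) ('D_(e2 R j) (Psi ^~ t)) u.

Lemma evolution_grad u (t : R) : U u -> 0 <= t -> grad U (Psi ^~ t) u = (g1 (u, t), g2 (u, t)).
Proof. by move=> Uu t0; rewrite (c1fun_grad clU (slice_c1fun hP t0) Uu). Qed.

Lemma evolution_triangle u (t : R) : U u -> 0 <= t -> triangle (g1 (u, t), g2 (u, t)).
Proof. by move=> Uu t0; rewrite -(evolution_grad Uu t0); exact: (sol_triangle hS). Qed.

Lemma hess_derive i j (g : (R * R) * R -> R) u (t : R) :
  (forall v, U° v -> is_derive v (e2 R j) (Psi ^~ t) (g (v, t))) ->
  U° u -> 0 < t -> is_derive u (e2 R i) (fun v => g (v, t)) (hess i j t u).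
Proof.
move=> dg Iu t0; have [/derivableP dd _] := sol_C2 hS i j Iu t0.
apply: near_eq_is_derive dd.
have : nbhs u U° by apply: open_nbhs_nbhs; split => //; exact: open_interior.
by apply: filterS => v Iv; have [_ ->] := dg v Iv.
Qed.

Lemma hess_continuous i j u (t : R) : U° u -> 0 < t -> {for u, continuous (hess i j t)}.
Proof.
move=> Iu t0; have [_ c] := sol_C2 hS i j Iu t0.
have h : (v, t) @[v --> u] --> (u, t).
  move=> B [[P Q] /= [PU QT] PQ]; apply: filterS PU => v Pv.
  by apply: (PQ (v, t)); split => //=; exact: nbhs_singleton QT.
exact: (cvg_comp _ _ h c).
Qed.

Lemma hess_sym u (t : R) : U° u -> 0 < t -> hess 1 0 t u = hess 0 1 t u.
Proof.
move=> Iu t0.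
have NU : nbhs u U° by apply: open_nbhs_nbhs; split => //; exact: open_interior.
apply: (@schwarz R U° (Psi ^~ t) (fun v => g1 (v, t)) (fun v => g2 (v, t))) => //.
- by move=> v Iv; exact: (ev_d1 hP).
- by move=> v Iv; exact: (ev_d2 hP).
- by move=> v Iv; apply: (hess_derive 1) => // w Iw; exact: (ev_d1 hP).
- by move=> v Iv; apply: (hess_derive 0) => // w Iw; exact: (ev_d2 hP).
- exact: hess_continuous.
- exact: hess_continuous.
Qed.

Lemma evolution_pde u (t : R) : U° u -> 0 < t ->
  g3 (u, t) = w1 (g1 (u, t)) (g2 (u, t)) * hess 0 0 t u
    + (w2 (g1 (u, t)) (g2 (u, t)) + w2 (g2 (u, t)) (g1 (u, t))) / 2 * (hess 0 1 t u + hess 1 0 t u)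
    + w1 (g2 (u, t)) (g1 (u, t)) * hess 1 1 t u.
Proof.
move=> Iu t0; have Uu := interior_subset Iu; have t0' := ltW t0.
have [_ <-] := ev_d3 hP Iu t0; rewrite -derive1E (sol_eq hS Iu t0) evolution_grad//.
exact: (pde_operator (fun i j => hess i j t u) (evolution_triangle Uu t0')).
Qed.

(** The divergence of W (grad Psi) is the time derivative g3, which extends to the
    boundary although the second derivatives may not. *)
Lemma W_field (t : R) : 0 < t -> exists p1 q1 p2 q2,
  field U (fun u => W1 (g1 (u, t)) (g2 (u, t))) (fun u => W1 (g2 (u, t)) (g1 (u, t)))
    (fun u => g3 (u, t)) p1 q1 p2 q2.
Proof.
move=> t0; have t0' := ltW t0.
have hc := slice_c1fun hP t0'.
have T u : U u -> triangle (g1 (u, t), g2 (u, t)) by move=> Uu; exact: evolution_triangle.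
have s0 u : U u -> sin (pi * (g1 (u, t) + g2 (u, t))) != 0.
  by move=> /T/sin_triangle[_ _ /lt0r_neq0].
have s0' u : U u -> sin (pi * (g2 (u, t) + g1 (u, t))) != 0.
  by move=> Uu; rewrite [g2 _ + _]addrC; exact: s0.
have Wc (g h : (R * R) * R -> R) : {within U, continuous (fun u => g (u, t))} ->
    {within U, continuous (fun u => h (u, t))} ->
    (forall u, U u -> triangle (g (u, t), h (u, t))) ->
    {within U, continuous (fun u => W1 (g (u, t)) (h (u, t)))}.
  move=> /subspace_continuousP cg /subspace_continuousP ch Tgh.
  by apply/subspace_continuousP => u Uu; apply: W1_cvg; [exact: cg|exact: ch|exact: Tgh].
have d11 v : U° v -> is_derive v (ev true) (fun u => g1 (u, t)) (hess 0 0 t v).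
  by move=> Iv; apply: (hess_derive 0) => // w Iw; exact: (ev_d1 hP).
have d12 v : U° v -> is_derive v (ev true) (fun u => g2 (u, t)) (hess 0 1 t v).
  by move=> Iv; apply: (hess_derive 0) => // w Iw; exact: (ev_d2 hP).
have d21 v : U° v -> is_derive v (ev false) (fun u => g1 (u, t)) (hess 1 0 t v).
  by move=> Iv; apply: (hess_derive 1) => // w Iw; exact: (ev_d1 hP).
have d22 v : U° v -> is_derive v (ev false) (fun u => g2 (u, t)) (hess 1 1 t v).
  by move=> Iv; apply: (hess_derive 1) => // w Iw; exact: (ev_d2 hP).
have cc v (g h : (R * R) * R -> R) i j i' j' : U° v ->
    {within U, continuous (fun u => g (u, t))} -> {within U, continuous (fun u => h (u, t))} ->
    triangle (g (v, t), h (v, t)) ->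
    {for v, continuous (fun u => w1 (g (u, t)) (h (u, t)) * hess i j t u +
      w2 (g (u, t)) (h (u, t)) * hess i' j' t u)}.
  move=> Iv cg ch Tv.
  have {}cg := interior_continuous cg Iv; have {}ch := interior_continuous ch Iv.
  have hc1 := hess_continuous (i := i) (j := j) Iv t0; have hc2 := hess_continuous (i := i') (j := j') Iv t0.
  have h1 := w1_cvg (nbhs_filter v) cg ch Tv; have h2 := w2_cvg (nbhs_filter v) cg ch Tv.
  have H := cvgD (cvgM h1 hc1) (cvgM h2 hc2); exact: H.
exists (fun u => w1 (g1 (u, t)) (g2 (u, t)) * hess 0 0 t u + w2 (g1 (u, t)) (g2 (u, t)) * hess 0 1 t u),
  (fun u => w1 (g1 (u, t)) (g2 (u, t)) * hess 1 0 t u + w2 (g1 (u, t)) (g2 (u, t)) * hess 1 1 t u),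
  (fun u => w1 (g2 (u, t)) (g1 (u, t)) * hess 0 1 t u + w2 (g2 (u, t)) (g1 (u, t)) * hess 0 0 t u),
  (fun u => w1 (g2 (u, t)) (g1 (u, t)) * hess 1 1 t u + w2 (g2 (u, t)) (g1 (u, t)) * hess 1 0 t u).
have c1 := c1_c1 hc; have c2 := c1_c2 hc.
have T' u : U u -> triangle (g2 (u, t), g1 (u, t)) by move=> /T; exact: triangle_sym.
split.
- exact: Wc.
- exact: Wc.
- exact: (space_slice (ev_c3 hP) t0').
- by move=> v Iv; apply: (W1_derive (d11 v Iv) (d12 v Iv)); exact: (s0 _ (interior_subset Iv)).
- by move=> v Iv; apply: (W1_derive (d21 v Iv) (d22 v Iv)); exact: (s0 _ (interior_subset Iv)).
- by move=> v Iv; apply: (W1_derive (d12 v Iv) (d11 v Iv)); exact: (s0' _ (interior_subset Iv)).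
- by move=> v Iv; apply: (W1_derive (d22 v Iv) (d21 v Iv)); exact: (s0' _ (interior_subset Iv)).
- by move=> v Iv; apply: cc => //; exact: (T _ (interior_subset Iv)).
- by move=> v Iv; apply: cc => //; exact: (T _ (interior_subset Iv)).
- by move=> v Iv; apply: cc => //; exact: (T' _ (interior_subset Iv)).
- by move=> v Iv; apply: cc => //; exact: (T' _ (interior_subset Iv)).
- move=> v Iv; rewrite (evolution_pde Iv t0) (hess_sym Iv t0).
  have E (A B C D x y z : R) : A * x + (B + D) / 2 * (y + y) + C * z = A * x + B * y + (C * z + D * y).
    by field.
  exact: E.
Qed.
End solution.

(** * The comparison principle *)

(** The first and second derivatives of f along the lines through u. *)
Lemma min_gradient_hessian (R : realType) (O : set (R * R)) (f p q r11 r12 r21 r22 : R * R -> R)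
    (u : R * R) : open O -> O u ->
  (forall v, O v -> is_derive v (ev true) f (p v)) ->
  (forall v, O v -> is_derive v (ev false) f (q v)) ->
  (forall v, O v -> is_derive v (ev true) p (r11 v)) ->
  (forall v, O v -> is_derive v (ev false) p (r12 v)) ->
  (forall v, O v -> is_derive v (ev true) q (r21 v)) ->
  (forall v, O v -> is_derive v (ev false) q (r22 v)) ->
  (forall v, O v -> {for v, continuous p}) -> (forall v, O v -> {for v, continuous q}) ->
  {for u, continuous r11} -> {for u, continuous r12} ->
  {for u, continuous r21} -> {for u, continuous r22} ->
  (forall v, O v -> f u <= f v) ->
  [/\ p u = 0, q u = 0 &
    forall x y, 0 <= x ^+ 2 * r11 u + x * y * (r12 u + r21 u) + y ^+ 2 * r22 u].
Proof.
move=> oO Ou dp dq d11 d12 d21 d22 cp cq c11 c12 c21 c22 umin.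
have NO v : O v -> nbhs v O by move=> Ov; exact: open_nbhs_nbhs.
pose c (x y s : R) : R * R := (u.1 + s * x, u.2 + s * y).
have c0 x y : c x y 0 = u by rewrite /c !mul0r !addr0; case: (u).
have aff (a b s : R) : is_derive s 1 (fun s : R => a + s * b) b.
  by apply: is_derive_eq; rewrite /GRing.scale/=; ring.
have line x y : exists2 e, 0 < e & forall s, `|s| < e -> O (c x y s).
  have cc : c x y s @[s --> (0 : R)] --> u.
    have h (a b : R) : a + s * b @[s --> (0 : R)] --> a.
      have k : a + s * b @[s --> (0 : R)] --> a + 0 * b := is_derive_continuous (aff a b 0).
      by rewrite mul0r addr0 in k.
    have := cvg_pt (i := true) (nbhs_filter (0 : R)) (h u.1 x) (h u.2 y).
    by rewrite [pt true u.1 u.2]/pt/= -surjective_pairing.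
  have /nbhs_ballP[e e0 He] := cc _ (NO _ Ou).
  by exists e => // s se; apply: He; rewrite /ball/= sub0r normrN.
have along (g g1 g2 : R * R -> R) x y s : O (c x y s) ->
    (forall v, O v -> is_derive v (ev true) g (g1 v)) ->
    (forall v, O v -> is_derive v (ev false) g (g2 v)) ->
    {for c x y s, continuous g1} -> {for c x y s, continuous g2} ->
    is_derive s 1 (fun s => g (c x y s)) (g1 (c x y s) * x + g2 (c x y s) * y).
  by move=> Oc h1 h2 k1 k2; exact: (@chain_curve R O g g1 g2 (fun s => u.1 + s * x)
    (fun s => u.2 + s * y) s x y (NO _ Oc) h1 h2 k1 k2 (aff _ _ _) (aff _ _ _)).
have first x y : p u * x + q u * y = 0.
  have [e e0 He] := line x y.
  have in_e s : s \in `]-e, e[ -> `|s| < e by rewrite in_itv/= ltr_norml.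
  have ee : - e <= e by rewrite (le_trans (y := 0)) ?oppr_le0 ?ltW.
  have h0 : (0 : R) \in `]-e, e[ by rewrite in_itv/= oppr_lt0 e0.
  have [||_ D0] := @derive1_at_min R (fun s => f (c x y s)) (- e) e 0 ee _ h0.
  - move=> s /in_e/He Os; have [] := along f p q x y s Os dp dq (cp _ Os) (cq _ Os).
    by [].
  - by move=> s /in_e/He Os; rewrite c0; exact: umin.
  have Oc : O (c x y 0) by rewrite c0.
  have [_] := along f p q x y 0 Oc dp dq (cp _ Oc) (cq _ Oc).
  by rewrite D0 c0.
split.
- by have := first 1 0; rewrite mulr1 mulr0 addr0.
- by have := first 0 1; rewrite mulr1 mulr0 add0r.
move=> x y; have [e e0 He] := line x y.
have Oc : O (c x y 0) by rewrite c0.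
have D1 (s : R) : `|s| < e -> is_derive s 1 (fun s => f (c x y s)) (p (c x y s) * x + q (c x y s) * y).
  by move=> /He Os; exact: (along f p q x y s Os dp dq (cp _ Os) (cq _ Os)).
have hp : is_derive (0 : R) 1 (fun s => p (c x y s)) (r11 u * x + r12 u * y).
  by have := along p r11 r12 x y 0 Oc d11 d12; rewrite c0; apply.
have hq : is_derive (0 : R) 1 (fun s => q (c x y s)) (r21 u * x + r22 u * y).
  by have := along q r21 r22 x y 0 Oc d21 d22; rewrite c0; apply.
have D2 := is_deriveD (is_deriveZ x hp) (is_deriveZ y hq).
have {}D2 : is_derive (0 : R) 1 (fun s => p (c x y s) * x + q (c x y s) * y)
    (x * (r11 u * x + r12 u * y) + y * (r21 u * x + r22 u * y)).
  move: D2; set F := (F in is_derive _ _ F _) => D2.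
  have -> : (fun s => p (c x y s) * x + q (c x y s) * y) = F.
    by apply/funext => s; rewrite [_ * x]mulrC [_ * y]mulrC.
  exact: D2.
have := second_derivative_ge0 e0 D1 _ D2.
rewrite (_ : _ + y * _ = x ^+ 2 * r11 u + x * y * (r12 u + r21 u) + y ^+ 2 * r22 u); last by ring.
by apply=> s /He Os; rewrite c0; exact: umin.
Qed.

Lemma left_min_derive (R : realType) (f : R -> R) (t d : R) : 0 < t ->
  is_derive t 1 f d -> (forall s, 0 <= s <= t -> f t <= f s) -> d <= 0.
Proof.
move=> t0 /is_derive_cvgP df tmin.
have {}df : h^-1 *: (f (h *: 1 + t) - f t) @[h --> (0 : R)^'-] --> d.
  apply: cvg_trans df; apply: cvg_app; apply: within_subset.
  by move=> x /= x0; rewrite lt_eqF.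
apply: (ler_cvg_to df (cvg_cst 0)); near=> h.
have h0 : h < 0 by near: h; exact: nbhs_left_lt.
have ht : - t < h by near: h; apply: nbhs_left_gt; rewrite oppr_lt0.
rewrite [_ *: _]/(_ * _) nmulr_rle0 ?invr_lt0// subr_ge0; apply: tmin.
by rewrite [h *: 1]mulr1; apply/andP; split; lra.
Unshelve. all: by end_near. Qed.

Section comparison.
Variables (R : realType) (U : set (R * R)) (psi1 psi2 : R * R -> R) (Psi1 Psi2 : R * R -> R -> R).
Variables (g1 g2 g3 h1 h2 h3 : (R * R) * R -> R).
Hypotheses (U0 : U !=set0) (cU : compact U) (clU : closure U° = U).
Hypotheses (hS1 : classical_solution U psi1 Psi1) (hS2 : classical_solution U psi2 Psi2).
Hypotheses (hP1 : evolution U Psi1 g1 g2 g3) (hP2 : evolution U Psi2 h1 h2 h3).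
Hypothesis hle : forall u, U u -> psi2 u <= psi1 u.
Hypothesis hbd : forall u, bdry U u -> psi1 u = psi2 u.

(** At an interior minimum of Psi1 - Psi2 + e t the gradients agree, so that the two
    equations have the same coefficients there. The second derivatives are ordered
    by [min_gradient_hessian] and [elliptic], hence so are the time derivatives,
    while minimality in time requires that of Psi1 - Psi2 to be at most - e. *)
Lemma no_interior_minimum (e : R) (u : R * R) (t : R) : U° u -> 0 < t ->
  (forall v, U° v -> Psi1 u t - Psi2 u t <= Psi1 v t - Psi2 v t) ->
  (forall s, 0 <= s <= t -> Psi1 u t - Psi2 u t + e * t <= Psi1 u s - Psi2 u s + e * s) ->
  e <= 0.
Proof.
move=> Iu t0 spacemin timemin; have Uu := interior_subset Iu; have t0' := ltW t0.
have d1 i j (g : (R * R) * R -> R) v : (forall v, U° v -> is_derive v (e2 R j) (Psi1 ^~ t) (g (v, t))) ->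
  U° v -> is_derive v (e2 R i) (fun v => g (v, t)) (hess Psi1 i j t v).
  by move=> dg Iv; exact: (hess_derive hS1 i dg Iv t0).
have d2 i j (g : (R * R) * R -> R) v : (forall v, U° v -> is_derive v (e2 R j) (Psi2 ^~ t) (g (v, t))) ->
  U° v -> is_derive v (e2 R i) (fun v => g (v, t)) (hess Psi2 i j t v).
  by move=> dg Iv; exact: (hess_derive hS2 i dg Iv t0).
have c1 i j : {for u, continuous (hess Psi1 i j t)} by exact: (hess_continuous hS1).
have c2 i j : {for u, continuous (hess Psi2 i j t)} by exact: (hess_continuous hS2).
have cB (f g : R * R -> R) v : {for v, continuous f} -> {for v, continuous g} ->
    {for v, continuous (fun v => f v - g v)}.
  by move=> cf cg; exact: (cvgB cf cg).
have k1 := slice_c1fun hP1 t0'; have k2 := slice_c1fun hP2 t0'.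
have k := c1funB k1 k2.
have dH1 v : U° v -> is_derive v (ev true) (Psi1 ^~ t) (g1 (v, t)) by move=> Iv; exact: (ev_d1 hP1).
have dH2 v : U° v -> is_derive v (ev false) (Psi1 ^~ t) (g2 (v, t)) by move=> Iv; exact: (ev_d2 hP1).
have dK1 v : U° v -> is_derive v (ev true) (Psi2 ^~ t) (h1 (v, t)) by move=> Iv; exact: (ev_d1 hP2).
have dK2 v : U° v -> is_derive v (ev false) (Psi2 ^~ t) (h2 (v, t)) by move=> Iv; exact: (ev_d2 hP2).
have [] := @min_gradient_hessian R U° (fun v => Psi1 v t - Psi2 v t) (fun v => g1 (v, t) - h1 (v, t))
  (fun v => g2 (v, t) - h2 (v, t)) (fun v => hess Psi1 0 0 t v - hess Psi2 0 0 t v)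
  (fun v => hess Psi1 1 0 t v - hess Psi2 1 0 t v) (fun v => hess Psi1 0 1 t v - hess Psi2 0 1 t v)
  (fun v => hess Psi1 1 1 t v - hess Psi2 1 1 t v) u (@open_interior _ U) Iu.
- by move=> v Iv; exact: (c1_d1 k Iv).
- by move=> v Iv; exact: (c1_d2 k Iv).
- by move=> v Iv; exact: (is_deriveB (d1 0 0 g1 v dH1 Iv) (d2 0 0 h1 v dK1 Iv)).
- by move=> v Iv; exact: (is_deriveB (d1 1 0 g1 v dH1 Iv) (d2 1 0 h1 v dK1 Iv)).
- by move=> v Iv; exact: (is_deriveB (d1 0 1 g2 v dH2 Iv) (d2 0 1 h2 v dK2 Iv)).
- by move=> v Iv; exact: (is_deriveB (d1 1 1 g2 v dH2 Iv) (d2 1 1 h2 v dK2 Iv)).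
- by move=> v Iv; exact: (interior_continuous (c1_c1 k) Iv).
- by move=> v Iv; exact: (interior_continuous (c1_c2 k) Iv).
- exact: (cB _ _ _ (c1 _ _) (c2 _ _)).
- exact: (cB _ _ _ (c1 _ _) (c2 _ _)).
- exact: (cB _ _ _ (c1 _ _) (c2 _ _)).
- exact: (cB _ _ _ (c1 _ _) (c2 _ _)).
- exact: spacemin.
move=> /eqP E1 /eqP E2 quad.
have {}E1 : h1 (u, t) = g1 (u, t) by apply/eqP; rewrite eq_sym -subr_eq0.
have {}E2 : h2 (u, t) = g2 (u, t) by apply/eqP; rewrite eq_sym -subr_eq0.
have ell := elliptic (evolution_triangle clU hS1 hP1 Uu t0') quad.
have p1 := evolution_pde clU hS1 hP1 Iu t0; have p2 := evolution_pde clU hS2 hP2 Iu t0.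
rewrite E1 E2 in p2.
have grow : 0 <= g3 (u, t) - h3 (u, t).
  rewrite p1 p2; apply: le_trans ell _; rewrite le_eqVlt; apply/orP; left; apply/eqP.
  have alg (A B C x y z w x' y' z' w' : R) : A * (x - x') + B * (y - y' + (z - z')) + C * (w - w') =
      A * x + B * (z + y) + C * w - (A * x' + B * (z' + y') + C * w') by ring.
  exact: alg.
have dt : is_derive t 1 (fun s : R => Psi1 u s - Psi2 u s + e * s) (g3 (u, t) - h3 (u, t) + e).
  have := is_deriveD (is_deriveB (ev_d3 hP1 Iu t0) (ev_d3 hP2 Iu t0)) (is_deriveZ e (is_derive_id t (1 : R))).
  by congr is_derive; congr (_ + _); exact: mulr1.
by apply: le_trans (left_min_derive t0 dt timemin); rewrite lerDr.
Qed.

(** The minimum of Psi1 - Psi2 + e t over U and the times up to t is attained at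
    time 0 or on the boundary, where it is nonnegative; let e tend to 0. *)
Lemma comparison u (t : R) : U u -> 0 <= t -> Psi2 u t <= Psi1 u t.
Proof.
move=> Uu t0; rewrite -subr_ge0.
have key (e : R) : 0 < e -> 0 <= Psi1 u t - Psi2 u t + e * t.
  move=> e0; pose F (p : (R * R) * R) := Psi1 p.1 p.2 - Psi2 p.1 p.2 + e * p.2.
  pose A : set ((R * R) * R) := U `*` `[0, t].
  have AU : A `<=` U `*` future by move=> p [Up]; rewrite /= in_itv/= => /andP[p0 _].
  have A0 : A !=set0.
    by have [v Uv] := U0; exists (v, 0); split => //=; rewrite in_itv/= lexx.
  have cA : compact A by apply: compact_setX => //; exact: segment_compact.
  have cF : {within A, continuous F}.
    apply: (continuous_subspaceW AU).
    apply: within_continuousD; first by apply: within_continuousB; [exact: (ev_c hP1)|exact: (ev_c hP2)].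
    apply: withinM; first exact: within_cst.
    by apply: continuous_subspaceT => p; exact: cvg_snd.
  have [[v s] vsA Fmin] := compact_EVT_min A0 cA cF.
  have Fm w r : U w -> 0 <= r <= t -> F (v, s) <= F (w, r).
    by move=> Uw rt; apply: Fmin; rewrite inE; split=> //=; rewrite in_itv.
  have [Uv st] : U v /\ 0 <= s <= t by move: vsA; rewrite inE => -[/=]; rewrite in_itv.
  have [s0 s1] := andP st.
  apply: (@le_trans _ _ (F (v, s))); last by apply: (Fm u t); rewrite ?t0 ?lexx.
  have [s00|sn0] := eqVneq s 0.
    rewrite /F/= s00 mulr0 addr0 (sol_init hS1 Uv) (sol_init hS2 Uv) subr_ge0.
    exact: hle.
  have sp : 0 < s by rewrite lt_neqAle eq_sym sn0.
  have [Iv|nIv] := pselect (U° v); last first.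
    have bv : bdry U v by split=> //; exact: subset_closure.
    rewrite /F/= (sol_bdry hS1 bv s0) (sol_bdry hS2 bv s0) hbd// subrr add0r.
    by rewrite mulr_ge0// ltW.
  have := @no_interior_minimum e v s Iv sp _ _; rewrite leNgt e0 => H.
  exfalso; suff : false by []. apply: H.
  - move=> w Iw; have := Fm w s (interior_subset Iw) st.
    by rewrite /F/= lerD2r.
  - move=> r /andP[r0 rs]; apply: (Fm v r Uv).
    by rewrite r0 (le_trans rs s1).
apply/ler_addgt0Pr => e e0.
have t1 : 0 < t + 1 by rewrite ltr_wpDl.
have := key (e / (t + 1)); rewrite divr_gt0// => /(_ isT) h.
apply: le_trans h _; rewrite lerD2l mulrAC ler_pdivrMr// ler_wpM2l ?ltW//.
by rewrite ltrDl.
Qed.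
End comparison.

(** * The time derivative of the volume *)

Section time_derivative.
Variables (R : realType) (U : set (R * R)) (gamma : R -> R * R) (L : R) (n : R * R -> R * R).
Variables (psi0 : R * R -> R) (Psi : R * R -> R -> R) (g1 g2 g3 : (R * R) * R -> R).
Hypothesis hU : smooth_sc_domain U gamma L.
Hypothesis hn : exterior_unit_normal U gamma n.
Hypothesis hS : classical_solution U psi0 Psi.
Hypothesis hP : evolution U Psi g1 g2 g3.
Let cU : compact U := domain_compact hU.
Let clU : closure U° = U := dom_closure hU.
Let lambda2 := (@lebesgue_measure R \x @lebesgue_measure R)%E.

(** The mean value theorem in time at interior points of U. The inequality is closed
    in x, hence extends to the boundary. *)
Lemma time_increment (t h e : R) : 0 <= t -> future (t + h) ->
  (forall x t', U x -> future t' -> `|t' - t| <= `|h| -> `|g3 (x, t') - g3 (x, t)| <= e) ->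
  forall x, U x -> `|Psi x (t + h) - Psi x t - g3 (x, t) * h| <= e * `|h|.
Proof.
move=> t0 th0 close.
have [->|h0] := eqVneq h 0.
  by move=> x _; rewrite addr0 subrr mulr0 subrr normr0 mulr0.
have inner x : U° x -> `|Psi x (t + h) - Psi x t - g3 (x, t) * h| <= e * `|h|.
  move=> Ix; have Ux := interior_subset Ix.
  have m0 : 0 <= Num.min t (t + h) by rewrite le_min t0.
  have tth : t != t + h by rewrite -{1}[t]addr0 (inj_eq (addrI t)) eq_sym.
  have dP (z : R) : Num.min t (t + h) < z < Num.max t (t + h) ->
      is_derive z 1 (Psi x) ((fun z => g3 (x, z)) z).
    by move=> /andP[z0 _]; apply: (ev_d3 hP Ix); exact: le_lt_trans z0.
  have cP : {within `[Num.min t (t + h), Num.max t (t + h)], continuous (Psi x)}.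
    apply: continuous_subspaceW (time_slice (ev_c hP) Ux) => z.
    by rewrite /= in_itv/= => /andP[z0 _]; exact: le_trans z0.
  have [z /andP[z0 z1] ->] := mvt_gen tth dP cP.
  rewrite [t + h]addrC addrK -mulrBl normrM ler_wpM2r//; apply: close => //.
    by apply: le_trans m0 _; exact: ltW.
  move: z0 z1; rewrite gt_min lt_max; have [hp|hn'] := leP 0 h => z0 z1.
    rewrite ger0_norm ?(ger0_norm hp).
      case/orP: z1 => z1; last by rewrite lerBlDl ltW.
      by rewrite lerBlDl (le_trans (ltW z1))// lerDl.
    by rewrite subr_ge0; case/orP: z0 => z0; [exact: ltW|rewrite (le_trans _ (ltW z0))// lerDl].
  rewrite distrC ger0_norm ?(ltr0_norm hn').
    case/orP: z0 => z0; last by rewrite lerBlDl -lerBlDr opprK ltW.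
    by rewrite lerBlDl -lerBlDr opprK (le_trans _ (ltW z0))// gerDl ltW.
  by rewrite subr_ge0; case/orP: z1 => z1; [exact: ltW|rewrite (le_trans (ltW z1))// gerDl ltW].
move=> x Ux.
have PF : ProperFilter (within U° (nbhs x)) by apply: within_nbhs_proper; rewrite /infer clU.
have cf : {within U, continuous (fun x => Psi x (t + h) - Psi x t - g3 (x, t) * h)}.
  apply: within_continuousB.
    by apply: within_continuousB; exact: (space_slice (ev_c hP)).
  by apply: withinM; [exact: (space_slice (ev_c3 hP))|exact: within_cst].
have /subspace_continuousP/(_ x Ux) cx := cf.
have {}cx : Psi v (t + h) - Psi v t - g3 (v, t) * h @[v --> within U° (nbhs x)] -->
    Psi x (t + h) - Psi x t - g3 (x, t) * h.
  by apply: cvg_trans cx; apply: cvg_app; apply: within_subset; exact: interior_subset.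
apply: (ler_cvg_to (cvg_norm cx) (cvg_cst (e * `|h|))).
by rewrite near_withinE; apply: nearW; exact: inner.
Qed.

Lemma volume_derive (t : R) : 0 <= t ->
  is_time_derivative (fun s => volume U (Psi ^~ s)) t (\int[lambda2]_(u in U) g3 (u, t)).
Proof.
move=> t0.
apply: (@derive_param_integral R _ _ lambda2 U future Psi (fun u t => g3 (u, t)) t).
- exact: compact_measurable2.
- exact: compact_measure_fin.
- exact: t0.
- by move=> s s0; apply: (integrable2 cU); exact: (space_slice (ev_c hP)).
- by apply: (integrable2 cU); exact: (space_slice (ev_c3 hP)).
- by move=> e e0; have H := unif_near cU (T := future) t0 (ev_c3 hP) e0; exact: H.
- by move=> h e th close; exact: time_increment.
Qed.

Lemma within_curve (g : (R * R) * R -> R) : {within U `*` future, continuous g} ->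
  {within `[0, L] `*` future, continuous (fun p : R * R => g (gamma p.1, p.2))}.
Proof.
move=> /subspace_continuousP cg; apply/subspace_continuousP => -[s t] [_ /= t0].
have Us x : U (gamma x) := curve_in_domain hU x.
move=> B /(cg (gamma s, t) (conj (Us s) t0)).
move=> [[P Q] /= [PU QT] PQ].
have cs := curve_continuous (dom_boundary hU) (x := s) PU.
exists (gamma @^-1` P, Q) => //= -[x y] [/= Px Qy] [_ y0].
by apply: (PQ (gamma x, y)); split => //=; exact: Us.
Qed.

Definition boundary_flux (s t : R) : R :=
  dot (W (g1 (gamma s, t), g2 (gamma s, t))) (n (gamma s)).

Lemma boundary_flux_continuous :
  {within `[0, L] `*` future, continuous (fun p : R * R => boundary_flux p.1 p.2)}.
Proof.
have wn i : {within `[0, L] `*` future, continuous (fun p : R * R => pa i (n (gamma p.1)))}.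
  apply: continuous_subspaceT => p.
  by apply: (continuous_fst (h := fun s => pa i (n (gamma s)))); exact: (normal_continuous hU hn).
have c1 := within_curve (ev_c1 hP); have c2 := within_curve (ev_c2 hP).
have tri (p : R * R) : (`[0, L] `*` future) p ->
    triangle (g1 (gamma p.1, p.2), g2 (gamma p.1, p.2)).
  by move=> [_ p0]; apply: (evolution_triangle clU hS hP) => //; exact: (curve_in_domain hU).
have cW1 : {within `[0, L] `*` future, continuous (fun p : R * R =>
    W1 (g1 (gamma p.1, p.2)) (g2 (gamma p.1, p.2)))}.
  have /subspace_continuousP k1 := c1; have /subspace_continuousP k2 := c2.
  by apply/subspace_continuousP => p Ap; apply: W1_cvg; [exact: k1|exact: k2|exact: tri].
have cW2 : {within `[0, L] `*` future, continuous (fun p : R * R =>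
    W1 (g2 (gamma p.1, p.2)) (g1 (gamma p.1, p.2)))}.
  have /subspace_continuousP k1 := c1; have /subspace_continuousP k2 := c2.
  by apply/subspace_continuousP => p Ap; apply: W1_cvg;
    [exact: k2|exact: k1|apply: triangle_sym; exact: tri].
exact: (within_continuousD (withinM cW1 (wn true)) (withinM cW2 (wn false))).
Qed.

Lemma boundary_flux_integrable (t : R) : 0 <= t ->
  (@lebesgue_measure R).-integrable `[0, L] (EFin \o (fun s => boundary_flux s t)).
Proof.
move=> t0; apply: integrable_seg.
have /subspace_continuousP c := boundary_flux_continuous.
apply/subspace_continuousP => s sL.
apply: cvg_trans (c (s, t) (conj sL t0)).
move=> B [[P Q] /= [PU QT] PQ]; rewrite /within/= in PQ *.
apply: filterS PU => x Px xL; apply: (PQ (x, t)); split => //=.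
exact: nbhs_singleton QT.
Qed.

(** The divergence theorem at positive times. The equation is not assumed at time 0,
    where both sides are the limits of their values at positive times. *)
Lemma area_flux (t : R) : 0 <= t ->
  \int[lambda2]_(u in U) g3 (u, t) = \int[lebesgue_measure]_(s in `[0, L]) boundary_flux s t.
Proof.
have pos (s : R) : 0 < s ->
    \int[lambda2]_(u in U) g3 (u, s) = \int[lebesgue_measure]_(x in `[0, L]) boundary_flux x s.
  move=> s0; have [p1 [q1 [p2 [q2 hF]]]] := W_field clU hS hP s0.
  exact: (divergence_theorem hU hn hF).
rewrite le_eqVlt => /orP[/eqP<-|]; last exact: pos.
have f0 : future (0 : R) by rewrite /future/= lexx.
have right (f : R -> R) l : f s @[s --> within future (nbhs (0 : R))] --> l -> f s @[s --> 0^'+] --> l.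
  move=> cf; apply: cvg_trans cf; apply: cvg_app; apply: within_subset.
  by move=> x /= /ltW.
have cA : \int[lambda2]_(u in U) g3 (u, s) @[s --> 0^'+] --> \int[lambda2]_(u in U) g3 (u, 0).
  apply: right; apply: (@cvg_param_integral R _ _ _ lambda2 U future (fun u t => g3 (u, t))) => //.
  - exact: compact_measurable2.
  - exact: compact_measure_fin.
  - by move=> s s0; apply: (integrable2 cU); exact: (space_slice (ev_c3 hP)).
  - by move=> e e0; have H := unif_near cU (T := future) f0 (ev_c3 hP) e0; exact: H.
have cB : \int[lebesgue_measure]_(x in `[0, L]) boundary_flux x s @[s --> 0^'+] -->
    \int[lebesgue_measure]_(x in `[0, L]) boundary_flux x 0.
  apply: right; apply: (@cvg_param_integral R _ _ _ (@lebesgue_measure R) `[0, L]%classic future boundary_flux) => //.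
  - exact: segment_measure_fin.
  - exact: boundary_flux_integrable.
  - by move=> e e0; have H := unif_near (@segment_compact R 0 L) (T := future) f0 boundary_flux_continuous e0; exact: H.
have cB' : \int[lambda2]_(u in U) g3 (u, s) @[s --> 0^'+] -->
    \int[lebesgue_measure]_(x in `[0, L]) boundary_flux x 0.
  apply: cvg_trans cB; apply: near_eq_cvg; apply: filterS (nbhs_right_gt (0 : R)) => s s0.
  by rewrite pos.
transitivity (lim (\int[lambda2]_(u in U) g3 (u, s) @[s --> 0^'+])).
  by apply/esym; exact: (cvg_lim _ cA).
exact: (cvg_lim _ cB').
Qed.
End time_derivative.

(** * Conclusion *)

Lemma volume_flux_derive (R : realType) (U : set (R * R)) (gamma : R -> R * R) (L : R)
    (n : R * R -> R * R) (psi1 psi2 : R * R -> R) (Psi1 Psi2 : R * R -> R -> R) (t : R) :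
  smooth_sc_domain U gamma L -> exterior_unit_normal U gamma n ->
  classical_solution U psi1 Psi1 -> classical_solution U psi2 Psi2 -> 0 <= t ->
  is_time_derivative (fun s => volume U (Psi1 ^~ s) - volume U (Psi2 ^~ s)) t
    (curve_integral gamma L
      (fun u => dot (W (grad U (Psi1 ^~ t) u) - W (grad U (Psi2 ^~ t) u)) (n u))).
Proof.
move=> hU hn hS1 hS2 t0; have clU := dom_closure hU.
have [g1 [g2 [g3 hP1]]] := solution_evolution hS1.
have [h1 [h2 [h3 hP2]]] := solution_evolution hS2.
have D1 := volume_derive hU hP1 t0; have D2 := volume_derive hU hP2 t0.
rewrite (area_flux hU hn hS1 hP1 t0) in D1; rewrite (area_flux hU hn hS2 hP2 t0) in D2.
have -> : curve_integral gamma L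
    (fun u => dot (W (grad U (Psi1 ^~ t) u) - W (grad U (Psi2 ^~ t) u)) (n u)) =
    \int[lebesgue_measure]_(s in `[0, L]) boundary_flux gamma n g1 g2 s t -
    \int[lebesgue_measure]_(s in `[0, L]) boundary_flux gamma n h1 h2 s t.
  rewrite -RintegralB//.
  - apply: eq_Rintegral => s _; have Us := curve_in_domain hU s.
    rewrite (evolution_grad clU hP1 Us t0) (evolution_grad clU hP2 Us t0).
    by rewrite /boundary_flux /dot/= !mulrBl opprD addrACA.
  - exact: (boundary_flux_integrable hU hn hS1 hP1 t0).
  - exact: (boundary_flux_integrable hU hn hS2 hP2 t0).
rewrite /is_time_derivative.
have -> : (fun h : R => h^-1 * (volume U (Psi1 ^~ (t + h)) - volume U (Psi2 ^~ (t + h)) -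
    (volume U (Psi1 ^~ t) - volume U (Psi2 ^~ t)))) =
    (fun h : R => h^-1 * (volume U (Psi1 ^~ (t + h)) - volume U (Psi1 ^~ t)) -
      h^-1 * (volume U (Psi2 ^~ (t + h)) - volume U (Psi2 ^~ t))).
  by apply/funext => h; ring.
exact: (cvgB D1 D2).
Qed.

Lemma solution_flux_le0 (R : realType) (U : set (R * R)) (gamma : R -> R * R) (L : R)
    (n : R * R -> R * R) (psi1 psi2 : R * R -> R) (Psi1 Psi2 : R * R -> R -> R) (t : R) :
  smooth_sc_domain U gamma L -> exterior_unit_normal U gamma n ->
  (forall u, U u -> psi2 u <= psi1 u) -> (forall u, bdry U u -> psi1 u = psi2 u) ->
  classical_solution U psi1 Psi1 -> classical_solution U psi2 Psi2 -> 0 <= t ->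
  curve_integral gamma L
    (fun u => dot (W (grad U (Psi1 ^~ t) u) - W (grad U (Psi2 ^~ t) u)) (n u)) <= 0.
Proof.
move=> hU hn hle hbd hS1 hS2 t0; have clU := dom_closure hU.
have [g1 [g2 [g3 hP1]]] := solution_evolution hS1.
have [h1 [h2 [h3 hP2]]] := solution_evolution hS2.
have -> : curve_integral gamma L
    (fun u => dot (W (grad U (Psi1 ^~ t) u) - W (grad U (Psi2 ^~ t) u)) (n u)) =
    curve_integral gamma L (fun u => dot (W (g1 (u, t), g2 (u, t)) - W (h1 (u, t), h2 (u, t))) (n u)).
  apply: eq_Rintegral => s _; have Us := curve_in_domain hU s.
  by rewrite (evolution_grad clU hP1 Us t0) (evolution_grad clU hP2 Us t0).
apply: (flux_comparison (G1 := fun u => (g1 (u, t), g2 (u, t)))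
  (G2 := fun u => (h1 (u, t), h2 (u, t))) hU hn (slice_c1fun hP1 t0) (slice_c1fun hP2 t0)).
- by move=> u Uu; exact: (evolution_triangle clU hS1 hP1 Uu t0).
- by move=> u Uu; exact: (evolution_triangle clU hS2 hP2 Uu t0).
- move=> u Uu.
  exact: (comparison (dom_nonempty hU) (domain_compact hU) clU hS1 hS2 hP1 hP2 hle hbd Uu t0).
- by move=> u bu; rewrite (sol_bdry hS1 bu t0) (sol_bdry hS2 bu t0) hbd.
Qed.

Lemma initial_flux_le0 (R : realType) (U : set (R * R)) (gamma : R -> R * R) (L : R)
    (n : R * R -> R * R) (psi1 psi2 : R * R -> R) :
  smooth_sc_domain U gamma L -> exterior_unit_normal U gamma n ->
  smooth_on U psi1 -> smooth_on U psi2 ->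
  (forall u, U u -> triangle (grad U psi1 u)) -> (forall u, U u -> triangle (grad U psi2 u)) ->
  (forall u, U u -> psi2 u <= psi1 u) -> (forall u, bdry U u -> psi1 u = psi2 u) ->
  curve_integral gamma L (fun u => dot (W (grad U psi1 u) - W (grad U psi2 u)) (n u)) <= 0.
Proof.
move=> hU hn hs1 hs2 hT1 hT2 hle hbd; have clU := dom_closure hU.
have [p1 [q1 c1]] := smooth_c1fun hs1; have [p2 [q2 c2]] := smooth_c1fun hs2.
have -> : curve_integral gamma L (fun u => dot (W (grad U psi1 u) - W (grad U psi2 u)) (n u)) =
    curve_integral gamma L (fun u => dot (W (p1 u, q1 u) - W (p2 u, q2 u)) (n u)).
  apply: eq_Rintegral => s _; have Us := curve_in_domain hU s.
  by rewrite (c1fun_grad clU c1 Us) (c1fun_grad clU c2 Us).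
apply: (flux_comparison (G1 := fun u => (p1 u, q1 u)) (G2 := fun u => (p2 u, q2 u))
  hU hn c1 c2) => //.
- by move=> u Uu; rewrite -(c1fun_grad clU c1 Uu); exact: hT1.
- by move=> u Uu; rewrite -(c1fun_grad clU c2 Uu); exact: hT2.
Qed.

Unset Implicit Arguments.
Set Strict Implicit.
Set Printing Implicit Defensive.

Theorem mainTheorem4 (R : realType) (U : set (R * R)) (gamma : R -> R * R)
  (L : R) (n : R * R -> R * R) (psi1 psi2 : R * R -> R)
  (hU : smooth_sc_domain U gamma L)
  (hn : exterior_unit_normal U gamma n)
  (hs1 : smooth_on U psi1) (hs2 : smooth_on U psi2)
  (hT1 : forall u, U u -> triangle (grad U psi1 u))
  (hT2 : forall u, U u -> triangle (grad U psi2 u))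
  (hle : forall u, U u -> psi2 u <= psi1 u)
  (hbd : forall u, bdry U u -> psi1 u = psi2 u) :
  curve_integral gamma L
    (fun u => dot (W (grad U psi1 u) - W (grad U psi2 u)) (n u)) <= 0 /\
  (forall (Psi1 Psi2 : R * R -> R -> R),
    classical_solution U psi1 Psi1 -> classical_solution U psi2 Psi2 ->
    forall t : R, 0 <= t ->
      is_time_derivative
        (fun s => volume U (Psi1 ^~ s) - volume U (Psi2 ^~ s)) t
        (curve_integral gamma L
          (fun u => dot (W (grad U (Psi1 ^~ t) u) - W (grad U (Psi2 ^~ t) u))
                        (n u))) /\
      curve_integral gamma L
        (fun u => dot (W (grad U (Psi1 ^~ t) u) - W (grad U (Psi2 ^~ t) u))
                      (n u)) <= 0).
Proof.
split; first exact: (initial_flux_le0 hU hn hs1 hs2 hT1 hT2 hle hbd).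
move=> Psi1 Psi2 hS1 hS2 t t0; split; first exact: (volume_flux_derive hU hn hS1 hS2 t0).
exact: (solution_flux_le0 hU hn hle hbd hS1 hS2 t0).
Qed.
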